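(* Let $0<s_1\le s_2<1$ and $0<\lambda\le\Lambda$. Let $g:(0,\infty)\to[0,\infty)$ be a strictly decreasing function satisfying $$2s_1r^{-1}g(r)\le|g'(r)|\le2s_2r^{-1}g(r)\quad\forall r>0,$$ and assume that $K$ satisfies $$\lambda|y|^{-n}g(|y|)\le K(y)\le\Lambda|y|^{-n}g(|y|),\qquad|\nabla K(y)|\le\Lambda|y|^{-1}K(y)$$ for all $y\in\mathbb R^n\setminus\{0\}$. Let $\eta\in C^{1,1}(\mathbb R^n)$ be such that $\eta\ge0$. Then there exists $\sigma_0=\sigma_0(n,s_1,s_2,\Lambda/\lambda,\|\eta\|_{C^{1,1}(\mathbb R^n)})>0$ such that for every $\sigma\ge\sigma_0$ and every smooth enough $u,v\in L^\infty(\mathbb R^n)$ $$L\big(\eta^2(\partial_eu)^2+\sigma u^2\big)\le2\eta^2L(\partial_eu)\,\partial_eu+2\sigma L(u)\,u\quad\text{in }\mathbb R^n,$$ $$L\big(\eta^2(\partial_ev)_+^2+\sigma v^2\big)\le2\eta^2L(\partial_ev)\,(\partial_ev)_++2\sigma L(v)\,v\quad\text{in }\mathbb R^n.$$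
   Context: $Lu(x)=\mathrm{p.v.}\int_{\mathbb R^n}(u(x)-u(y))K(x-y)\,dy$, where $K:\mathbb R^n\to[0,\infty]$ is symmetric, $K(y)=K(-y)$. Here $e\in\mathbb S^{n-1}$ is a direction, $\partial_e$ is the directional derivative, and $t_+=\max\{t,0\}$. ''Smooth enough'' is a qualitative requirement; no specific smoothness class is prescribed.
   Formalization: The threshold σ_0 depends on Λ/min{λ,1} in place of Λ/λ: for large λ the gradient bound, whose constant is Λ, is not controlled by Λ/λ, and with kernels oscillating fast on an annulus no σ_0 depending only on Λ/λ exists. *)

(* Defs.v *)
From HB Require Import structures.
From mathcomp Require Import all_boot all_order all_algebra.
From mathcomp Require Import all_classical all_reals all_analysis.
Set Implicit Arguments.
Unset Strict Implicit.
Unset Printing Implicit Defensive.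
Import Order.TTheory GRing.Theory Num.Theory.
Import numFieldNormedType.Exports.

Local Open Scope classical_set_scope.
Local Open Scope ring_scope.

(** Points of R^n are row vectors ['rV[R]_n], which carry the differential
    calculus of the library.  The library norm [`|x|] on them is the sup norm;
    Euclidean lengths are [enorm]. *)

Section euclidean.
Context {R : realType} {n : nat}.
Implicit Types (f : 'rV[R]_n -> R) (x : 'rV[R]_n).

Definition enorm x : R := Num.sqrt (\sum_(i < n) x ord0 i ^+ 2).

Definition grad f x : 'rV[R]_n := \row_(i < n) 'D_(delta_mx ord0 i) f x.

Fixpoint Ck (k : nat) f : Prop :=
  if k is k'.+1 then
    (forall x, differentiable f x) /\
    (forall i : 'I_n, Ck k' ('D_(delta_mx ord0 i) f))
  else continuous f.

(* sup |f| + sup |grad f| + Lipschitz seminorm of grad f; meaningful for f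
   differentiable everywhere. *)
Definition C11norm f : \bar R :=
  (ereal_sup [set `|f x|%:E | x in [set: 'rV[R]_n]]
   + ereal_sup [set (enorm (grad f x))%:E | x in [set: 'rV[R]_n]]
   + ereal_sup [set (enorm (grad f p.1 - grad f p.2) / enorm (p.1 - p.2))%:E
                 | p in [set p : 'rV[R]_n * 'rV[R]_n | p.1 != p.2]])%E.

Definition C11 f : Prop :=
  (forall x, differentiable f x) /\ (C11norm f < +oo)%E.

End euclidean.

Section lebesgue.
Context {R : realType}.

Definition consR n (p : n.-tuple (measurableTypeR R) * measurableTypeR R) :
  n.+1.-tuple (measurableTypeR R) := [tuple of p.2 :: p.1].

Lemma measurable_consR n : measurable_fun setT (@consR n).
Proof.
by apply: measurable_cons; [exact: measurable_snd|exact: measurable_fst].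
Qed.

Definition lebesgueS n
    (mu : {measure set (n.-tuple (measurableTypeR R)) -> \bar R}) :
  set (n.+1.-tuple (measurableTypeR R)) -> \bar R :=
  pushforward (mu \x @lebesgue_measure R)%E (@consR n).

Section lebesgueS_measure.
Variable n : nat.
Variable mu : {measure set (n.-tuple (measurableTypeR R)) -> \bar R}.

HB.instance Definition _ := Measure.copy (lebesgueS mu)
  (measure_function_pushforward__canonical__measure_function_Measure
     (mu \x @lebesgue_measure R)%E (@measurable_consR n)).

End lebesgueS_measure.

(* n-dimensional Lebesgue measure: the iterated product of the 1-dimensional
   one, carried by n-tuples because those have the product sigma-algebra. *)
Fixpoint lebesgueT (n : nat) :
    {measure set (n.-tuple (measurableTypeR R)) -> \bar R} :=
  if n is m.+1 then lebesgueS (lebesgueT m) else dirac [tuple].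

Definition vec n (t : n.-tuple (measurableTypeR R)) : 'rV[R]_n :=
  \row_(i < n) tnth t i.

End lebesgue.

Section operator.
Context {R : realType} {n : nat}.
Implicit Types (K : 'rV[R]_n -> \bar R) (w : 'rV[R]_n -> R) (x : 'rV[R]_n).

Definition Lintegrand K w x (t : n.-tuple (measurableTypeR R)) :
  \bar R :=
  ((w x - w (vec t))%R%:E * K (x - vec t)%R)%E.

Definition outside x (eps : R) : set (n.-tuple (measurableTypeR R)) :=
  [set t | eps < enorm (x - vec t)].

(* L w (x) = lim_{eps -> 0+} of the integral over |x - y| > eps. *)
Definition Lop K w x : \bar R :=
  lim ((fun eps : R =>
          \int[lebesgueT n]_(t in outside x eps) Lintegrand K w x t)%E
       @ 0^'+).

(* "Smooth enough" bounded function, in the direction e.  C^3 is the first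
   class C^k for which 'D_e u is regular enough for L ('D_e u) to converge at
   the singularity, whatever the order of L in (0,2).  Boundedness of u does not
   control 'D_e u at infinity, hence the last clause, which says that
   L ('D_e u) is meaningful there; it holds for instance when 'D_e u is bounded,
   and nothing is required of the other derivatives of u.  The square of 'D_e u
   may then fail to be integrable at infinity against K, in which case L of
   eta^2 ('D_e u)^2 takes the value -oo. *)
Definition smooth_enough K (e : 'rV[R]_n) (u : 'rV[R]_n -> R) : Prop :=
  [/\ Ck 3 u,
      bounded_fun u &
      forall x (eps : R), 0 < eps ->
        (lebesgueT n).-integrable (outside x eps) (Lintegrand K ('D_e u) x)].

End operator.

(** The threshold of the theorem is a function of n, s1, s2, Lambda/min(lambda,1)
    and of the C^{1,1} norm of eta.  The bounds of K by g are unchanged by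
    (g, lambda, Lambda) |-> (g/t, t lambda, t Lambda), but the gradient bound,
    whose constant is Lambda itself, is not: for large lambda the ratio
    Lambda/lambda alone does not control the gradient of K, and a threshold
    depending on that ratio only does not exist (take K oscillating
    fast on an annulus, in resonance with 'D_e u).  For lambda <= 1 the argument
    is Lambda/lambda; for lambda > 1 it is Lambda. *)

(* Main.v *)
(** Write w = D_e u and w = p - m, with (p, m) = (w, 0) for the first
    inequality and (p, m) = (w_+, w_-) for the second, and put
    A = eta(x) p(x).  Expanding squares, the inequality at x amounts to

      2 A pv-int w(y) (eta(x) - eta(y)) K(x-y) dy
        <= int (E(y) + sigma (u(x) - u(y))^2) K(x-y) dy,

    where E = (A - eta(y) p(y))^2 + 2 eta(x) eta(y) p(x) m(y) >= 0.  The right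
    side may be infinite; otherwise the left side is absorbed at the scale
    rho = c sqrt(eta(x)/M), where M dominates the C^{1,1} norm of eta and c is
    small.  With G = lambda g(rho):

    - Near x the inequality |grad eta|^2 <= C M eta, valid because eta >= 0,
      makes |eta(x) - eta(y)| a small fraction of eta(x).  Splitting
      w(y) = w(x) + (w(y) - w(x)), the first term is symmetrized and the second
      is controlled by E; both leave a small multiple of A^2 G.
    - Far from x, w is the derivative of u(y) - u(x); integrating by parts in
      the direction e and using the bound on grad K gives a small multiple of
      A^2 G plus a multiple of int (u(x) - u(y))^2 K(x-y) dy.
    - A^2 G is in turn bounded by the right side: integrate A eta w against a
      cutoff at scale rho and integrate by parts in the direction e. *)
Require Import Defs.
From HB Require Import structures.
From mathcomp Require Import all_boot all_order all_algebra.
From mathcomp Require Import all_classical all_reals all_analysis.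
From mathcomp Require Import measurable_realfun ring lra.
Import Order.TTheory GRing.Theory Num.Theory.
Import numFieldNormedType.Exports.
Local Open Scope classical_set_scope.
Local Open Scope ring_scope.
Set Implicit Arguments.
Unset Strict Implicit.
Unset Printing Implicit Defensive.

(** * Lebesgue measure on tuples: cubes, sigma-finiteness, translations and point reflections *)

Section lebesgue_affine.
Context {R : realType}.
Local Notation leb := (@lebesgue_measure R).

(** The energy E sees only differences of [eta p], so it cannot bound A by itself. If E is small,
    [eta w] stays close to A on a whole ball, and then u has to vary there: the sigma term pays for
    that variation.

    All errors are counted in the unit S = A^2 G. The mass of |x-y|^2 K inside the ball of radius
    rho is a multiple of rho^2 g(rho), that of K outside it a multiple of g(rho), with factors
    depending only on n, s1, s2 and Lambda. Hence the coefficients of S do not depend on g, x or u.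

    The scale is the largest, up to a factor, on which eta stays comparable to eta(x), and M rho^2 =
    c^2 eta(x) turns second-order increments of eta into small multiples of eta(x). The near errors
    are made small by c, the far one by a Young weight whose inverse falls on the sigma term. Since
    eta <= M gives eta(x) <= (M/c) rho, the interpolation constant does not degenerate as eta(x)
    tends to 0.

    Infinite values are confined to one place: the principal values at x of w, u and w (eta -
    eta(x)) are finite, and what remains is a nonnegative integral, monotone in the truncation. *)

Lemma ge0_integral_lebesgue_affine (b a : R) (f : R -> \bar R) :
  b = 1 \/ b = -1 -> measurable_fun [set: R] f -> (forall x, 0 <= f x)%E ->
  (\int[leb]_x f (b * x + a)%R = \int[leb]_x f x)%E.
Proof.
move=> b1 mf f0.
pose h : measurableTypeR R -> measurableTypeR R := fun x => b * x + a.
have mh : measurable_fun setT h.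
  by apply: measurable_funD => //; apply: measurable_funM.
have hK : forall A, measurable A -> leb A = pushforward leb h A.
  move=> A mA; apply: (@lebesgue_measure_unique _
    (measure_function_pushforward__canonical__measure_function_Measure leb mh))
    => // X [[x y]] _ <-.
  rewrite /= /pushforward.
  case: b1 @h mh => -> h mh.
    rewrite (_ : h @^-1` _ = `]x - a, y - a]%classic); last first.
      by apply/seteqP; split=> z /=; rewrite !in_itv/= /h;
        move=> /andP[? ?]; apply/andP; split; lra.
    rewrite !lebesgue_measure_itv/= !lte_fin ltrD2r -!EFinD.
    by case: ifP => // _; congr (_%:E); ring.
  (* A reflection turns a left-open interval into a right-open one; its length is unchanged. *)
  rewrite (_ : h @^-1` _ = `[a - y, a - x[%classic); last first.
    by apply/seteqP; split=> z /=; rewrite !in_itv/= /h;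
      move=> /andP[? ?]; apply/andP; split; lra.
  rewrite !lebesgue_measure_itv/= !lte_fin ltrD2l ltrN2 -!EFinD.
  by case: ifP => // _; congr (_%:E); ring.
have := @ge0_integral_pushforward _ _ _ _ _ h mh leb setT f measurableT.
rewrite preimage_setT => H.
rewrite -[LHS]/(\int[leb]_x (f \o h) x)%E -H//.
by apply: eq_measure_integral => A mA _; rewrite /= hK.
Qed.

(** Used with [b = 1], a translation, and with [b = -1] and [a = 2 x], the reflection through x. *)
Definition affT {n} (b : R) (a : 'rV[R]_n) (t : n.-tuple (measurableTypeR R)) :
  n.-tuple (measurableTypeR R) := [tuple b * tnth t i + a ord0 i | i < n].

Lemma vec_affT n b (a : 'rV[R]_n) t : vec (affT b a t) = b *: vec t + a.
Proof. by apply/rowP => i; rewrite !mxE tnth_mktuple. Qed.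

Lemma measurable_affT n b (a : 'rV[R]_n) : measurable_fun setT (affT b a).
Proof.
apply/measurable_fun_tnthP => i.
rewrite (_ : _ \o _ = fun t : n.-tuple (measurableTypeR R) =>
  b * tnth t i + a ord0 i); last first.
  by apply/funext => t /=; rewrite tnth_mktuple.
apply: measurable_funD => //; apply: measurable_funM => //.
exact: measurable_tnth.
Qed.

Lemma affT_consR n b (a : 'rV[R]_n.+1) p :
  affT b a (consR p) =
  consR (affT b (\row_i a ord0 (lift ord0 i)) p.1, b * p.2 + a ord0 ord0).
Proof.
apply: eq_from_tnth => i; rewrite tnth_mktuple.
case: (unliftP ord0 i) => [j|] ->.
  by rewrite /consR/= !tnthS tnth_mktuple mxE.
by rewrite /consR/= !tnth0.
Qed.

(** Cubes stand in for balls: their measure is explicit, and enclosing or inscribing a cube costs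
    only a dimensional factor. *)
Definition cubeT {n} (a : 'rV[R]_n) (h : R) :
    set (n.-tuple (measurableTypeR R)) :=
  [set t | forall i, a ord0 i <= tnth t i <= a ord0 i + h].

Lemma cubeT_consR n (a : 'rV[R]_n.+1) h :
  @consR R n @^-1` cubeT a h =
  cubeT (\row_i a ord0 (lift ord0 i)) h `*` `[a ord0 ord0, a ord0 ord0 + h]%classic.
Proof.
apply/seteqP; split => -[t s]; rewrite /cubeT/consR/= in_itv/=.
  move=> H; split; last by have := H ord0; rewrite tnth0.
  by move=> i; have := H (lift ord0 i); rewrite tnthS mxE.
move=> [H1 H2] i; case: (unliftP ord0 i) => [j|] ->; last by rewrite tnth0.
by have := H1 j; rewrite tnthS mxE.
Qed.

Lemma measurable_cubeT n (a : 'rV[R]_n) h : measurable (cubeT a h).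
Proof.
rewrite (_ : cubeT a h = \bigcap_(i in [set: 'I_n])
   ((fun t => tnth t i) @^-1` `[a ord0 i, a ord0 i + h]%classic)).
  apply: fin_bigcap_measurable => // i _; rewrite -[X in measurable X]setTI.
  exact: measurable_tnth.
apply/seteqP; split=> t /=; first by move=> H i _; rewrite /= in_itv/= H.
by move=> H i; have := H i I; rewrite /= in_itv.
Qed.

Lemma lebesgueT_cubeT n (a : 'rV[R]_n) (h : R) : 0 <= h ->
  lebesgueT n (cubeT a h) = (h ^+ n)%:E.
Proof.
move=> h0; elim: n a => [|n IH] a.
  rewrite /= diracE mem_set ?expr0//; by case.
rewrite -[LHS]/((lebesgueT n \x leb)%E (@consR R n @^-1` cubeT a h)).
rewrite cubeT_consR product_measure1E//; last exact: measurable_cubeT.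
rewrite IH -[X in (_ * X)%E]/(leb `[a ord0 ord0, a ord0 ord0 + h]%classic).
rewrite lebesgue_measure_itv/= lte_fin.
case: ifPn => [_|]; first by rewrite -EFinD -EFinM exprSr; congr (_%:E); ring.
rewrite -leNgt => h1; have -> : h = 0 by lra.
by rewrite mule0 exprS mul0r.
Qed.

Lemma lebesgueT_sigma_finite n : sigma_finite setT (@lebesgueT R n).
Proof.
exists (fun k => cubeT (const_mx (- k%:R)) (2 * k%:R)) => [|k].
  apply/esym; rewrite -subTset => t _.
  pose s := \sum_(i < n) `|tnth t i|.
  exists (Num.truncn s).+1 => //= i; rewrite mxE.
  have si : `|tnth t i| <= s.
    by rewrite /s (bigD1 i)//= lerDl sumr_ge0.
  have := truncnS_gt s; move: si; rewrite ler_norml => /andP[] *.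
  by apply/andP; split; lra.
split; first exact: measurable_cubeT.
by rewrite lebesgueT_cubeT ?mulr_ge0// ltry.
Qed.

(* [lebesgueT n] is a bundled measure; its underlying function can carry the
   sigma-finite structure that the library asks for in Tonelli's theorem. *)
Definition lebesgueT_fun n : set (n.-tuple (measurableTypeR R)) -> \bar R :=
  lebesgueT n.
HB.instance Definition _ n := Measure.copy (@lebesgueT_fun n) (lebesgueT n).
HB.instance Definition _ n := Measure_isSigmaFinite.Build _ _ _
  (@lebesgueT_fun n) (@lebesgueT_sigma_finite n).

Lemma ge0_integral_lebesgueS n (f : n.+1.-tuple (measurableTypeR R) -> \bar R) :
  measurable_fun setT f -> (forall t, 0 <= f t)%E ->
  (\int[lebesgueT n.+1]_t f t =
   \int[lebesgueT n]_t \int[leb]_s f (consR (t, s)))%E.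
Proof.
move=> mf f0.
have := @ge0_integral_pushforward _ _ _ _ _ _ (@measurable_consR R n)
  (lebesgueT n \x leb)%E setT f measurableT.
rewrite preimage_setT => H; rewrite [LHS]H//.
rewrite (@fubini_tonelli1 _ _ _ _ _ (@lebesgueT_fun n) leb (f \o (@consR R n)))//=.
by apply: measurableT_comp => //; exact: measurable_consR.
Qed.

Lemma measurable_integral_consR n
    (f : n.+1.-tuple (measurableTypeR R) -> \bar R) :
  measurable_fun setT f -> (forall t, 0 <= f t)%E ->
  measurable_fun setT (fun t => \int[leb]_s f (consR (t, s)))%E.
Proof.
move=> mf f0.
apply: (@measurable_fun_fubini_tonelli_F _ _ _ _ _ leb (f \o (@consR R n))) =>
  [|x]; last exact: f0.
by apply: measurableT_comp => //; exact: measurable_consR.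
Qed.

Lemma ge0_integral_affT n (b : R) (a : 'rV[R]_n)
    (f : n.-tuple (measurableTypeR R) -> \bar R) :
  b = 1 \/ b = -1 -> measurable_fun setT f -> (forall x, 0 <= f x)%E ->
  (\int[lebesgueT n]_t f (affT b a t) = \int[lebesgueT n]_t f t)%E.
Proof.
move=> b1; elim: n => [|n IH] in a f * => mf f0.
  by apply: eq_integral => t _; congr f; apply: eq_from_tnth => -[].
have mfa : measurable_fun setT (f \o affT b a).
  by apply: measurableT_comp => //; exact: measurable_affT.
rewrite (@ge0_integral_lebesgueS _ (f \o affT b a))//; last first.
  by move=> t; exact: f0.
rewrite ge0_integral_lebesgueS//.
pose F t := (\int[leb]_s f (consR (t, s)))%E.
have F0 t : (0 <= F t)%E by apply: integral_ge0 => s _; exact: f0.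
have mF : measurable_fun setT F by exact: measurable_integral_consR.
rewrite -(IH (\row_i a ord0 (lift ord0 i)) F mF F0).
apply: eq_integral => t _; rewrite /F.
set t' := affT _ _ t.
rewrite -(@ge0_integral_lebesgue_affine b (a ord0 ord0)
  (fun s => f (consR (t', s))))//.
  by apply: eq_integral => s _ /=; rewrite affT_consR.
apply: (measurableT_comp mf); apply: (measurableT_comp (@measurable_consR R n)).
exact: measurable_pair1.
Qed.

End lebesgue_affine.

(** * Comparison of the Euclidean norm with the sup norm *)

Section euclid.
Context {R : realType} {n : nat}.
Implicit Types x v : 'rV[R]_n.

Lemma enorm_ge0 x : 0 <= enorm x. Proof. exact: sqrtr_ge0. Qed.

Lemma enorm_sqr x : enorm x ^+ 2 = \sum_(i < n) x ord0 i ^+ 2.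
Proof. by rewrite sqr_sqrtr// sumr_ge0// => i _; rewrite sqr_ge0. Qed.

Lemma enormN x : enorm (- x) = enorm x.
Proof. by congr Num.sqrt; apply: eq_bigr => i _; rewrite mxE sqrrN. Qed.

Lemma enormZ (c : R) x : enorm (c *: x) = `|c| * enorm x.
Proof.
rewrite /enorm -sqrtr_sqr -sqrtrM ?sqr_ge0//; congr Num.sqrt.
by rewrite mulr_sumr; apply: eq_bigr => i _; rewrite mxE exprMn.
Qed.

Lemma coord_le_enorm x i : `|x ord0 i| <= enorm x.
Proof.
rewrite -(@ler_pXn2r _ 2)// ?nnegrE ?enorm_ge0// enorm_sqr real_normK ?num_real//.
by rewrite (bigD1 i)//= lerDl sumr_ge0// => j _; rewrite sqr_ge0.
Qed.

Lemma enorm0 : enorm (0 : 'rV[R]_n) = 0.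
Proof. by rewrite -(scale0r (0 : 'rV_n)) enormZ normr0 mul0r. Qed.

Lemma enorm_eq0 x : (enorm x == 0) = (x == 0).
Proof.
apply/eqP/eqP => [x0|->]; last exact: enorm0.
by apply/rowP => i; rewrite mxE; apply/normr0_eq0/le_anti;
  rewrite normr_ge0 -x0 coord_le_enorm.
Qed.

Lemma enorm_gt0 x : (0 < enorm x) = (x != 0).
Proof. by rewrite lt_neqAle enorm_ge0 andbT eq_sym enorm_eq0. Qed.

Lemma norm_rV_le x e : 0 <= e -> (forall i, `|x ord0 i| <= e) -> `|x| <= e.
Proof.
move=> e0 H; rewrite -[`|x|]/(mx_norm x) mx_normrE; apply: bigmax_le => //= -[i j] _ /=.
by rewrite (ord1 i) H.
Qed.

Lemma coord_le_norm x i : `|x ord0 i| <= `|x|.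
Proof.
rewrite -[leRHS]/(mx_norm x) mx_normrE.
by apply: (le_bigmax _ (fun k : 'I_1 * 'I_n => `|x k.1 k.2|) (ord0, i)).
Qed.

Lemma norm_le_enorm x : `|x| <= enorm x.
Proof. by apply: norm_rV_le; [exact: enorm_ge0|exact: coord_le_enorm]. Qed.

Lemma enorm_le_norm x : enorm x <= n%:R * `|x|.
Proof.
rewrite -(@ler_pXn2r _ 2)// ?nnegrE ?enorm_ge0 ?mulr_ge0// enorm_sqr.
apply: (@le_trans _ _ (\sum_(i < n) `|x| ^+ 2)).
  apply: ler_sum => i _; rewrite -[leLHS]real_normK ?num_real//.
  by rewrite ler_pXn2r ?nnegrE ?coord_le_norm.
rewrite sumr_const card_ord -[leLHS]mulr_natl exprMn; apply: ler_wpM2r.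
  by rewrite sqr_ge0.
by rewrite -natrX ler_nat; case: (n) => // m; rewrite expnS expn1 leq_pmull.
Qed.

Lemma continuous_enorm : continuous (enorm : 'rV[R]_n -> R).
Proof.
move=> x; apply: (@continuous_comp _ _ _
  (fun x : 'rV[R]_n => \sum_(i < n) x ord0 i ^+ 2) Num.sqrt); last first.
  exact: sqrt_continuous.
apply: (@cvg_big _ _ +%R 0 xpredT _ _ (nbhs x)) => [y|i _].
  exact: add_continuous.
have cx : {for x, continuous (fun y : 'rV[R]_n => y ord0 i)}.
  exact: coord_continuous.
exact: (continuous_comp cx (@exprn_continuous R 2 _)).
Qed.

End euclid.

(** * Measurability of functions of the point [vec t] *)

Section measurable_vec.
Context {R : realType} {n : nat}.
Local Notation T := (n.-tuple (measurableTypeR R)).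

(** Index of the cell of mesh 1/(k+1) that contains t. There are countably many cells, so every
    function of the index is measurable, whatever its regularity. *)
Let grid (k : nat) (t : T) : n.-tuple int :=
  [tuple Num.floor (k.+1%:R * tnth t i) | i < n].

Let gridpt (k : nat) (q : n.-tuple int) : 'rV[R]_n :=
  \row_i ((tnth q i)%:~R / k.+1%:R).

Let cvg_grid (t : T) : gridpt k (grid k t) @[k --> \oo] --> vec t.
Proof.
apply/cvgrPdist_le => /= e e0.
have := @cvg_harmonic R; move/cvgrPdist_le => /(_ e e0).
apply: filterS => k; rewrite sub0r normrN => he.
apply: norm_rV_le; first exact: ltW.
move=> i; rewrite !mxE tnth_mktuple.
apply: le_trans he; rewrite /harmonic/= [leRHS]ger0_norm ?invr_ge0//.
have k0 : 0 < k.+1%:R :> R by rewrite ltr0n.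
rewrite -(ler_pM2l k0) mulfV ?gt_eqF// -[X in X * _]ger0_norm ?ltW// -normrM.
have := floor_le (k.+1%:R * tnth t i); have := floorD1_gt (k.+1%:R * tnth t i).
rewrite intrD1 => h1 h2.
rewrite mulrBr [_ * (_ / _)]mulrC -mulrA mulVf ?gt_eqF// mulr1.
by rewrite ger0_norm; lra.
Qed.

Let measurable_grid k (D : set T) (f : 'rV[R]_n -> R) : measurable D ->
  measurable_fun D (f \o gridpt k \o grid k).
Proof.
move=> mD _ A mA; apply: measurableI => //.
rewrite (_ : _ @^-1` _ = \bigcup_q (if q \in [set q | A (f (gridpt k q))] then
    \bigcap_(i in [set: 'I_n])
   ((fun t : T => tnth t i) @^-1`
     `[(tnth q i)%:~R / k.+1%:R, ((tnth q i)%:~R + 1) / k.+1%:R[%classic)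
     else set0)).
  apply: countable_bigcupT_measurable => // q; case: ifP => // _.
  apply: fin_bigcap_measurable => // i _; rewrite -[X in measurable X]setTI.
  exact: measurable_tnth.
have k0 : 0 < k.+1%:R :> R by rewrite ltr0n.
apply/seteqP; split => [t /= At|t [q _]].
  exists (grid k t) => //; rewrite mem_set//= => i _ /=.
  rewrite in_itv/= tnth_mktuple ler_pdivrMr// ltr_pdivlMr// [tnth t i * _]mulrC.
  have := floor_le (k.+1%:R * tnth t i); have := floorD1_gt (k.+1%:R * tnth t i).
  by rewrite intrD1 => -> ->.
case: ifPn => // /set_mem /= Aq Ht /=; rewrite (_ : grid k t = q)//.
apply: eq_from_tnth => i; rewrite tnth_mktuple.
have := Ht i I; rewrite /= in_itv/= ler_pdivrMr// ltr_pdivlMr//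
  [tnth t i * _]mulrC => Hi.
by apply: floor_def; rewrite intrD1.
Qed.

(** [f (vec t)] is the limit of the values of f at the corners of the cells containing t. Continuity
    is asked only at the points of D, so that a kernel singular at one point is covered. *)
Lemma measurable_fun_vec (D : set T) (f : 'rV[R]_n -> R) : measurable D ->
  (forall t, D t -> {for vec t, continuous f}) -> measurable_fun D (f \o @vec R n).
Proof.
move=> mD cf.
apply: (@measurable_fun_cvg _ _ _ _ (fun k => f \o gridpt k \o grid k)).
  by move=> k; exact: measurable_grid.
move=> t Dt /=.
exact: (cvg_comp _ _ (@cvg_grid t) (cf t Dt)).
Qed.

End measurable_vec.

(** * Directional derivatives: mean value inequalities and local bounds for C^k functions *)

Section directional.
Context {R : realType} {n : nat}.
Implicit Types (f g : 'rV[R]_n -> R) (x y v : 'rV[R]_n).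

Lemma is_derive_line f y v (s d : R) : is_derive (y + s *: v) v f d ->
  is_derive s 1 (fun s => f (y + s *: v)) d.
Proof.
have E : (fun h : R => h^-1 *: (((fun s => f (y + s *: v)) \o shift s) (h *: 1)
    - f (y + s *: v))) =
  (fun h => h^-1 *: ((f \o shift (y + s *: v)) (h *: v) - f (y + s *: v))).
  apply/funext => h /=; congr (_ *: (f _ - _)).
  by rewrite [_%:A]mulr1 scalerDl addrCA.
by case=> df dv; apply: DeriveDef; rewrite /derivable/derive E.
Qed.

Lemma is_derive_comp_real f y v (d : R) (g : R -> R) (dg : R) :
  is_derive y v f d -> is_derive (f y) 1 g dg ->
  is_derive y v (fun z => g (f z)) (dg * d).
Proof.
move=> df dgy.
have Hf : is_derive (0 : R) 1 (fun s => f (y + s *: v)) d.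
  by apply: is_derive_line; rewrite scale0r addr0.
have Hg : is_derive ((fun s : R => f (y + s *: v)) 0) 1 g dg.
  by rewrite /= scale0r addr0.
have := is_derive1_comp Hg Hf => -[Hd Hv].
have E : (fun h : R => h^-1 *:
    (((fun z => g (f z)) \o shift y) (h *: v) - g (f y))) =
  (fun h => h^-1 *: (((g \o (fun s : R => f (y + s *: v))) \o shift 0) (h *: 1) -
    (g \o (fun s : R => f (y + s *: v))) 0)).
  apply/funext => h /=; rewrite [_%:A]mulr1 addr0 scale0r addr0.
  by rewrite [h *: v + y]addrC.
by apply: DeriveDef; rewrite /derivable/derive E.
Qed.

Lemma mean_value_bound (h dh : R -> R) (B : R) :
  (forall s : R, 0 <= s <= 1 -> is_derive s 1 h (dh s)) ->
  (forall s : R, 0 <= s <= 1 -> `|dh s| <= B) -> `|h 1 - h 0| <= B.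
Proof.
move=> hd hB.
have [||c] := @MVT_segment R h dh 0 1 ler01.
- by move=> s /[!in_itv]/= /andP[? ?]; apply: hd; rewrite !ltW.
- apply: derivable_within_continuous => s /[!in_itv]/= s01.
  by have := hd s s01; case.
by rewrite in_itv/= subr0 mulr1 => c01 ->; exact: hB.
Qed.

Lemma dir_mean_value f y v (B : R) :
  (forall s : R, 0 <= s <= 1 -> derivable f (y + s *: v) v) ->
  (forall s : R, 0 <= s <= 1 -> `|'D_v f (y + s *: v)| <= B) ->
  `|f (y + v) - f y| <= B.
Proof.
move=> hd hB.
have := @mean_value_bound (fun s => f (y + s *: v))
  (fun s => 'D_v f (y + s *: v)) B.
rewrite scale1r scale0r addr0; apply=> // s s01.
by apply: is_derive_line; apply: derivableP; exact: hd.
Qed.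

Lemma dir_second_difference f y v (B : R) :
  (forall s : R, -1 <= s <= 1 -> derivable f (y + s *: v) v) ->
  (forall s : R, 0 <= s <= 1 ->
    `|'D_v f (y + s *: v) - 'D_v f (y - s *: v)| <= B) ->
  `|2 * f y - f (y + v) - f (y - v)| <= B.
Proof.
move=> hd hB.
have dl (s : R) : -1 <= s <= 1 ->
    is_derive s 1 (fun s => f (y + s *: v)) ('D_v f (y + s *: v)).
  by move=> s1; apply: is_derive_line; apply: derivableP; exact: hd.
have := @mean_value_bound
  (fun s => f (y + s *: v) + f (y + (- s) *: v))
  (fun s => 'D_v f (y + s *: v) - 'D_v f (y - s *: v)) B.
rewrite scale1r scale0r oppr0 scale0r addr0 scaleN1r.
rewrite (_ : 2 * _ - _ - _ = - (f (y + v) + f (y - v) - (f y + f y)));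
  last by ring.
rewrite normrN; apply => // s s01.
have h1 := dl s ltac:(lra); have h2 := dl (- s) ltac:(lra).
have := is_derive1_comp h2 (is_deriveNid s 1) => h3.
by apply: (is_derive_eq (is_deriveD h1 h3)); rewrite mulrN1 scaleNr.
Qed.

Lemma derive_coordE f y v : differentiable f y ->
  'D_v f y = \sum_(i < n) v ord0 i * 'D_(delta_mx ord0 i) f y.
Proof.
move=> df; rewrite deriveE// {1}(row_sum_delta v) linear_sum.
by apply: eq_bigr => i _; rewrite linearZ/= deriveE.
Qed.

Lemma dir_derive_le f y v (B C : R) : differentiable f y ->
  (forall i, `|v ord0 i| <= C) ->
  (forall i : 'I_n, `|'D_(delta_mx ord0 i) f y| <= B) ->
  `|'D_v f y| <= n%:R * (C * B).
Proof.
move=> df vC DB; rewrite derive_coordE//.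
apply: le_trans (ler_norm_sum _ _ _) _.
apply: (@le_trans _ _ (\sum_(i < n) C * B)).
  by apply: ler_sum => i _; rewrite normrM ler_pM.
by rewrite sumr_const card_ord mulr_natl.
Qed.

(** The remainder [h ^+ 2] with constant 1 fits both uses: the squared positive part, and the
    squared length along a vector of norm at most 1. *)
Lemma is_derive_quadratic (g : R -> R) (t d : R) :
  (forall h, `|g (t + h) - g t - h * d| <= h ^+ 2) -> is_derive t 1 g d.
Proof.
move=> H.
have L : (fun h => h^-1 *: ((g \o shift t) (h *: 1) - g t)) @ 0^' --> d.
  apply/cvgrPdist_le => e e0; near=> h.
  have h0 : h != 0 by near: h; exact: nbhs_dnbhs_neq.
  rewrite /= [_%:A]mulr1 [h + t]addrC.
  rewrite -(ler_pM2l (_ : 0 < `|h|)) ?normr_gt0// -normrM mulrBr.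
  rewrite [X in _ - X]mulrA mulfV// mul1r distrC (le_trans (H h))//.
  rewrite -[leLHS]real_normK ?num_real// expr2 ler_pM2l ?normr_gt0//.
  near: h; apply: nbhs_dnbhs.
  exact: (@nbhs0_le R R e).
by apply: DeriveDef; [apply/cvg_ex; exists d|exact: cvg_lim].
Unshelve. all: by end_near. Qed.

End directional.

Section more_directional.
Context {R : realType} {n : nat}.
Implicit Types (f g : 'rV[R]_n -> R) (x y z v : 'rV[R]_n).

Lemma is_derive_lineV f y v (d : R) :
  is_derive (0 : R) 1 (fun s => f (y + s *: v)) d -> is_derive y v f d.
Proof.
have E : (fun h : R => h^-1 *: (((fun s => f (y + s *: v)) \o shift 0) (h *: 1)
    - f (y + 0 *: v))) =
  (fun h => h^-1 *: ((f \o shift y) (h *: v) - f y)).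
  apply/funext => h /=; rewrite scale0r !addr0; congr (_ *: (f _ - _)).
  by rewrite [_%:A]mulr1 addrC.
by case=> df dv; apply: DeriveDef; move: df dv; rewrite /derivable/derive E.
Qed.

Lemma dir_derive_dist f x y v (C L : R) :
  differentiable f x -> differentiable f y ->
  (forall i, `|v ord0 i| <= C) ->
  (forall i : 'I_n, `|'D_(delta_mx ord0 i) f x - 'D_(delta_mx ord0 i) f y| <= L) ->
  `|'D_v f x - 'D_v f y| <= n%:R * (C * L).
Proof.
move=> dx dy vC DL; rewrite !derive_coordE// -sumrB.
apply: le_trans (ler_norm_sum _ _ _) _.
apply: (@le_trans _ _ (\sum_(i < n) C * L)).
  by apply: ler_sum => i _; rewrite -mulrBr normrM ler_pM.
by rewrite sumr_const card_ord mulr_natl.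
Qed.

Lemma second_difference_le f x z (C L : R) :
  (forall y, differentiable f y) -> (forall i, `|z ord0 i| <= C) ->
  (forall (s : R) (i : 'I_n), 0 <= s <= 1 ->
     `|'D_(delta_mx ord0 i) f (x + s *: z) -
       'D_(delta_mx ord0 i) f (x - s *: z)| <= L) ->
  `|2 * f x - f (x + z) - f (x - z)| <= n%:R * (C * L).
Proof.
move=> df zC HL; apply: dir_second_difference => s s1.
  exact: diff_derivable.
by apply: dir_derive_dist => // i; exact: HL.
Qed.

Lemma continuous_bounded_ball f x (r : R) : continuous f ->
  exists C : R, 0 <= C /\ forall y, `|y - x| <= r -> `|f y| <= C.
Proof.
move=> cf; pose A := [set y | `|y - x| <= r].
have cA : compact A.
  apply: bounded_closed_compact.
    exists (r + `|x|); split; first exact: num_real.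
    move=> M rM y /= yr; apply: le_trans (ltW rM).
    by rewrite -[y](subrK x) (le_trans (ler_normD _ _))// lerD2r.
  rewrite (_ : A = closed_ball_ Num.norm x r); first exact: closed_closed_ball_.
  by apply/funext => y; rewrite /A/closed_ball_/= distrC.
have := compact_bounded (continuous_compact (continuous_subspaceT cf) cA).
move=> [M [_ HM]]; exists (`|M| + 1); split; first by rewrite addr_ge0.
move=> y yr; apply: (HM (`|M| + 1)); last by exists y.
by rewrite (le_lt_trans (ler_norm _))// ltrDl.
Qed.

Lemma Ck_continuous k f : Ck k f -> continuous f.
Proof.
by case: k => [//|k] [df _] x; exact/differentiable_continuous.
Qed.

Lemma Ck1_lipschitz f x (r : R) : Ck 1 f ->
  exists C : R, 0 <= C /\ forall y y', `|y - x| <= r -> `|y' - x| <= r ->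
    `|f y' - f y| <= C * `|y' - y|.
Proof.
move=> [df cf].
have /choice[C HC] : forall i : 'I_n, exists C : R, 0 <= C /\
    forall y, `|y - x| <= r -> `|'D_(delta_mx ord0 i) f y| <= C.
  by move=> i; apply: continuous_bounded_ball; exact: cf.
exists (n%:R * \sum_i C i); split.
  by rewrite mulr_ge0// sumr_ge0// => i _; case: (HC i).
move=> y y' yr y'r; have := @dir_mean_value R n f y (y' - y)
  (n%:R * (`|y' - y| * \sum_i C i)).
rewrite subrKC => H.
rewrite -mulrA [X in _ * X]mulrC; apply: H => s s01; first exact: diff_derivable.
apply: dir_derive_le => // i; first exact: coord_le_norm.
apply: (@le_trans _ _ (C i)); last first.
  by rewrite (bigD1 i)//= lerDl sumr_ge0// => j _; case: (HC j).
apply: (HC i).2.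
(* The segment stays in the ball, each of its points being a convex combination of [y] and [y']. *)
have -> : y + s *: (y' - y) - x = (1 - s) *: (y - x) + s *: (y' - x).
  by apply/rowP => j; rewrite !mxE; ring.
apply: le_trans (ler_normD _ _) _; rewrite !normrZ.
rewrite ger0_norm; last by lra.
rewrite [`|s|]ger0_norm; last by lra.
have [s0 s1] : 0 <= s /\ 0 <= 1 - s by split; lra.
have := ler_wpM2l s0 y'r; have := ler_wpM2l s1 yr; lra.
Qed.

Lemma Ck2_second_difference f x : Ck 2 f ->
  exists C : R, 0 <= C /\ forall z, `|z| <= 1 ->
    `|2 * f x - f (x + z) - f (x - z)| <= C * `|z| ^+ 2.
Proof.
move=> [df cf].
have /choice[C HC] : forall i : 'I_n, exists C : R, 0 <= C /\
    forall y y', `|y - x| <= 1 -> `|y' - x| <= 1 ->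
    `|'D_(delta_mx ord0 i) f y' - 'D_(delta_mx ord0 i) f y| <= C * `|y' - y|.
  by move=> i; apply: Ck1_lipschitz; exact: cf.
pose S := \sum_i C i.
have S0 : 0 <= S by apply: sumr_ge0 => i _; case: (HC i).
exists (n%:R * (2 * S)); split; first by rewrite !mulr_ge0.
move=> z z1.
have -> : n%:R * (2 * S) * `|z| ^+ 2 =
  n%:R * (`|z| * (2 * S * `|z|)) by ring.
apply: second_difference_le => // [i|s i /andP[s0 s1]].
  exact: coord_le_norm.
have sz : `|s *: z| <= 1.
  by rewrite normrZ ger0_norm// mulr_ile1.
apply: le_trans ((HC i).2 _ _ _ _) _.
- by rewrite addrAC subrr add0r normrN.
- by rewrite addrAC subrr add0r.
rewrite (_ : x + s *: z - (x - s *: z) = (2 * s) *: z); last first.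
  by apply/rowP => j; rewrite !mxE; ring.
rewrite normrZ (ger0_norm (_ : 0 <= 2 * s)); last by lra.
have Ci : C i <= S.
  by rewrite /S (bigD1 i)//= lerDl sumr_ge0// => j _; case: (HC j).
have C0 := (HC i).1.
have -> : 2 * S * `|z| = S * (2 * `|z|) by ring.
apply: ler_pM => //; first by rewrite mulr_ge0// mulr_ge0.
by rewrite ler_wpM2r//; lra.
Qed.

End more_directional.

(** * Functions of class C^{1,1}: first and second differences, gradient of a nonnegative
    function *)

Section C11_functions.
Context {R : realType} {n : nat}.
Implicit Types (x y z v : 'rV[R]_n).

(** The three suprema are nonnegative, so their finite sum bounds each of them. *)
Lemma C11_bounds (eta : 'rV[R]_n -> R) : (0 < n)%N -> C11 eta ->
  let M := fine (C11norm eta) in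
  [/\ 0 <= M, forall y, `|eta y| <= M,
      forall y (i : 'I_n), `|'D_(delta_mx ord0 i) eta y| <= M &
      forall y y' (i : 'I_n), `|'D_(delta_mx ord0 i) eta y -
        'D_(delta_mx ord0 i) eta y'| <= M * enorm (y - y')].
Proof.
move=> n0 [deta]; rewrite /C11norm.
set a := ereal_sup _; set b := ereal_sup _; set c := ereal_sup _ => abc /=.
have ua y : (`|eta y|%:E <= a)%E by apply: ereal_sup_ubound; exists y.
have ub y : ((enorm (grad eta y))%:E <= b)%E.
  by apply: ereal_sup_ubound; exists y.
have uc y y' : y != y' ->
    ((enorm (grad eta y - grad eta y') / enorm (y - y'))%:E <= c)%E.
  by move=> yy'; apply: ereal_sup_ubound; exists (y, y').
have a0 : (0 <= a)%E by apply: le_trans (ua 0); rewrite lee_fin.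
have b0 : (0 <= b)%E by apply: le_trans (ub 0); rewrite lee_fin enorm_ge0.
(* Two distinct points are needed here: in dimension 0 the supremum runs over the empty set and
   equals -oo. *)
have c0 : (0 <= c)%E.
  have /uc : const_mx 1 != 0 :> 'rV[R]_n.
    apply/eqP => /rowP /(_ (Ordinal n0)); rewrite !mxE => /eqP.
    by rewrite oner_eq0.
  by apply: le_trans; rewrite lee_fin divr_ge0 ?enorm_ge0.
have fabc : (a + b + c)%E \is a fin_num.
  by rewrite ge0_fin_numE// !adde_ge0.
have fE := fineK fabc.
have la : (a <= (fine (a + b + c))%:E)%E.
  by rewrite fE -addeA leeDl// adde_ge0.
have lb : (b <= (fine (a + b + c))%:E)%E.
  by rewrite fE addeAC leeDr// adde_ge0.
have lc : (c <= (fine (a + b + c))%:E)%E by rewrite fE leeDr// adde_ge0.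
split => [|y|y i|y y' i].
- by rewrite -lee_fin (le_trans a0 la).
- by rewrite -lee_fin (le_trans (ua y) la).
- rewrite -lee_fin (le_trans _ lb)// (le_trans _ (ub y))// lee_fin.
  by have := coord_le_enorm (grad eta y) i; rewrite mxE.
- have [->|yy'] := eqVneq y y'; first by rewrite !subrr enorm0 mulr0 normr0.
  rewrite -ler_pdivrMr ?enorm_gt0 ?subr_eq0//.
  rewrite -lee_fin (le_trans _ lc)// (le_trans _ (uc _ _ yy'))// lee_fin.
  rewrite ler_pM2r ?invr_gt0 ?enorm_gt0 ?subr_eq0//.
  by have := coord_le_enorm (grad eta y - grad eta y') i; rewrite !mxE.
Qed.

Variables (eta : 'rV[R]_n -> R) (M : R).
Hypothesis deta : forall y, differentiable eta y.
Hypothesis M0 : 0 <= M.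
Hypothesis D_le : forall y (i : 'I_n), `|'D_(delta_mx ord0 i) eta y| <= M.
Hypothesis D_lip : forall y y' (i : 'I_n), `|'D_(delta_mx ord0 i) eta y -
        'D_(delta_mx ord0 i) eta y'| <= M * enorm (y - y').

Lemma C11_lipschitz x z : `|eta (x + z) - eta x| <= n%:R * M * enorm z.
Proof.
apply: dir_mean_value => s s01; first exact: diff_derivable.
rewrite (_ : _ * enorm z = n%:R * (enorm z * M)); last by ring.
by apply: dir_derive_le => // i; exact: coord_le_enorm.
Qed.

Lemma C11_second_difference x z :
  `|2 * eta x - eta (x + z) - eta (x - z)| <= 2 * n%:R * M * enorm z ^+ 2.
Proof.
rewrite (_ : 2 * _ * _ * _ = n%:R * (enorm z * (M * (2 * enorm z)))); last by ring.
apply: second_difference_le => // [i|s i s01]; first exact: coord_le_enorm.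
apply: (le_trans (D_lip _ _ _)); rewrite ler_wpM2l//.
rewrite (_ : _ - _ = (2 * s) *: z); last by apply/rowP => j; rewrite !mxE; ring.
rewrite enormZ ger0_norm; last by lra.
by rewrite ler_wpM2r ?enorm_ge0//; lra.
Qed.

Lemma C11_taylor x z :
  `|eta (x + z) - eta x - 'D_z eta x| <= n%:R * M * enorm z ^+ 2.
Proof.
have := @mean_value_bound R (fun s => eta (x + s *: z) - s * 'D_z eta x)
  (fun s => 'D_z eta (x + s *: z) - 'D_z eta x) (n%:R * M * enorm z ^+ 2).
rewrite scale1r scale0r mul0r mul1r addr0 subr0.
rewrite (_ : eta (x + z) - _ - _ = eta (x + z) - eta x - 'D_z eta x); last by ring.
apply=> s s01.
  have h1 : is_derive s 1 (fun s => eta (x + s *: z)) ('D_z eta (x + s *: z)).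
    by apply: is_derive_line; apply: derivableP; exact: diff_derivable.
  have h2 : is_derive s 1 (fun s => s * 'D_z eta x) ('D_z eta x).
    by apply: is_derive_eq; rewrite scaler0 add0r [_%:A]mulr1.
  exact: (is_deriveB h1 h2).
rewrite (_ : _ * _ * _ = n%:R * (enorm z * (M * enorm z))); last by ring.
apply: dir_derive_dist => // i; first exact: coord_le_enorm.
apply: (le_trans (D_lip _ _ _)); rewrite ler_wpM2l// addrAC subrr add0r enormZ.
by rewrite ger0_norm ?ler_piMl ?enorm_ge0//; lra.
Qed.

(* A nonnegative function lies above its osculating paraboloid, whose
   discriminant is therefore nonpositive. *)
Lemma C11_ge0_gradient x (i : 'I_n) : (forall y, 0 <= eta y) ->
  'D_(delta_mx ord0 i) eta x ^+ 2 <= 4 * n%:R * M * eta x.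
Proof.
move=> eta0; set d : R := 'D_ _ _ _.
have e1 : enorm (delta_mx ord0 i : 'rV[R]_n) = 1.
  rewrite /enorm (bigD1 i)//= big1 ?addr0 => [|j ji]; last first.
    by rewrite mxE/= (negbTE ji) expr0n.
  by rewrite mxE !eqxx expr1n sqrtr1.
have H (s : R) : 0 <= eta x + s * d + n%:R * M * s ^+ 2.
  have := C11_taylor x (s *: delta_mx ord0 i).
  rewrite enormZ e1 mulr1 real_normK ?num_real// ler_norml => /andP[_].
  rewrite deriveE// linearZ/= -deriveE// -/d => h.
  have := eta0 (x + s *: delta_mx ord0 i); move: h.
  by rewrite (_ : s *: d = s * d)//; lra.
have [nM|nM] := eqVneq (n%:R * M) 0.
  rewrite (_ : _ * eta x = 4 * (n%:R * M) * eta x); last by ring.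
  rewrite nM mulr0 mul0r; have [->|d0] := eqVneq d 0; first by rewrite expr0n.
  have := H (- (eta x + 1) / d); rewrite nM mul0r addr0 divfK//; lra.
rewrite (_ : _ * eta x = 4 * (n%:R * M) * eta x); last by ring.
move: nM H; set c := n%:R * M => c0 H.
have c_gt0 : 0 < c by rewrite lt_neqAle eq_sym c0 mulr_ge0.
have := H (- d / (2 * c)).
have -> : eta x + - d / (2 * c) * d + c * (- d / (2 * c)) ^+ 2 =
   eta x - d ^+ 2 / (4 * c) by field.
have c4 : 0 < 4 * c by lra.
by rewrite subr_ge0 ler_pdivrMr// => h; apply: le_trans h _; lra.
Qed.

End C11_functions.

Section scaled_mean_value.
Context {R : realType} {n : nat}.

Lemma dir_mean_value_scaled (f : 'rV[R]_n -> R) y e (c B : R) : 0 <= c ->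
  (forall z, derivable f z e) -> (forall z, `|'D_e f z| <= B) ->
  `|f (y + c *: e) - f y| <= c * B.
Proof.
move=> c0 df DB.
have dl (s : R) : is_derive s 1 (fun s => f (y + s *: e)) ('D_e f (y + s *: e)).
  by apply: is_derive_line; apply: derivableP.
have [|k _] := @MVT_segment R (fun s => f (y + s *: e))
    (fun s => 'D_e f (y + s *: e)) 0 c c0.
  by apply: derivable_within_continuous => s _; case: (dl s).
rewrite scale0r addr0 subr0 => ->.
by rewrite normrM [`|c|]ger0_norm// mulrC ler_wpM2l.
Qed.

End scaled_mean_value.

(** * Radial cutoffs of class C^1 *)

Section cutoff.
Context {R : realType} {n : nat}.
Implicit Types (x y z v : 'rV[R]_n).

(** The square removes the corner of the positive part at 0, so that the derivative exists
    everywhere and is explicit. *)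
Definition sqrpos (t : R) : R := Num.max t 0 ^+ 2.

Lemma is_derive_sqrpos (t : R) : is_derive t 1 sqrpos (2 * Num.max t 0).
Proof.
apply: is_derive_quadratic => h; rewrite /sqrpos.
rewrite ler_norml.
by rewrite /Num.max; do 2 case: ifPn => ?; apply/andP; split; nra.
Qed.

Lemma sqrpos_ge0 t : 0 <= sqrpos t. Proof. exact: sqr_ge0. Qed.

(* A radial function of class C^1, equal to 1 where [a |z|^2 <= 1] and to 0
   where [a |z|^2 >= 2]. *)
Definition cutoff (a : R) z : R := sqrpos (1 - sqrpos (a * enorm z ^+ 2 - 1)).

Lemma cutoff_ge0 a z : 0 <= cutoff a z. Proof. exact: sqrpos_ge0. Qed.

Lemma cutoff_le1 a z : cutoff a z <= 1.
Proof.
rewrite /cutoff; have := sqrpos_ge0 (a * enorm z ^+ 2 - 1).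
set q := sqrpos (_ - 1); rewrite /sqrpos => q0.
by rewrite -[leRHS](expr1n _ 2) ler_pXn2r ?nnegrE ?le_max ?lexx ?orbT// ge_max; lra.
Qed.

Lemma cutoff1 a z : a * enorm z ^+ 2 <= 1 -> cutoff a z = 1.
Proof.
move=> h; rewrite /cutoff /sqrpos (max_r (_ : a * _ - 1 <= 0)); last by lra.
by rewrite expr0n/= subr0 max_l// expr1n.
Qed.

Lemma cutoff0 a z : 2 <= a * enorm z ^+ 2 -> cutoff a z = 0.
Proof.
move=> h; rewrite /cutoff /sqrpos (max_l (_ : 0 <= a * _ - 1)); last by lra.
by rewrite max_r ?expr0n//; nra.
Qed.

Lemma cutoffN a z : cutoff a (- z) = cutoff a z.
Proof. by rewrite /cutoff enormN. Qed.

Lemma is_derive_enorm2 z v : enorm v <= 1 ->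
  is_derive z v (fun y => enorm y ^+ 2) (2 * \sum_i z ord0 i * v ord0 i).
Proof.
move=> v1; apply: is_derive_lineV; apply: is_derive_quadratic => h.
rewrite add0r scale0r addr0.
have -> : enorm (z + h *: v) ^+ 2 - enorm z ^+ 2 -
    h * (2 * \sum_i z ord0 i * v ord0 i) = h ^+ 2 * enorm v ^+ 2.
  rewrite !enorm_sqr -sumrB !mulr_sumr -sumrB.
  by apply: eq_bigr => i _; rewrite !mxE; ring.
have h2 := sqr_ge0 h; have v2 : enorm v ^+ 2 <= 1 by rewrite expr_le1// enorm_ge0.
have v0 := sqr_ge0 (enorm v).
by rewrite ger0_norm; nra.
Qed.

Lemma is_derive_cutoff a z v : enorm v <= 1 ->
  is_derive z v (cutoff a)
    (2 * Num.max (1 - sqrpos (a * enorm z ^+ 2 - 1)) 0 *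
     (- (2 * Num.max (a * enorm z ^+ 2 - 1) 0 *
       (a * (2 * \sum_i z ord0 i * v ord0 i))))).
Proof.
move=> v1; have h0 := is_derive_enorm2 z v1.
have h1 : is_derive z v (fun y => a * enorm y ^+ 2 - 1)
    (a * (2 * \sum_i z ord0 i * v ord0 i)).
  have := is_deriveB (is_deriveZ a h0) (is_derive_cst (1 : R) z v).
  by rewrite subr0.
have h2 := is_derive_comp_real h1 (is_derive_sqrpos _).
have h3 := is_deriveB (is_derive_cst (1 : R) z v) h2; rewrite sub0r in h3.
exact: (is_derive_comp_real h3 (is_derive_sqrpos _)).
Qed.

Lemma derivable_cutoff a z v : enorm v <= 1 -> derivable (cutoff a) z v.
Proof. by move=> v1; case: (is_derive_cutoff a z v1). Qed.

Lemma derive_cutoff_le a z v : 0 <= a -> enorm v <= 1 ->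
  `|'D_v (cutoff a) z| <= 8 * n%:R * a * enorm z.
Proof.
move=> a0 v1; have [_ ->] := is_derive_cutoff a z v1.
have := sqrpos_ge0 (a * enorm z ^+ 2 - 1); rewrite /sqrpos.
set m := Num.max (_ - 1) 0; set k := Num.max (1 - _) 0 => m2.
have m0 : 0 <= m by rewrite le_max lexx orbT.
have k0 : 0 <= k by rewrite le_max lexx orbT.
(* [k] vanishes unless [m] is at most 1, so the product of the two outer derivatives is bounded
   independently of z. *)
have km : k * m <= 1.
  by rewrite /k /Num.max; case: ifPn => [_|]; [rewrite mul0r|]; nra.
set S := \sum_i _; have HS : `|S| <= n%:R * enorm z.
  apply: le_trans (ler_norm_sum _ _ _) _.
  apply: (@le_trans _ _ (\sum_(i < n) enorm z)).
    apply: ler_sum => i _; rewrite normrM -[leRHS]mulr1 ler_pM ?coord_le_enorm//.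
    exact: le_trans (coord_le_enorm _ _) v1.
  by rewrite sumr_const card_ord mulr_natl.
rewrite (_ : _ * - _ = - (8 * (k * m) * a * S)); last by ring.
rewrite normrN normrM ger0_norm ?mulr_ge0//.
rewrite (_ : 8 * _ * _ * _ = 8 * 1 * a * (n%:R * enorm z)); last by ring.
by rewrite ler_pM// ?mulr_ge0// ler_wpM2r// ler_wpM2l.
Qed.

Lemma derive_cutoff0 a z v : enorm v <= 1 -> 2 <= a * enorm z ^+ 2 ->
  'D_v (cutoff a) z = 0.
Proof.
move=> v1 h; have [_ ->] := is_derive_cutoff a z v1.
rewrite /sqrpos [X in 1 - X ^+ 2]max_l; last by lra.
by rewrite [X in 2 * X * _]max_r ?mulr0 ?mul0r//; nra.
Qed.

Lemma derive_cutoff1 a z v : enorm v <= 1 -> a * enorm z ^+ 2 <= 1 ->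
  'D_v (cutoff a) z = 0.
Proof.
move=> v1 h; have [_ ->] := is_derive_cutoff a z v1.
by rewrite (max_r (_ : a * _ - 1 <= 0)) ?mulr0 ?mul0r ?oppr0 ?mulr0//; lra.
Qed.

(* The radial cutoffs at all scales share this scale-invariant bound. *)
Lemma derive_cutoff_enorm_le a z v : 0 <= a -> enorm v <= 1 ->
  `|'D_v (cutoff a) z| * enorm z <= 16 * n%:R.
Proof.
move=> a0 v1; have [h|h] := lerP 2 (a * enorm z ^+ 2).
  by rewrite derive_cutoff0// normr0 mul0r mulr_ge0.
apply: le_trans (ler_wpM2r (enorm_ge0 _) (derive_cutoff_le _ a0 v1)) _.
rewrite (_ : _ * enorm z = 8 * n%:R * (a * enorm z ^+ 2)); last by ring.
by rewrite (_ : 16 * n%:R = 8 * n%:R * 2); [rewrite ler_wpM2l ?mulr_ge0//|]; lra.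
Qed.

Lemma continuous_cutoff a : continuous (cutoff a).
Proof.
have cq : continuous sqrpos.
  move=> t; apply/differentiable_continuous/derivable1_diffP.
  by case: (is_derive_sqrpos t).
move=> z.
have h0 : enorm y ^+ 2 @[y --> z] --> enorm z ^+ 2.
  exact: (continuous_comp (@continuous_enorm _ _ z) (@exprn_continuous R 2 _)).
have h1 : {for z, continuous (fun z : 'rV[R]_n => a * enorm z ^+ 2 - 1)}.
  exact: (cvgB (cvgM (cvg_cst a) h0) (cvg_cst (1 : R))).
have h2 : {for z, continuous (fun z => 1 - sqrpos (a * enorm z ^+ 2 - 1))}.
  exact: (cvgB (cvg_cst (1 : R)) (continuous_comp h1 (cq _))).
exact: (continuous_comp h2 (cq _)).
Qed.

End cutoff.

(** * Integrals of real-valued functions *)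

Section integrable_real.
Context d (T : measurableType d) {R : realType}
  (mu : {measure set T -> \bar R}).
Implicit Types (f g : T -> R) (D A : set T).

Lemma integrable_le_fun D f g : measurable D -> measurable_fun D f ->
  mu.-integrable D (EFin \o g) -> (forall t, D t -> `|f t| <= g t) ->
  mu.-integrable D (EFin \o f).
Proof.
move=> mD mf ig fg; apply: (le_integrable mD _ _ ig).
  exact/measurable_EFinP.
by move=> t Dt /=; rewrite lee_fin (le_trans (fg t Dt))// ler_norm.
Qed.

Lemma integrable_cst_indic A (C : R) : measurable A -> (mu A < +oo)%E ->
  mu.-integrable setT (EFin \o (fun t => C * \1_A t)).
Proof.
move=> mA Afin.
have iA : mu.-integrable setT (EFin \o (\1_A : T -> R)).
  apply/integrableP; split; first exact/measurable_EFinP.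
  rewrite (eq_integral (fun x => (\1_A x)%:E)); last first.
    by move=> t _; rewrite /= ger0_norm.
  by rewrite integral_indic// setIT.
exact: (integrableZl measurableT C iA).
Qed.

Lemma Rintegral_cst_indic A (C : R) : measurable A -> (mu A < +oo)%E ->
  \int[mu]_t (C * \1_A t) = C * fine (mu A).
Proof.
move=> mA Afin.
have iA := integrable_cst_indic 1 mA Afin.
rewrite RintegralZl//; last first.
  by apply: eq_integrable iA => // t _; rewrite /= mul1r.
by rewrite /Rintegral integral_indic// setIT.
Qed.

End integrable_real.

Section integrable_real_fine.
Context d (T : measurableType d) {R : realType}
  (mu : {measure set T -> \bar R}).

Lemma Rintegral_EFin D (f : T -> R) : measurable D ->
  mu.-integrable D (EFin \o f) ->
  (\int[mu]_(t in D) (f t)%:E)%E = (\int[mu]_(t in D) f t)%:E.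
Proof. by move=> mD /(integrable_fin_num mD)/fineK. Qed.

End integrable_real_fine.

(** * The integral of a directional derivative of a compactly supported function vanishes *)

Section translation_invariance.
Context {R : realType} {n : nat}.
Local Notation T := (n.-tuple (measurableTypeR R)).
Local Notation mu := (@lebesgueT R n).

Lemma integral_affT (b : R) (a : 'rV[R]_n) (f : T -> \bar R) :
  b = 1 \/ b = -1 -> measurable_fun setT f ->
  (\int[mu]_t f (affT b a t) = \int[mu]_t f t)%E.
Proof.
move=> b1 mf; rewrite [LHS]integralE [RHS]integralE.
rewrite -[X in (X - _)%E](eq_integral _ (f^\+ \o affT b a)%E); last first.
  by move=> t _; rewrite -funepos_comp.
rewrite -[X in (_ - X)%E](eq_integral _ (f^\- \o affT b a)%E); last first.
  by move=> t _; rewrite -funeneg_comp.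
rewrite (@ge0_integral_affT _ _ _ _ f^\+%E)//; last exact: measurable_funepos.
by rewrite (@ge0_integral_affT _ _ _ _ f^\-%E)//; exact: measurable_funeneg.
Qed.

Lemma integrable_affT (b : R) (a : 'rV[R]_n) (f : T -> \bar R) :
  b = 1 \/ b = -1 -> mu.-integrable setT f ->
  mu.-integrable setT (f \o affT b a).
Proof.
move=> b1 /integrableP[mf fy]; apply/integrableP; split.
  by apply: measurableT_comp => //; exact: measurable_affT.
rewrite [ltLHS](@integral_affT b a (fun t => `|f t|)%E)//.
exact: measurableT_comp.
Qed.

(** The difference quotients [Q m] have integral zero by translation invariance, and dominated
    convergence passes to the limit; measurability of ['D_e F] comes with the limit. This is the
    only form of integration by parts in the proof. *)
Lemma integral_directional_derivative (F : 'rV[R]_n -> R) e x (r B : R) :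
  enorm e = 1 -> (forall y, derivable F y e) ->
  measurable_fun setT (F \o @vec R n) ->
  0 <= r -> (forall y, r <= `|y - x| -> F y = 0) ->
  (forall y, `|F y| <= B) -> (forall y, `|'D_e F y| <= B) ->
  mu.-integrable setT (EFin \o (fun t => 'D_e F (vec t))) /\
  \int[mu]_t 'D_e F (vec t) = 0.
Proof.
move=> e1 dF mF r0 F0 FB DB.
have B0 : 0 <= B by apply: le_trans (FB 0).
(* The half-side is r + 1, so that F vanishes outside the cube even after a shift by [v m], whose
   length is at most 1. *)
pose A : set T := cubeT (x - const_mx (r + 1)) (2 * (r + 1)).
have mA : measurable A by exact: measurable_cubeT.
have Afin : (mu A < +oo)%E.
  by rewrite lebesgueT_cubeT ?ltry// mulr_ge0// addr_ge0.
have Anot t : ~ A t -> r + 1 <= `|vec t - x|.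
  move=> At; rewrite leNgt; apply/negP => h; apply: At => i.
  have := le_lt_trans (coord_le_norm (vec t - x) i) h.
  by rewrite !mxE ltr_norml => /andP[] *; apply/andP; split; lra.
have iA := integrable_cst_indic B mA Afin.
have e_le : `|e| <= 1 by rewrite -e1 norm_le_enorm.
pose v (m : nat) : 'rV[R]_n := m.+1%:R^-1 *: e.
have v_le m : `|v m| <= 1.
  rewrite normrZ ger0_norm ?invr_ge0//.
  have : m.+1%:R^-1 <= 1 :> R by rewrite invf_le1// ler1n.
  have : 0 <= m.+1%:R^-1 :> R by rewrite invr_ge0.
  by move=> *; exact: mulr_ile1.
pose Q m (t : T) := m.+1%:R * (F (vec t + v m) - F (vec t)).
have mFv m : measurable_fun setT (fun t => F (vec t + v m)).
  rewrite (_ : (fun _ => _) = (F \o @vec R n) \o affT 1 (v m)).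
    by apply: measurableT_comp => //; exact: measurable_affT.
  by apply/funext => t /=; rewrite vec_affT scale1r.
have mQ m : measurable_fun setT (Q m).
  by apply: measurable_funM => //; exact: measurable_funB.
have iF : mu.-integrable setT (EFin \o (F \o @vec R n)).
  apply: (integrable_le_fun _ _ iA) => // t _; rewrite indicE.
  case: (boolP (t \in A)) => [_|/negP tA].
    by rewrite mulr1 /=; exact: FB.
  rewrite /= F0 ?normr0 ?mulr0//.
  have /Anot : ~ A t by move=> At; apply: tA; exact/mem_set.
  by move=> ?; lra.
have iFv m : mu.-integrable setT (EFin \o (fun t => F (vec t + v m))).
  apply: eq_integrable (@integrable_affT 1 (v m) _ (or_introl erefl) iF) => //.
  by move=> t _; rewrite /= vec_affT scale1r.
have iQ m : mu.-integrable setT (EFin \o Q m).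
  have := integrableZl measurableT m.+1%:R (integrableB measurableT (iFv m) iF).
  exact: eq_integrable.
have IQ m : \int[mu]_t Q m t = 0.
  rewrite RintegralZl//; last first.
    by have := integrableB measurableT (iFv m) iF; exact: eq_integrable.
  rewrite RintegralB// {1}/Rintegral.
  rewrite (eq_integral (fun t => (EFin \o (F \o @vec R n)) (affT 1 (v m) t))).
    rewrite integral_affT ?subrr ?mulr0//; first by left.
    exact/measurable_EFinP.
  by move=> t _; rewrite /= vec_affT scale1r.
have QB m t : `|Q m t| <= B * \1_A t.
  rewrite indicE /Q normrM ger0_norm//.
  case: (boolP (t \in A)) => [_|/negP tA].
    have m0 : 0 <= m.+1%:R^-1 :> R by rewrite invr_ge0.
    have := dir_mean_value_scaled (vec t) m0 dF DB; rewrite -/(v m) => h.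
    rewrite mulr1; apply: le_trans (ler_wpM2l _ h) _ => //.
    by rewrite mulrA mulfV ?mul1r.
  have /Anot h : ~ A t by move=> At; apply: tA; exact/mem_set.
  rewrite !F0 ?subrr ?normr0 ?mulr0//; first by move: h; lra.
  have := ler_normB (vec t + v m - x) (v m).
  have -> : vec t + v m - x - v m = vec t - x.
    by apply/rowP => i; rewrite !mxE; ring.
  by have := v_le m; lra.
have Qcvg t : Q m t @[m --> \oo] --> 'D_e F (vec t).
  have := dF (vec t); rewrite /derivable => cF.
  have h : (m.+1%:R^-1 : R) @[m --> \oo] --> 0^'.
    move=> P nP.
    have : \forall m \near \oo, (@harmonic R m != 0 -> P (@harmonic R m)).
      exact: (@cvg_harmonic R _ nP).
    by apply: filterS => m; apply; rewrite /harmonic invr_eq0 pnatr_eq0.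
  have := cvg_comp _ _ h cF; apply: cvg_trans; apply: near_eq_cvg.
  by apply: nearW => m /=; rewrite /Q invrK /v [_ + vec t]addrC.
have mD : measurable_fun setT (fun t => 'D_e F (vec t)).
  by apply: (@measurable_fun_cvg _ _ _ _ Q) => // t _; exact: Qcvg.
have [iD _ cI] := @dominated_convergence _ _ _ mu setT measurableT
  (fun m => EFin \o Q m) (EFin \o (fun t => 'D_e F (vec t)))
  (EFin \o (fun t => B * \1_A t)) ltac:(by move=> m; exact/measurable_EFinP)
  ltac:(exact/measurable_EFinP)
  ltac:(by apply: aeW => t _; apply: cvg_EFin; [exact: nearW|exact: Qcvg])
  iA ltac:(by apply: aeW => t m _; rewrite lee_fin; exact: QB).
split=> //.
have := cvg_lim _ cI; rewrite /Rintegral => <- //=.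
rewrite (_ : (fun _ => _) = cst 0%E); first by rewrite lim_cst.
by apply/funext => m /=; rewrite Rintegral_EFin// IQ.
Qed.

End translation_invariance.

(** * Integral bounds by summation over dyadic shells *)

Section dyadic.
Context {R : realType} {n : nat}.
Local Notation T := (n.-tuple (measurableTypeR R)).
Local Notation mu := (@lebesgueT R n).

Lemma dyadic_scale_le (a rho : R) : 0 < a -> a <= rho ->
  exists j, rho / 2 ^+ j.+1 < a <= rho / 2 ^+ j.
Proof.
move=> a0 arho.
have ex : exists j, rho / 2 ^+ j.+1 < a.
  exists (Num.truncn (rho / a)); rewrite ltr_pdivrMr ?exprn_gt0//.
  rewrite mulrC -ltr_pdivrMr//; apply: lt_trans (truncnS_gt _) _.
  by rewrite -natrX ltr_nat ltn_expl.
case: (ex_minnP ex) => j jlt jmin; exists j; rewrite jlt/=.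
case: j jlt jmin => [|j] _ jmin; first by rewrite expr0 divr1.
by rewrite leNgt; apply/negP => /jmin; rewrite ltnn.
Qed.

Lemma sum_geometric_le (q : R) N : 0 <= q < 1 ->
  \sum_(0 <= j < N) q ^+ j <= (1 - q)^-1.
Proof.
move=> /andP[q0 q1]; have q1' : 0 < 1 - q by lra.
rewrite -(ler_pM2l q1') mulfV ?gt_eqF// big_mkord.
have := subrX1 q N => E; have : 0 <= q ^+ N by exact: exprn_ge0.
move: E; set S := \sum_(_ < _) _ => E; nra.
Qed.

(** Each point is charged to one cube of side [2 * r j] on which the function is at most [A j]; the
    masses of these blocks form a geometric series. The cubes overlap, which is harmless for an
    upper bound. *)
Lemma integral_dyadic_le (f : T -> R) (A r : nat -> R) x (C q : R) :
  measurable_fun setT f -> (forall t, 0 <= f t) ->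
  (forall j, 0 <= A j) -> (forall j, 0 <= r j) -> 0 <= q < 1 -> 0 <= C ->
  (forall t, f t = 0 \/ exists j, f t <= A j /\ `|x - vec t| <= r j) ->
  (forall j, A j * (2 * r j) ^+ n <= C * q ^+ j) ->
  mu.-integrable setT (EFin \o f) /\ \int[mu]_t f t <= C / (1 - q).
Proof.
move=> mf f0 A0 r0 q01 C0 fA HC.
pose c j : set T := cubeT (x - const_mx (r j)) (2 * r j).
have mc j : measurable (c j) by exact: measurable_cubeT.
have muc j : mu (c j) = ((2 * r j) ^+ n)%:E.
  by rewrite lebesgueT_cubeT// mulr_ge0.
have h0 j t : (0 <= (A j * \1_(c j) t)%:E)%E.
  by rewrite lee_fin mulr_ge0.
have fle t : ((f t)%:E <= \sum_(j <oo) (A j * \1_(c j) t)%:E)%E.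
  have [->|[j [fj tj]]] := fA t; first exact: nneseries_ge0.
  apply: (@le_trans _ _ (\sum_(0 <= i < j.+1) (A i * \1_(c i) t)%:E)%E); last first.
    exact: nneseries_lim_ge.
  rewrite big_nat_recr//=; apply: (@le_trans _ _ (A j * \1_(c j) t)%:E).
    rewrite lee_fin indicE mem_set ?mulr1// => i.
    have := le_trans (coord_le_norm _ i) tj.
    by rewrite !mxE ler_norml => /andP[] *; apply/andP; split; lra.
  by rewrite leeDr//; apply: sume_ge0 => i _.
have mh j : measurable_fun setT (fun t => (A j * \1_(c j) t)%:E).
  by apply/measurable_EFinP; apply: measurable_funM.
have int_le : (\int[mu]_t (f t)%:E <= (C / (1 - q))%:E)%E.
  apply: (@le_trans _ _ (\int[mu]_t \sum_(j <oo) (A j * \1_(c j) t)%:E)%E).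
    apply: ge0_le_integral => //.
    - by move=> t _; rewrite lee_fin.
    - exact/measurable_EFinP.
    - apply: (ge0_emeasurable_sum (h := fun j t => (A j * \1_(c j) t)%:E)).
        by move=> j t _ _; exact: h0.
      by move=> j _; exact: mh.
  rewrite integral_nneseries//.
  apply: lime_le.
    by apply: is_cvg_nneseries => j _ _; exact: integral_ge0.
  apply: nearW => N.
  apply: (@le_trans _ _ (\sum_(0 <= j < N) (C * q ^+ j)%:E)%E).
    apply: lee_sum => j _.
    rewrite Rintegral_EFin//; last by apply: integrable_cst_indic; rewrite // muc ltry.
    by rewrite Rintegral_cst_indic// ?muc ?ltry//= lee_fin.
  rewrite sumEFin lee_fin -mulr_sumr ler_wpM2l//; exact: sum_geometric_le.
have intf : mu.-integrable setT (EFin \o f).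
  apply/integrableP; split; first exact/measurable_EFinP.
  rewrite (eq_integral (EFin \o f)) => [|t _]; last by rewrite /= ger0_norm.
  exact: le_lt_trans int_le (ltry _).
by split => //; rewrite -lee_fin -Rintegral_EFin.
Qed.

End dyadic.

(** * Doubling properties of the profile g *)

Section profile.
Context {R : realType}.
Variables (s1 s2 : R) (g : R -> R).
Hypothesis s1_gt0 : 0 < s1.
Hypothesis s2_lt1 : s2 < 1.
Hypothesis g_ge0 : forall r : R, 0 < r -> 0 <= g r.
Hypothesis g_decr : forall r r' : R, 0 < r -> r < r' -> g r' < g r.
Hypothesis g_derivable : forall r : R, 0 < r -> derivable g r 1.
Hypothesis g_growth : forall r : R, 0 < r ->
     2 * s1 * r^-1 * g r <= `|derive1 g r| <= 2 * s2 * r^-1 * g r.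

(** This is 2^(2s), the factor gained by r^(-2s) when r is halved. *)
Definition doubling (s : R) : R := expR (2 * s * ln 2).

Lemma doubling_gt1 : 1 < doubling s1.
Proof.
have l2 : 0 < ln (2 : R) by rewrite ln_gt0 ?ltr1n.
by rewrite -expR0 ltr_expR !mulr_gt0.
Qed.

Lemma doubling_gt0 s : 0 < doubling s. Proof. exact: expR_gt0. Qed.

(** Order below 2: when the radius is halved, |y|^2 loses a factor 4, more than g can gain. Hence
    the mass of |y|^2 K near the origin converges. *)
Lemma doubling_lt4 : doubling s2 < 4.
Proof.
have l2 : 0 < ln (2 : R) by rewrite ln_gt0 ?ltr1n.
have <- : expR (2 * ln 2) = 4 :> R.
  rewrite (_ : 2 * ln 2 = ln 2 + ln 2); last by ring.
  by rewrite expRD lnK ?posrE// -natrM.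
by rewrite ltr_expR -mulrA ltr_pM2l// gtr_pMl.
Qed.

Lemma profile_gt0 (r : R) : 0 < r -> 0 < g r.
Proof.
move=> r0; have r20 : 0 < 2 * r by lra.
by apply: le_lt_trans (g_ge0 r20) _; apply: g_decr; lra.
Qed.

Lemma profile_le r r' : 0 < r -> r <= r' -> g r' <= g r.
Proof.
by move=> r0; rewrite le_eqVlt => /orP[/eqP->//|rr']; exact/ltW/g_decr.
Qed.

Lemma profile_derive_le0 (r : R) : 0 < r -> derive1 g r <= 0.
Proof.
move=> r0; apply: (@decr_derive1_le0_itvy R g false 0 r).
- move=> x; rewrite ?inE/= ?in_itv/= ?andbT; exact: g_derivable.
- by move=> x y /[!in_itv]/=; rewrite ?andbT => x0 y0 xy; exact: g_decr.
- by rewrite in_itv/= r0.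
Qed.

(* The logarithmic derivative of g lies between -2 s2 / r and -2 s1 / r. *)
Lemma profile_log_mvt (r : R) : 0 < r ->
  exists2 c, 2 * s1 * ln 2 <= c <= 2 * s2 * ln 2 & g r = g (2 * r) * expR c.
Proof.
move=> r0; have r2 : 0 < 2 * r by lra.
have gr := profile_gt0 r0; have g2r := profile_gt0 r2.
exists (ln (g r) - ln (g (2 * r))); last first.
  by rewrite expRB !lnK ?posrE// mulrCA mulfV ?mulr1// gt_eqF.
have ln2r : ln (2 * r) = ln 2 + ln r by rewrite lnM ?posrE.
have dF (a s : R) : 0 < s -> is_derive s 1 (fun s => ln (g s) + a * ln s)
    (derive1 g s / g s + a * s^-1).
  move=> s0; have gs := profile_gt0 s0.
  have dg : is_derive s 1 g (derive1 g s).
    by rewrite derive1E; exact: derivableP (g_derivable s0).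
  have h1 := is_derive1_comp (is_derive1_ln gs) dg.
  have h2 := is_deriveZ a (is_derive1_ln s0).
  by apply: (is_derive_eq (is_deriveD h1 h2)); rewrite [_^-1 * _]mulrC.
have mvt (a : R) : exists2 c, r < c < 2 * r &
    ln (g (2 * r)) + a * ln (2 * r) - (ln (g r) + a * ln r) =
    (derive1 g c / g c + a * c^-1) * r.
  have rr : r < 2 * r by lra.
  have [||c] := @MVT R (fun s => ln (g s) + a * ln s)
    (fun s => derive1 g s / g s + a * s^-1) _ _ rr.
  - by move=> s /[!in_itv]/= /andP[rs _]; apply: dF; lra.
  - apply: derivable_within_continuous => s /[!in_itv]/= /andP[rs _].
    by have := dF a s ltac:(lra); case.
  rewrite in_itv/= => cr ->; exists c => //; congr (_ * _); lra.
have bound (c : R) : 0 < c -> - (2 * s2 * c^-1) <= derive1 g c / g c <= - (2 * s1 * c^-1).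
  move=> c0; have := g_growth c0; rewrite ler0_norm ?profile_derive_le0//.
  have gc := profile_gt0 c0.
  by rewrite ler_pdivlMr// ler_pdivrMr// => /andP[h1 h2]; apply/andP; split; lra.
apply/andP; split.
  have [c /andP[rc _]] := mvt (2 * s1); have c0 : 0 < c by lra.
  have /andP[_] := bound c c0; rewrite ln2r => h E.
  suff : (derive1 g c / g c + 2 * s1 * c^-1) * r <= 0 by rewrite -E; lra.
  by rewrite pmulr_lle0//; lra.
have [c /andP[rc _]] := mvt (2 * s2); have c0 : 0 < c by lra.
have /andP[+ _] := bound c c0; rewrite ln2r => h E.
suff : 0 <= (derive1 g c / g c + 2 * s2 * c^-1) * r by rewrite -E; lra.
by rewrite pmulr_lge0//; lra.
Qed.

Lemma profile_double (r : R) : 0 < r -> g r <= g (2 * r) * doubling s2.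
Proof.
move=> r0; have [c /andP[_ c2] ->] := profile_log_mvt r0.
by rewrite ler_wpM2l ?ler_expR// g_ge0//; lra.
Qed.

Lemma profile_halve (r : R) : 0 < r -> g (2 * r) * doubling s1 <= g r.
Proof.
move=> r0; have [c /andP[c1 _] ->] := profile_log_mvt r0.
by rewrite ler_wpM2l ?ler_expR// g_ge0//; lra.
Qed.

Lemma profile_dyadic_down (r : R) j : 0 < r ->
  g (r / 2 ^+ j) <= g r * doubling s2 ^+ j.
Proof.
move=> r0; elim: j => [|j IH]; first by rewrite !expr0 divr1 mulr1.
have rj : 0 < r / 2 ^+ j.+1 by rewrite divr_gt0 ?exprn_gt0.
have := profile_double rj.
have -> : 2 * (r / 2 ^+ j.+1) = r / 2 ^+ j.
  by rewrite exprS invfM mulrCA mulVKf.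
move=> h; apply: le_trans h _; rewrite exprSr mulrA ler_wpM2r//.
exact/ltW/doubling_gt0.
Qed.

Lemma profile_dyadic_up (r : R) j : 0 < r ->
  g (r * 2 ^+ j) <= g r * (doubling s1)^-1 ^+ j.
Proof.
move=> r0; elim: j => [|j IH]; first by rewrite !expr0 !mulr1.
have rj : 0 < r * 2 ^+ j by rewrite mulr_gt0 ?exprn_gt0.
have := profile_halve rj; rewrite -ler_pdivlMr ?doubling_gt0//.
rewrite (_ : 2 * (r * _) = r * 2 ^+ j.+1); last by rewrite exprS; ring.
move=> h; apply: le_trans h _; rewrite exprSr mulrA ler_wpM2r//.
by rewrite invr_ge0 ltW ?doubling_gt0.
Qed.

End profile.

(** * Mass of the kernel near its singularity and at infinity *)

Section kernel.
Context {R : realType} {n : nat}.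
Local Notation T := (n.-tuple (measurableTypeR R)).
Local Notation mu := (@lebesgueT R n).
Variables (s1 s2 lambda Lambda : R) (g : R -> R) (K : 'rV[R]_n -> \bar R).
Hypothesis s1_gt0 : 0 < s1.
Hypothesis s2_lt1 : s2 < 1.
Hypothesis lambda_gt0 : 0 < lambda.
Hypothesis lambda_le : lambda <= Lambda.
Hypothesis g_ge0 : forall r : R, 0 < r -> 0 <= g r.
Hypothesis g_decr : forall r r' : R, 0 < r -> r < r' -> g r' < g r.
Hypothesis g_derivable : forall r : R, 0 < r -> derivable g r 1.
Hypothesis g_growth : forall r : R, 0 < r ->
     2 * s1 * r^-1 * g r <= `|derive1 g r| <= 2 * s2 * r^-1 * g r.
Hypothesis K_ge0 : forall y, (0 <= K y)%E.
Hypothesis K_even : forall y, K (- y) = K y.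
Hypothesis K_bounds : forall y, y != 0 ->
  ((lambda * enorm y ^- n * g (enorm y))%:E <= K y)%E /\
  (K y <= (Lambda * enorm y ^- n * g (enorm y))%:E)%E.
Hypothesis K_differentiable :
  forall y, y != 0 -> differentiable (fun z => fine (K z)) y.

Lemma continuous_opp_shift (x y : 'rV[R]_n) :
  {for y, continuous (fun z : 'rV[R]_n => x - z)}.
Proof. by apply: (@continuousB _ _ _ (cst x) id); [exact: cst_continuous|]. Qed.

Definition dist (x : 'rV[R]_n) (t : T) : R := enorm (x - vec t).

(* The value at [t = x], where [K] may be infinite, is irrelevant. *)
Definition kern (x : 'rV[R]_n) (t : T) : R :=
  if vec t == x then 0 else fine (K (x - vec t)).

Definition nearS x (rho : R) : set T := [set t | dist x t <= rho].

Definition farS x (rho : R) : set T := [set t | rho <= dist x t].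

Lemma dist_ge0 x t : 0 <= dist x t. Proof. exact: enorm_ge0. Qed.

Lemma dist_gt0 x t : (0 < dist x t) = (vec t != x).
Proof. by rewrite enorm_gt0 subr_eq0 eq_sym. Qed.

Lemma measurable_dist x : measurable_fun setT (dist x).
Proof.
apply: (measurable_fun_vec (f := fun y => enorm (x - y))) => // t _.
exact: (continuous_comp (@continuous_opp_shift x (vec t)) (@continuous_enorm _ _ _)).
Qed.

Lemma measurable_outside x (rho : R) : measurable (outside x rho : set T).
Proof.
rewrite (_ : outside x rho = dist x @^-1` `]rho, +oo[%classic).
  by rewrite -[X in measurable X]setTI; exact: measurable_dist.
by apply/seteqP; split=> t /=; rewrite in_itv/= andbT.
Qed.

Lemma nearSE x rho : nearS x rho = ~` outside x rho.
Proof.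
apply/seteqP; split=> t; rewrite /nearS/outside/=.
  by rewrite leNgt => /negP.
by move/negP; rewrite -leNgt.
Qed.

Lemma measurable_nearS x rho : measurable (nearS x rho).
Proof. by rewrite nearSE; apply: measurableC; exact: measurable_outside. Qed.

Lemma measurable_farS x rho : measurable (farS x rho).
Proof.
rewrite (_ : farS x rho = dist x @^-1` `[rho, +oo[%classic).
  by rewrite -[X in measurable X]setTI; exact: measurable_dist.
by apply/seteqP; split=> t /=; rewrite in_itv/= andbT.
Qed.

Lemma K_fin y : y != 0 -> K y \is a fin_num.
Proof.
by move=> y0; rewrite ge0_fin_numE// (le_lt_trans (K_bounds y0).2)// ltry.
Qed.

Lemma kernE x t : vec t != x -> K (x - vec t) = (kern x t)%:E.
Proof.
move=> tx; rewrite /kern (negbTE tx) fineK// K_fin// subr_eq0 eq_sym//.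
Qed.

Lemma kern_ge0 x t : 0 <= kern x t.
Proof. by rewrite /kern; case: ifP => // _; rewrite fine_ge0. Qed.

Lemma kern_le x t : vec t != x ->
  kern x t <= Lambda * dist x t ^- n * g (dist x t).
Proof.
move=> tx; rewrite -lee_fin -kernE//; apply: (K_bounds _).2.
by rewrite subr_eq0 eq_sym.
Qed.

Lemma kern_ge x t : vec t != x ->
  lambda * dist x t ^- n * g (dist x t) <= kern x t.
Proof.
move=> tx; rewrite -lee_fin -kernE//; apply: (K_bounds _).1.
by rewrite subr_eq0 eq_sym.
Qed.

Lemma measurable_kern x : measurable_fun setT (kern x).
Proof.
have mD : measurable [set t : T | vec t != x].
  rewrite (_ : [set t | _] = outside x 0); first exact: measurable_outside.
  by apply/seteqP; split=> t; rewrite /outside/= -/(dist x t) dist_gt0.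
rewrite (_ : kern x = ((fun y => fine (K (x - y))) \o @vec R n) \_
    [set t : T | vec t != x]).
  apply: (measurable_restrictT _ mD).1.
  apply: (measurable_fun_vec (f := fun y => fine (K (x - y)))) => // t /= tx.
  have c2 : {for x - vec t, continuous (fun z => fine (K z))}.
    apply: differentiable_continuous.
    by apply: K_differentiable; rewrite subr_eq0 eq_sym.
  exact: (continuous_comp (@continuous_opp_shift x (vec t)) c2).
apply/funext => t; rewrite /patch /kern.
case: ifPn => [/eqP tx|tx]; last by rewrite mem_set.
by rewrite memNset//=; apply/negP; rewrite negbK; apply/eqP.
Qed.

Lemma kern_reflect x t : kern x (affT (-1) (2 *: x) t) = kern x t.
Proof.
rewrite /kern vec_affT scaleN1r.
have -> : (- vec t + 2 *: x == x) = (vec t == x).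
  apply/eqP/eqP => [h|->]; apply/rowP => i; last by rewrite !mxE; ring.
  by have := congr1 (fun v : 'rV[R]_n => v ord0 i) h; rewrite !mxE; lra.
case: ifP => // _; congr fine; rewrite -K_even; congr K.
by apply/rowP => i; rewrite !mxE; ring.
Qed.

Lemma dist_reflect x t : dist x (affT (-1) (2 *: x) t) = dist x t.
Proof.
rewrite /dist vec_affT -enormN; congr enorm.
by apply/rowP => i; rewrite !mxE; ring.
Qed.

(** Sum of a geometric series of ratio [doubling s2 / 4]. The factor [4 ^+ n] compares the cube
    around a shell with the n-th power of the inner radius; the extra [doubling s2] comes from
    evaluating g at that inner radius. *)
Definition near_const : R := (4 ^+ n * doubling s2) / (1 - doubling s2 / 4).
Definition far_const : R := 4 ^+ n / (1 - (doubling s1)^-1).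

Let q2 : 0 <= doubling s2 / 4 < 1.
Proof.
have := doubling_lt4 s2_lt1; have := doubling_gt0 s2 => ? ?.
by apply/andP; split; lra.
Qed.

Let q1 : 0 <= (doubling s1)^-1 < 1.
Proof.
by rewrite invr_ge0 ltW ?doubling_gt0//= invf_lt1 ?doubling_gt0// doubling_gt1.
Qed.

Lemma near_const_ge0 : 0 <= near_const.
Proof.
have /andP[_ ?] := q2; rewrite divr_ge0//; last by lra.
by rewrite mulr_ge0 ?exprn_ge0// ltW ?doubling_gt0.
Qed.

Lemma far_const_ge0 : 0 <= far_const.
Proof. by have /andP[_ ?] := q1; rewrite divr_ge0 ?exprn_ge0//; lra. Qed.

Let Lambda_gt0 : 0 < Lambda. Proof. exact: lt_le_trans lambda_le. Qed.

(** On the shell between rho/2^(j+1) and rho/2^j the volume compensates |y|^(-n), the square of the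
    distance gives 4^(-j), and g is at most [doubling s2 ^+ j.+1] times [g rho]. *)
Lemma near_mass x (rho : R) : 0 < rho ->
  mu.-integrable setT (EFin \o (fun t => dist x t ^+ 2 * kern x t * \1_(nearS x rho) t)) /\
  \int[mu]_t (dist x t ^+ 2 * kern x t * \1_(nearS x rho) t) <=
    near_const * (Lambda * rho ^+ 2 * g rho).
Proof.
move=> rho0; have grho := profile_gt0 g_ge0 g_decr rho0.
pose D := doubling s2; have D0 : 0 < D := doubling_gt0 s2.
pose A j := Lambda * rho ^+ 2 * g rho * 4^-1 ^+ j *
  (2 ^+ j.+1 / rho) ^+ n * D ^+ j.+1.
pose r j := rho / 2 ^+ j.
have p2 j : 0 < 2 ^+ j :> R by exact: exprn_gt0.
have := @integral_dyadic_le R n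
  (fun t => dist x t ^+ 2 * kern x t * \1_(nearS x rho) t) A r x
  (Lambda * rho ^+ 2 * g rho * 4 ^+ n * D) (D / 4).
have -> : Lambda * rho ^+ 2 * g rho * 4 ^+ n * D / (1 - D / 4) =
   near_const * (Lambda * rho ^+ 2 * g rho) by rewrite /near_const -/D; ring.
apply.
- apply: measurable_funM; last first.
    by apply: measurable_indic; exact: measurable_nearS.
  apply: measurable_funM; last exact: measurable_kern.
  by apply: measurable_funX; exact: measurable_dist.
- by move=> t; rewrite indicE !mulr_ge0 ?exprn_ge0 ?dist_ge0 ?kern_ge0 ?ler0n.
- by move=> j; rewrite !mulr_ge0 ?exprn_ge0 ?divr_ge0 ?exprn_ge0 ?ltW// mulr_gt0.
- by move=> j; rewrite divr_ge0 ?exprn_ge0 ?ltW.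
- exact: q2.
- by rewrite !mulr_ge0 ?exprn_ge0// ltW.
- move=> t; have [tx|tx] := eqVneq (vec t) x.
    by left; rewrite /kern tx eqxx mulr0 mul0r.
  rewrite indicE; have [|tn] := boolP (t \in nearS x rho); last first.
    by left; rewrite mulr0.
  rewrite inE /nearS/= => dr; right.
  have d0 : 0 < dist x t by rewrite dist_gt0.
  have [j /andP[jl ju]] := dyadic_scale_le d0 dr; exists j; split; last first.
    exact: le_trans (norm_le_enorm _) ju.
  have rj0 : 0 < rho / 2 ^+ j.+1 by rewrite divr_gt0.
  rewrite mulr1; apply: le_trans (ler_wpM2l _ (kern_le tx)) _.
    exact: sqr_ge0.
  have g1 : g (dist x t) <= g rho * D ^+ j.+1.
    apply: le_trans (profile_dyadic_down g_ge0 g_decr g_derivable g_growth _ rho0).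
    by apply: (profile_le g_decr) => //; exact: ltW.
  have d1 : dist x t ^+ 2 <= rho ^+ 2 * 4^-1 ^+ j.
    have -> : rho ^+ 2 * 4^-1 ^+ j = (rho / 2 ^+ j) ^+ 2.
      have -> : 4^-1 = 2^-1 ^+ 2 :> R by field.
      by rewrite -exprM mulnC exprM exprVn -exprMn.
    by rewrite ler_pXn2r ?nnegrE ?dist_ge0// divr_ge0 ?exprn_ge0// ltW.
  have d2 : dist x t ^- n <= (2 ^+ j.+1 / rho) ^+ n.
    have pr : 0 < 2 ^+ j.+1 / rho by rewrite divr_gt0.
    rewrite -exprVn lerXn2r ?nnegrE ?invr_ge0 ?dist_ge0 ?(ltW pr)//.
    by rewrite -[leRHS]invrK lef_pV2 ?posrE ?invr_gt0// invf_div ltW.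
  rewrite /A; have -> : Lambda * rho ^+ 2 * g rho * 4^-1 ^+ j *
    (2 ^+ j.+1 / rho) ^+ n * D ^+ j.+1 = rho ^+ 2 * 4^-1 ^+ j *
    (Lambda * (2 ^+ j.+1 / rho) ^+ n * (g rho * D ^+ j.+1)) by ring.
  have gd : 0 <= g (dist x t) by exact: g_ge0.
  apply: ler_pM => //; first exact: sqr_ge0.
    by rewrite !mulr_ge0 ?invr_ge0 ?exprn_ge0// ?ltW.
  apply: ler_pM => //; first by rewrite mulr_ge0 ?invr_ge0 ?exprn_ge0// ltW.
  by rewrite ler_wpM2l// ltW.
- move=> j; rewrite /A /r.
  have -> : Lambda * rho ^+ 2 * g rho * 4^-1 ^+ j * (2 ^+ j.+1 / rho) ^+ n *
     D ^+ j.+1 * (2 * (rho / 2 ^+ j)) ^+ n = Lambda * rho ^+ 2 * g rho * D *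
     (D / 4) ^+ j * ((2 ^+ j.+1 / rho) * (2 * (rho / 2 ^+ j))) ^+ n.
    move: (2 ^+ j.+1 / rho) (2 * (rho / 2 ^+ j)) => a b.
    by rewrite [D ^+ j.+1]exprS [(a * b) ^+ n]exprMn [(D / 4) ^+ j]exprMn; ring.
  have -> : 2 ^+ j.+1 / rho * (2 * (rho / 2 ^+ j)) = 4.
    by rewrite exprS; field; rewrite !gt_eqF.
  by rewrite le_eqVlt; apply/orP; left; apply/eqP; ring.
Qed.

(** On the shell between rho 2^j and rho 2^(j+1) the volume again compensates |y|^(-n), and g has
    decayed by [doubling s1 ^+ j], with [doubling s1] above 1. *)
Lemma far_mass x (rho : R) : 0 < rho ->
  mu.-integrable setT (EFin \o (fun t => kern x t * \1_(farS x rho) t)) /\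
  \int[mu]_t (kern x t * \1_(farS x rho) t) <= far_const * (Lambda * g rho).
Proof.
move=> rho0; have grho := profile_gt0 g_ge0 g_decr rho0.
pose D := (doubling s1)^-1; have D0 : 0 < D by rewrite invr_gt0 doubling_gt0.
pose A j := Lambda * (rho * 2 ^+ j) ^- n * (g rho * D ^+ j).
pose r j := rho * 2 ^+ j.+1.
have p2 j : 0 < 2 ^+ j :> R by exact: exprn_gt0.
have := @integral_dyadic_le R n
  (fun t => kern x t * \1_(farS x rho) t) A r x
  (Lambda * g rho * 4 ^+ n) D.
have -> : Lambda * g rho * 4 ^+ n / (1 - D) =
   far_const * (Lambda * g rho) by rewrite /far_const -/D; ring.
apply.
- apply: measurable_funM; first exact: measurable_kern.
  by apply: measurable_indic; exact: measurable_farS.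
- by move=> t; rewrite mulr_ge0 ?kern_ge0// indicE.
- move=> j; rewrite !mulr_ge0 ?invr_ge0 ?exprn_ge0 ?ltW//.
  by rewrite mulr_gt0.
- by move=> j; rewrite mulr_ge0 ?exprn_ge0 ?ltW.
- exact: q1.
- by rewrite !mulr_ge0 ?exprn_ge0// ltW.
- move=> t; have [tx|tx] := eqVneq (vec t) x.
    by left; rewrite /kern tx eqxx mul0r.
  rewrite indicE; have [|tn] := boolP (t \in farS x rho); last first.
    by left; rewrite mulr0.
  rewrite inE /farS/= => dr; right; have d0 : 0 < dist x t by rewrite dist_gt0.
  (* The dyadic scale is taken with the roles exchanged: rho is the small length, the distance the
     large one. *)
  have [j /andP[jl ju]] := dyadic_scale_le rho0 dr.
  rewrite ltr_pdivrMr// in jl; rewrite ler_pdivlMr// in ju.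
  exists j; split; last exact: le_trans (norm_le_enorm _) (ltW jl).
  have rj0 : 0 < rho * 2 ^+ j by rewrite mulr_gt0.
  rewrite mulr1; apply: (le_trans (kern_le tx)); rewrite /A.
  have g1 : g (dist x t) <= g rho * D ^+ j.
    apply: le_trans (profile_dyadic_up g_ge0 g_decr g_derivable g_growth _ rho0).
    exact: (profile_le g_decr).
  have d2 : dist x t ^- n <= (rho * 2 ^+ j) ^- n.
    by rewrite lef_pV2 ?posrE ?exprn_gt0// lerXn2r ?nnegrE ?(ltW rj0) ?dist_ge0.
  have gd : 0 <= g (dist x t) by exact: g_ge0.
  have dn0 : 0 <= dist x t ^- n by rewrite invr_ge0 exprn_ge0 ?ltW.
  apply: ler_pM => //; first by rewrite mulr_ge0// ltW.
  by rewrite ler_wpM2l// ltW.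
- move=> j; rewrite /A /r.
  have -> : Lambda * (rho * 2 ^+ j) ^- n * (g rho * D ^+ j) *
      (2 * (rho * 2 ^+ j.+1)) ^+ n =
    Lambda * g rho * D ^+ j * ((rho * 2 ^+ j)^-1 * (2 * (rho * 2 ^+ j.+1))) ^+ n.
    by move: (rho * 2 ^+ j) (2 * _) => a b; rewrite -exprVn exprMn; ring.
  have -> : (rho * 2 ^+ j)^-1 * (2 * (rho * 2 ^+ j.+1)) = 4.
    by rewrite exprS; field; rewrite !gt_eqF.
  by rewrite le_eqVlt; apply/orP; left; apply/eqP; ring.
Qed.

End kernel.

Ltac nneg := repeat first [done | exact: sqr_ge0 | exact: ltW | exact: normr_ge0
  | exact: dist_ge0 | exact: enorm_ge0 | apply: addr_ge0 | apply: mulr_ge0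
  | rewrite invr_ge0 | apply: exprn_ge0].

Lemma normrM_le (R : realType) (a b A B : R) :
  `|a| <= A -> `|b| <= B -> `|a * b| <= A * B.
Proof. by move=> aA bB; rewrite normrM ler_pM. Qed.

(** * Comparison of integrals, translated derivatives *)

Section integral_comparison.
Context d (T : measurableType d) {R : realType}
  (mu : {measure set T -> \bar R}).

Lemma integrable_scale (D : set T) (c : R) (f : T -> R) : measurable D ->
  mu.-integrable D (EFin \o f) -> mu.-integrable D (EFin \o (fun t => c * f t)).
Proof. by move=> mD h; exact: (integrableZl mD c h). Qed.

Lemma integrable_add (D : set T) (f h : T -> R) : measurable D ->
  mu.-integrable D (EFin \o f) -> mu.-integrable D (EFin \o h) ->
  mu.-integrable D (EFin \o (fun t => f t + h t)).
Proof. by move=> mD h1 h2; exact: (integrableD mD h1 h2). Qed.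

Lemma Rintegral_le_setT (D : set T) (f h : T -> R) : measurable D ->
  mu.-integrable D (EFin \o f) -> mu.-integrable setT (EFin \o h) ->
  (forall t, 0 <= h t) -> (forall t, D t -> f t <= h t) ->
  \int[mu]_(t in D) f t <= \int[mu]_t h t.
Proof.
move=> mD fD hT h0 fh.
have hD : mu.-integrable D (EFin \o h) by exact: integrableS hT.
apply: (@le_trans _ _ (\int[mu]_(t in D) h t)); first exact: le_Rintegral.
rewrite -lee_fin -!Rintegral_EFin//.
apply: ge0_subset_integral => //; last by move=> t _; rewrite lee_fin.
by case/integrableP: hT.
Qed.

End integral_comparison.

Section translated_derivative.
Context {R : realType} {n : nat}.

Lemma is_derive_translate (f : 'rV[R]_n -> R) x y e (d : R) :
  is_derive (y - x) e f d -> is_derive y e (fun z => f (z - x)) d.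
Proof.
move=> df; apply: is_derive_lineV.
have -> : (fun s : R => f (y + s *: e - x)) = (fun s => f (y - x + s *: e)).
  by apply/funext => s; rewrite addrAC.
by apply: is_derive_line; rewrite scale0r addr0.
Qed.

End translated_derivative.

(** * Interpolation: A^2 G is controlled by the energy and by the oscillation of u *)

Section interpolation.
Context {R : realType} {n : nat}.
Local Notation T := (n.-tuple (measurableTypeR R)).
Local Notation mu := (@lebesgueT R n).
Local Notation N := (n%:R : R).
Variables (eta u w p m : 'rV[R]_n -> R) (k : T -> R) (x e : 'rV[R]_n).
Variables (M rho G H Bu : R).
Hypothesis n_gt0 : (0 < n)%N.
Hypothesis e1 : enorm e = 1.
Hypothesis deta : forall y, differentiable eta y.
Hypothesis D_le : forall y (i : 'I_n), `|'D_(delta_mx ord0 i) eta y| <= M.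
Hypothesis eta_ge0 : forall y, 0 <= eta y.
Hypothesis eta_le : forall y, eta y <= M.
Hypothesis du : forall y, is_derive y e u (w y).
Hypothesis cu : continuous u.
Hypothesis cw : continuous w.
Hypothesis u_le : forall y, `|u y| <= Bu.
Hypothesis wE : forall y, w y = p y - m y.
Hypothesis pm0 : p x * m x = 0.
Hypothesis pm_ge0 : forall y, 0 <= p x * m y.
Hypothesis rho_gt0 : 0 < rho.
Hypothesis G_gt0 : 0 < G.
Hypothesis k_ge0 : forall t, 0 <= k t.
Hypothesis k_ge : forall t, vec t != x -> dist x t <= rho -> G <= rho ^+ n * k t.
Hypothesis eta_H : eta x <= H * rho.

Definition energy (t : T) : R := (eta x * p x - eta (vec t) * p (vec t)) ^+ 2 +
  2 * eta x * eta (vec t) * (p x * m (vec t)).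
Definition gap (t : T) : R := (u x - u (vec t)) ^+ 2.

Lemma energy_ge0 t : 0 <= energy t.
Proof.
by rewrite /energy addr_ge0 ?sqr_ge0// mulr_ge0// mulr_ge0// mulr_ge0.
Qed.

Lemma gap_ge0 t : 0 <= gap t. Proof. exact: sqr_ge0. Qed.

Let phi y : R := cutoff (4 / rho ^+ 2) (y - x).
Let dphi y : R := 'D_e (cutoff (4 / rho ^+ 2)) (y - x).
(** Its derivative along e integrates to zero, which trades the integral of [w eta phi] for that of
    [(u - u x) dpsi]. Subtracting [u x] is what makes the gap appear. *)
Let F y : R := (u y - u x) * (eta y * phi y).
Let dpsi y : R := 'D_e eta y * phi y + eta y * dphi y.

(** Bound on the derivative of [eta phi]: [N * M] from eta, and for phi a slope at most 32 N / rho
    multiplied by eta <= (H + N M) rho on the ball. The powers of rho cancel. *)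
Definition interp_slope : R := N * M + 32 * N * (H + N * M).
Local Notation H3 := interp_slope.

Let a_gt0 : 0 < 4 / rho ^+ 2 :> R.
Proof. by rewrite divr_gt0// exprn_gt0. Qed.

Let M_ge0 : 0 <= M. Proof. exact: le_trans (eta_ge0 x) (eta_le x). Qed.

Let phi_out y : rho <= enorm (y - x) -> phi y = 0 /\ dphi y = 0.
Proof.
move=> h; have h2 : 2 <= 4 / rho ^+ 2 * enorm (y - x) ^+ 2.
  rewrite mulrAC ler_pdivlMr ?exprn_gt0//.
  have : rho ^+ 2 <= enorm (y - x) ^+ 2 by rewrite lerXn2r ?nnegrE ?enorm_ge0 ?(ltW rho_gt0).
  by have := sqr_ge0 rho; lra.
by split; [exact: cutoff0|apply: derive_cutoff0 => //; rewrite e1].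
Qed.

Let phi_in y : enorm (y - x) <= rho / 2 -> phi y = 1.
Proof.
move=> h; apply: cutoff1; rewrite mulrAC ler_pdivrMr ?exprn_gt0// mul1r.
have -> : rho ^+ 2 = 4 * (rho / 2) ^+ 2 by field.
by rewrite ler_pM2l// lerXn2r ?nnegrE ?enorm_ge0// divr_ge0// (ltW rho_gt0).
Qed.

Let deta_le y : `|'D_e eta y| <= N * M.
Proof.
rewrite -[M]mul1r; apply: dir_derive_le => // i.
by rewrite -e1 coord_le_enorm.
Qed.

Let H_ge0 : 0 <= H.
Proof. by have := le_trans (eta_ge0 x) eta_H; rewrite pmulr_lge0. Qed.

Let NM_ge0 : 0 <= N * M. Proof. exact: mulr_ge0. Qed.

Let H3_ge0 : 0 <= H3.
Proof. by rewrite /interp_slope addr_ge0// mulr_ge0 ?addr_ge0// mulr_ge0. Qed.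

Let eta_near y : enorm (y - x) <= rho -> eta y <= (H + N * M) * rho.
Proof.
move=> h; have := C11_lipschitz deta D_le x (y - x).
rewrite subrKC ler_norml => /andP[_ h1].
have := ler_wpM2l NM_ge0 h; have := eta_H; lra.
Qed.

Let dpsi_le y : `|dpsi y| <= H3.
Proof.
have [h|h] := lerP rho (enorm (y - x)).
  have [E1 E2] := phi_out h; rewrite /dpsi E1 E2 !mulr0 addr0 normr0.
  exact: H3_ge0.
apply: le_trans (ler_normD _ _) _; rewrite /interp_slope; apply: lerD.
  rewrite normrM -[leRHS]mulr1; apply: ler_pM => //.
  by rewrite ger0_norm ?cutoff_ge0 ?cutoff_le1.
rewrite normrM (ger0_norm (eta_ge0 y)).
have h1 := eta_near (ltW h).
have h2 : `|dphi y| <= 8 * N * (4 / rho ^+ 2) * rho.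
  apply: le_trans (derive_cutoff_le _ (ltW a_gt0) _) _; first by rewrite e1.
  apply: ler_wpM2l (ltW h); apply: mulr_ge0; last exact: ltW.
  exact: mulr_ge0.
have -> : 32 * N * (H + N * M) =
    (H + N * M) * rho * (8 * N * (4 / rho ^+ 2) * rho).
  by field; rewrite gt_eqF.
by apply: ler_pM.
Qed.

Let dF y : is_derive y e F (w y * (eta y * phi y) + (u y - u x) * dpsi y).
Proof.
have h1 : is_derive y e (fun z => u z - u x) (w y).
  have := is_deriveB (du y) (is_derive_cst (u x) y e).
  by rewrite subr0.
have h2 : is_derive y e eta ('D_e eta y) by exact/derivableP/diff_derivable.
have h3 : is_derive y e phi (dphi y).
  by apply: is_derive_translate; apply/derivableP/derivable_cutoff; rewrite e1.
have h4 := is_deriveM h2 h3.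
apply: (is_derive_eq (is_deriveM h1 h4)).
have sc (a b : R) : a *: b = a * b by [].
by rewrite /dpsi /= !sc (_ : (eta * phi) y = eta y * phi y)//; ring.
Qed.

Let intF : mu.-integrable setT (EFin \o (fun t => 'D_e F (vec t))) /\
  \int[mu]_t 'D_e F (vec t) = 0.
Proof.
have [Cw [Cw0 Cwle]] := continuous_bounded_ball x rho cw.
have Bu0 : 0 <= Bu by apply: le_trans (u_le 0).
have B2 y : `|u y - u x| <= 2 * Bu.
  by apply: le_trans (ler_normB _ _) _; have := u_le y; have := u_le x; lra.
have phi01 y : 0 <= phi y <= 1 by rewrite cutoff_ge0 cutoff_le1.
have ephi y : 0 <= eta y * phi y <= M.
  have /andP[p0 p1] := phi01 y; rewrite mulr_ge0//= -[leRHS]mulr1.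
  exact: ler_pM.
apply: (@integral_directional_derivative _ _ _ _ x rho
  (Cw * M + 2 * Bu * H3 + 2 * Bu * M)) => //.
- by move=> y; case: (dF y).
- have mv (f : 'rV[R]_n -> R) : continuous f -> measurable_fun setT (f \o @vec R n).
    by move=> cf; apply: measurable_fun_vec => // t _; exact: cf.
  rewrite (_ : F \o @vec R n = fun t => (u (vec t) - u x) *
    (eta (vec t) * phi (vec t)))//.
  apply: measurable_funM; first by apply: measurable_funB => //; exact: mv.
  apply: measurable_funM.
    by apply: mv => y; exact/differentiable_continuous.
  apply: mv => y; rewrite /phi.
  have c1 : {for y, continuous (fun y : 'rV[R]_n => y - x)}.
    by apply: (@continuousB _ _ _ id (cst x)); [|exact: cst_continuous].
  exact: (continuous_comp c1 (@continuous_cutoff _ _ _ _)).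
- exact: ltW.
- move=> y h; have [E1 _] := phi_out (le_trans h (norm_le_enorm _)).
  by rewrite /F E1 !mulr0.
- move=> y; rewrite /F normrM; have /andP[q0 q1] := ephi y.
  have : `|u y - u x| * `|eta y * phi y| <= 2 * Bu * M.
    by apply: ler_pM => //; rewrite ger0_norm.
  have : 0 <= Cw * M by exact: mulr_ge0.
  have : 0 <= 2 * Bu * H3 by rewrite mulr_ge0 ?mulr_ge0.
  lra.
- move=> y; case: (dF y) => _ ->.
  have h0 : 0 <= 2 * Bu * M by rewrite mulr_ge0 ?mulr_ge0.
  have h3 : `|u y - u x| * `|dpsi y| <= 2 * Bu * H3 by exact: ler_pM.
  have h2 : `|w y| * `|eta y * phi y| <= Cw * M.
    have /andP[q0 q1] := ephi y.
    have [h|h] := lerP rho (enorm (y - x)).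
      by have [E1 _] := phi_out h; rewrite E1 mulr0 normr0 mulr0 mulr_ge0.
    apply: ler_pM => //; last by rewrite ger0_norm.
    by apply: Cwle; exact: le_trans (norm_le_enorm _) (ltW h).
  apply: le_trans (ler_normD _ _) _.
  rewrite [`|w y * _|]normrM [`|(u y - u x) * _|]normrM; lra.
Qed.

Let A : R := eta x * p x.
Let P : R := (2 * N) ^+ n.
(** [c1] lies in the ball of radius rho/2, where phi is 1, and [c2] contains the ball of radius rho,
    outside which phi is 0. The ratio of their volumes is P. *)
Let c1 : set T := cubeT (x - const_mx (rho / (2 * N))) (rho / N).
Let c2 : set T := cubeT (x - const_mx rho) (2 * rho).

Let N_ge1 : 1 <= N. Proof. by rewrite ler1n. Qed.

Let P_gt0 : 0 < P. Proof. by rewrite exprn_gt0//; have := N_ge1; lra. Qed.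

Let c1P t : c1 t -> enorm (vec t - x) <= rho / 2.
Proof.
move=> ct; apply: le_trans (enorm_le_norm _) _.
have N0 : 0 < N by have := N_ge1; lra.
rewrite -ler_pdivlMl//; have -> : N^-1 * (rho / 2) = rho / (2 * N).
  by field; rewrite gt_eqF.
apply: norm_rV_le => [|i]; first by rewrite divr_ge0 ?ltW// mulr_gt0.
have := ct i; rewrite !mxE ler_norml.
have -> : rho / N = 2 * (rho / (2 * N)) by field; rewrite gt_eqF.
by move=> /andP[? ?]; apply/andP; split; lra.
Qed.

Let c2P t : enorm (vec t - x) <= rho -> c2 t.
Proof.
move=> h i; have := le_trans (coord_le_enorm (vec t - x) i) h.
by rewrite !mxE ler_norml => /andP[? ?]; apply/andP; split; lra.
Qed.

(** The weight is such that [A ^+ 2 / (4 * P)] on [c2] costs a quarter of [A ^+ 2] on [c1]; of the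
    three quarters in [interp_pointwise] one half survives. *)
Let young a v : - (a * v) <= a ^+ 2 / (4 * P) + P * v ^+ 2.
Proof.
have -> : a ^+ 2 / (4 * P) = (a ^+ 2 / 4) / P by field; rewrite gt_eqF.
rewrite -subr_ge0 -(pmulr_rge0 _ P_gt0).
have -> : P * (a ^+ 2 / 4 / P + P * v ^+ 2 - - (a * v)) = (a / 2 + P * v) ^+ 2.
  by field; rewrite gt_eqF.
exact: sqr_ge0.
Qed.

Let interp_pointwise t : 3 / 4 * A ^+ 2 * \1_c1 t <=
  rho ^+ n / G * (energy t * k t) + A * 'D_e F (vec t) +
  A ^+ 2 / (4 * P) * \1_c2 t + P * H3 ^+ 2 * (rho ^+ n / G) * (gap t * k t).
Proof.
have rG0 : 0 <= rho ^+ n / G by rewrite divr_ge0 ?exprn_ge0 ?ltW.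
have E0 := energy_ge0 t; have U0 := gap_ge0 t; have k0 := k_ge0 t.
have A0 := sqr_ge0 A.
have AP0 : 0 <= A ^+ 2 / (4 * P) by rewrite divr_ge0// mulr_ge0// ltW.
have PH0 : 0 <= P * H3 ^+ 2 by rewrite mulr_ge0 ?sqr_ge0// ltW.
case: (dF (vec t)) => _ ->.
set y := vec t.
have [h|h] := lerP rho (enorm (y - x)).
  rewrite indicE memNset; last first.
    by move=> /c1P; move: h; rewrite -/y; have := rho_gt0; lra.
  have [-> E2] := phi_out h.
  have -> : dpsi y = 0 by have [E1 E3] := phi_out h; rewrite /dpsi E1 E3 !mulr0 addr0.
  rewrite !(mulr0, addr0).
  have h1 : 0 <= rho ^+ n / G * (energy t * k t) by rewrite mulr_ge0// mulr_ge0.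
  have h2 : 0 <= A ^+ 2 / (4 * P) * \1_c2 t by rewrite mulr_ge0// indicE.
  have h3 : 0 <= P * H3 ^+ 2 * (rho ^+ n / G) * (gap t * k t).
    by apply: mulr_ge0; apply: mulr_ge0.
  lra.
have d_lt : dist x t <= rho by rewrite /dist -enormN opprB ltW.
(* The lower bound on [k] holds only off x; at x the energy, thanks to [pm0], and the gap both
   vanish. *)
have scale f : 0 <= f -> (vec t = x -> f = 0) -> f <= rho ^+ n / G * (f * k t).
  move=> f0 fx; have [tx|tx] := eqVneq (vec t) x.
    by rewrite (fx tx) mul0r mulr0.
  rewrite mulrCA ler_peMr// -mulrAC ler_pdivlMr// mul1r; exact: k_ge.
have E_le : energy t <= rho ^+ n / G * (energy t * k t).
  apply: scale => // tx; rewrite /energy tx subrr expr0n/= pm0; ring.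
have U_le : gap t <= rho ^+ n / G * (gap t * k t).
  by apply: scale => // tx; rewrite /gap tx subrr expr0n.
have -> : \1_c2 t = 1 :> R by rewrite indicE mem_set//; apply: c2P; exact: ltW.
have f0 : 0 <= phi y by exact: cutoff_ge0.
have f1 : phi y <= 1 by exact: cutoff_le1.
have L : 3 / 4 * A ^+ 2 * \1_c1 t <= 3 / 4 * A ^+ 2 * phi y.
  apply: ler_wpM2l; first by rewrite mulr_ge0.
  rewrite indicE; case: (boolP (t \in c1)) => // /set_mem/c1P ct.
  by rewrite phi_in.
have Ef : 3 / 4 * A ^+ 2 * phi y <= energy t + A * (w y * (eta y * phi y)).
  have -> : A * (w y * (eta y * phi y)) = (A * (eta y * w y)) * phi y by ring.
  (* With b = A - eta(y) p(y), A eta p = A^2 - A b >= 3/4 A^2 - b^2. Replacing p by w costs eta(x)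
     eta(y) p(x) m(y), half of the cross term of the energy. *)
  have E1 : 3 / 4 * A ^+ 2 <= energy t + A * (eta y * w y).
    have h1 : 0 <= eta x * eta y * (p x * m y) by rewrite mulr_ge0// mulr_ge0.
    have h2 := sqr_ge0 (A / 2 - (A - eta y * p y)).
    rewrite /energy -/A -/y wE; move: h1 h2; rewrite /A; lra.
  have := ler_wpM2r f0 E1; rewrite mulrDl; have := ler_wpM2l E0 f1; lra.
have Y := young A ((u y - u x) * dpsi y).
have D2 : ((u y - u x) * dpsi y) ^+ 2 <= H3 ^+ 2 * gap t.
  rewrite exprMn mulrC /gap -/y -[X in _ <= _ * X]sqrrN opprB.
  apply: ler_wpM2r; first exact: sqr_ge0.
  by rewrite -[leLHS]real_normK ?num_real// lerXn2r ?nnegrE.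
have PD2 := ler_wpM2l (ltW P_gt0) D2.
have PU := ler_wpM2l PH0 U_le.
rewrite mulr1 mulrDr; rewrite -mulrA in PU *; lra.
Qed.

(** Integration of the pointwise bound: the derivative term drops out, and only the energy and the
    gap remain to pay for half of [A ^+ 2] on [c1]. *)
Lemma interpolation :
  mu.-integrable setT (EFin \o (fun t => energy t * k t)) ->
  mu.-integrable setT (EFin \o (fun t => gap t * k t)) ->
  (eta x * p x) ^+ 2 * G <= 2 * N ^+ n * (\int[mu]_t (energy t * k t) +
    H3 ^+ 2 * (2 * N) ^+ n * \int[mu]_t (gap t * k t)).
Proof.
move=> iE iU; rewrite -/A -/P.
have N0 : 0 < N by have := N_ge1; lra.
have [iF IF] := intF.
have mc1 : measurable c1 by exact: measurable_cubeT.
have mc2 : measurable c2 by exact: measurable_cubeT.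
have mu1 : mu c1 = ((rho / N) ^+ n)%:E.
  by rewrite lebesgueT_cubeT// divr_ge0// ltW.
have mu2 : mu c2 = ((2 * rho) ^+ n)%:E.
  by rewrite lebesgueT_cubeT// mulr_ge0// ltW.
have zl := fun c f => @integrable_scale _ _ _ mu setT c f measurableT.
have ad := fun f h => @integrable_add _ _ _ mu setT f h measurableT.
have i1 : mu.-integrable setT (EFin \o (fun t => 3 / 4 * A ^+ 2 * \1_c1 t)).
  by apply: integrable_cst_indic; rewrite // mu1 ltry.
have i2 : mu.-integrable setT (EFin \o (fun t => A ^+ 2 / (4 * P) * \1_c2 t)).
  by apply: integrable_cst_indic; rewrite // mu2 ltry.
have := @le_Rintegral _ _ _ mu setT _ _ measurableT i1
  (ad _ _ (ad _ _ (ad _ _ (zl _ _ iE) (zl A _ iF)) i2) (zl _ _ iU))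
  (fun t _ => interp_pointwise t).
rewrite RintegralD//; last 2 first.
- exact: (ad _ _ (ad _ _ (zl _ _ iE) (zl A _ iF)) i2).
- exact: (zl _ _ iU).
rewrite RintegralD//; last exact: (ad _ _ (zl _ _ iE) (zl A _ iF)).
rewrite RintegralD//; last 2 first.
- exact: (zl _ _ iE).
- exact: (zl A _ iF).
rewrite !Rintegral_cst_indic ?mu1 ?mu2 ?ltry//=.
rewrite !RintegralZl// IF mulr0 addr0.
set EE := \int[mu]_t (energy t * k t); set UU := \int[mu]_t (gap t * k t).
have -> : A ^+ 2 / (4 * P) * (2 * rho) ^+ n = A ^+ 2 / 4 * (rho / N) ^+ n.
  have -> : 2 * rho = (2 * N) * (rho / N) by field; rewrite gt_eqF.
  rewrite [(2 * N * _) ^+ n]exprMn -/P; move: (gt_eqF P_gt0) => /negbT P0.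
  by move: P P0 ((rho / N) ^+ n) => b b0 a; field.
move=> h.
have Nn : 0 < N ^+ n by exact: exprn_gt0.
have rn : 0 < rho ^+ n by exact: exprn_gt0.
have : 1 / 2 * A ^+ 2 * (rho / N) ^+ n <= rho ^+ n / G * (EE + P * H3 ^+ 2 * UU).
  by move: h; set a := (rho / N) ^+ n; set b := rho ^+ n / G; lra.
rewrite expr_div_n.
have c0 : 0 < 2 * G * N ^+ n / rho ^+ n by rewrite divr_gt0 ?mulr_gt0.
move=> /(ler_wpM2l (ltW c0)).
have -> : 2 * G * N ^+ n / rho ^+ n * (1 / 2 * A ^+ 2 * (rho ^+ n / N ^+ n)) =
  A ^+ 2 * G by field; rewrite !gt_eqF.
have -> : 2 * G * N ^+ n / rho ^+ n * (rho ^+ n / G * (EE + P * H3 ^+ 2 * UU)) =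
  2 * N ^+ n * (EE + H3 ^+ 2 * P * UU) by field; rewrite !gt_eqF.
by [].
Qed.

End interpolation.

(** * Reflection through the point x *)

Section reflection.
Context {R : realType} {n : nat}.
Local Notation T := (n.-tuple (measurableTypeR R)).
Local Notation mu := (@lebesgueT R n).
Implicit Types (x : 'rV[R]_n).

Definition reflect_at x (t : T) : T := affT (-1) (2 *: x) t.

Lemma vec_reflect x t : vec (reflect_at x t) = x - (vec t - x).
Proof. by rewrite vec_affT; apply/rowP => i; rewrite !mxE; ring. Qed.

Lemma outside_reflect x eps t :
  outside x eps (reflect_at x t) = outside x eps t.
Proof. by rewrite /outside/= -!/(dist x _) dist_reflect. Qed.

Lemma Rintegral_reflect x eps (f : T -> R) :
  mu.-integrable (outside x eps) (EFin \o f) ->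
  mu.-integrable (outside x eps) (EFin \o (fun t => f (reflect_at x t))) /\
  \int[mu]_(t in outside x eps) f (reflect_at x t) =
  \int[mu]_(t in outside x eps) f t.
Proof.
move=> fi; have mD := @measurable_outside R n x eps.
have m1 : -1 = 1 :> R \/ -1 = -1 :> R by right.
have E : ((EFin \o (fun t => f (reflect_at x t))) \_ (outside x eps)) =
    ((EFin \o f) \_ (outside x eps)) \o reflect_at x.
  apply/funext => t; rewrite /patch/=.
  rewrite (_ : (reflect_at x t \in _) = (t \in outside x eps))//.
  by apply/idP/idP; rewrite !inE outside_reflect.
have fi' := (integrable_mkcond _ mD).1 fi.
split.
  by apply: (integrable_mkcond _ mD).2; rewrite E; exact: integrable_affT.
have mf : measurable_fun setT ((EFin \o f) \_ (outside x eps)).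
  by case/integrableP : fi'.
have H := integral_affT (2 *: x) m1 mf.
rewrite /Rintegral; congr fine.
by rewrite integral_mkcond [in RHS]integral_mkcond -H E.
Qed.

End reflection.

(** * The part of the left side inside the ball of radius rho *)

Section near_estimates.
Context {R : realType} {n : nat}.
Local Notation T := (n.-tuple (measurableTypeR R)).
Local Notation mu := (@lebesgueT R n).
Local Notation N := (n%:R : R).
Variables (eta w p m : 'rV[R]_n -> R) (k : T -> R) (x : 'rV[R]_n).
Variables (M r c kap rho G a1 : R) (phi : 'rV[R]_n -> R).
Hypothesis n_gt0 : (0 < n)%N.
Hypothesis deta : forall y, differentiable eta y.
Hypothesis D_le : forall y (i : 'I_n), `|'D_(delta_mx ord0 i) eta y| <= M.
Hypothesis D_lip : forall y y' (i : 'I_n), `|'D_(delta_mx ord0 i) eta y -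
        'D_(delta_mx ord0 i) eta y'| <= M * enorm (y - y').
Hypothesis eta_ge0 : forall y, 0 <= eta y.
Hypothesis eta_le : forall y, eta y <= M.
Hypothesis cw : continuous w.
Hypothesis wE : forall y, w y = p y - m y.
Hypothesis pm0 : p x * m x = 0.
Hypothesis pm_ge0 : forall y, 0 <= p x * m y.
Hypothesis G_ge0 : 0 <= G.
Hypothesis a1_ge0 : 0 <= a1.
Hypothesis eta_gt0 : 0 < eta x.
Hypothesis mk : measurable_fun setT k.
Hypothesis k_ge0 : forall t, 0 <= k t.
Hypothesis k_even : forall t, k (reflect_at x t) = k t.
Hypothesis k_out : forall eps, 0 < eps ->
  mu.-integrable (outside x eps) (EFin \o k).
Hypothesis w_out : forall eps, 0 < eps -> mu.-integrable (outside x eps)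
  (EFin \o (fun t => (w x - w (vec t)) * k t)).
Hypothesis near_int : mu.-integrable setT
  (EFin \o (fun t => dist x t ^+ 2 * k t * \1_(nearS x rho) t)).
Hypothesis near_le :
  \int[mu]_t (dist x t ^+ 2 * k t * \1_(nearS x rho) t) <= a1 * rho ^+ 2 * G.
Hypothesis eta_r : eta x = M * r ^+ 2.
Hypothesis r_gt0 : 0 < r.
Hypothesis c_gt0 : 0 < c.
Hypothesis rhoE : rho = c * r.
Hypothesis kapE : kap = 3 * N ^+ 2 * c.
Hypothesis kap_le : kap <= 1 / 8.
Hypothesis cphi : continuous phi.
Hypothesis phi_ge0 : forall y, 0 <= phi y.
Hypothesis phi_le1 : forall y, phi y <= 1.
Hypothesis phi_out : forall t, rho <= dist x t -> phi (vec t) = 0.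
Hypothesis phi_even : forall t, phi (vec (reflect_at x t)) = phi (vec t).

Let de t : R := eta x - eta (vec t).

Let M_ge0 : 0 <= M. Proof. exact: le_trans (eta_ge0 x) (eta_le x). Qed.
Let N_ge1 : 1 <= N. Proof. by rewrite ler1n. Qed.
Let c_le1 : c <= 1.
Proof.
have := kap_le; rewrite kapE => h.
have : 1 <= N ^+ 2 by rewrite exprn_ege1.
by have := c_gt0; nra.
Qed.
Let kap_gt0 : 0 < kap.
Proof. by rewrite kapE !mulr_gt0// ltr0n. Qed.

(** Since eta(x) = M r^2, [C11_ge0_gradient] bounds the partial derivatives at x by 2 N M r. The
    Taylor remainder N M d^2 is of the same order as d <= rho <= r. At d = rho the bound 3 N^2 M r
    rho is exactly [kap * eta x]. *)
Lemma near_gap t : dist x t <= rho ->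
  `|de t| <= 3 * N ^+ 2 * M * r * dist x t /\ `|de t| <= kap * eta x.
Proof.
move=> h; set d := dist x t; have d0 : 0 <= d by exact: dist_ge0.
have Di i : `|'D_(delta_mx ord0 i) eta x| <= 2 * N * M * r.
  rewrite -(@ler_pXn2r _ 2)// ?nnegrE// ?mulr_ge0 ?(ltW r_gt0)//.
  rewrite real_normK ?num_real//.
  apply: (le_trans (C11_ge0_gradient deta M_ge0 D_lip x i eta_ge0)).
  rewrite eta_r.
  have -> : (2 * N * M * r) ^+ 2 = N * (4 * N * M * (M * r ^+ 2)) by ring.
  by rewrite ler_peMl// !mulr_ge0 ?(ltW r_gt0).
have zd : enorm (vec t - x) = d by rewrite -enormN opprB.
have h1 := C11_taylor deta M_ge0 D_lip x (vec t - x).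
rewrite subrKC zd in h1.
have h2 : `|'D_(vec t - x) eta x| <= N * (d * (2 * N * M * r)).
  by apply: dir_derive_le => // i; rewrite -zd coord_le_enorm.
have dr : d <= r.
  by apply: le_trans h _; rewrite rhoE ler_piMl// ltW.
have N2 : N <= N ^+ 2 by rewrite expr2 ler_peMl.
have first : `|de t| <= 3 * N ^+ 2 * M * r * d.
  have -> : de t = - (eta (vec t) - eta x - 'D_(vec t - x) eta x) -
      'D_(vec t - x) eta x by rewrite /de; ring.
  apply: (le_trans (ler_normB _ _)); rewrite normrN.
  have : N * M * d ^+ 2 <= N ^+ 2 * M * r * d.
    rewrite expr2 mulrA; apply: ler_wpM2r => //.
    by apply: ler_pM => //; rewrite ?mulr_ge0// ler_wpM2r.
  lra.
split => //; apply: (le_trans first).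
have -> : kap * eta x = 3 * N ^+ 2 * M * r * rho.
  by rewrite kapE eta_r rhoE; ring.
by rewrite ler_wpM2l// ?mulr_ge0// ?(ltW r_gt0)// sqr_ge0.
Qed.

Let mv (f : 'rV[R]_n -> R) : continuous f -> measurable_fun setT (f \o @vec R n).
Proof. by move=> cf; apply: measurable_fun_vec => // t _; exact: cf. Qed.

Let ceta : continuous eta.
Proof. by move=> y; exact/differentiable_continuous. Qed.

Let mde : measurable_fun setT de.
Proof. by apply: measurable_funB => //; exact: mv. Qed.

Let de_le t : `|de t| <= M.
Proof.
rewrite ler_norml; have := eta_ge0 x; have := eta_ge0 (vec t).
by have := eta_le x; have := eta_le (vec t); move=> *; apply/andP; split;
  rewrite /de; lra.
Qed.

(** Averaging with the reflected point replaces the first difference of eta by a second one, of size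
    M d^2, which K integrates. Then M rho^2 = c^2 eta(x), together with p w = p^2 at x, restores the
    unit A^2 G. *)
Lemma near_even_integral eps : 0 < eps ->
  mu.-integrable (outside x eps) (EFin \o (fun t => de t * phi (vec t) * k t)) /\
  2 * (eta x * p x) * w x * \int[mu]_(t in outside x eps)
     (de t * phi (vec t) * k t) <= 2 * N * a1 * c ^+ 2 * ((eta x * p x) ^+ 2 * G).
Proof.
move=> eps0; have mD := @measurable_outside R n x eps.
set f := fun t => _ : R.
have fi : mu.-integrable (outside x eps) (EFin \o f).
  apply: (@integrable_le_fun _ _ _ _ _ _ (fun t => M * k t)) => //.
  - apply: measurable_funS (_ : measurable_fun setT f) => //.
    apply: measurable_funM => //; apply: measurable_funM => //; exact: mv.
  - by apply: integrable_scale => //; exact: k_out.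
  - move=> t _; rewrite /f !normrM (ger0_norm (k_ge0 t)) ler_wpM2r//.
    by rewrite -[leRHS]mulr1 ler_pM// ger0_norm.
split=> //.
have [fi' If] := Rintegral_reflect fi.
set I := \int[mu]_(t in _) f t in If *.
have I_le : `|2 * I| <= 2 * N * M * (a1 * rho ^+ 2 * G).
  have -> : 2 * I = \int[mu]_(t in outside x eps) (f t + f (reflect_at x t)).
    by rewrite RintegralD// If -/I; ring.
  have fi2 := integrable_add mD fi fi'.
  apply: (le_trans (le_normr_Rintegral mD fi2)).
  apply: (@le_trans _ _ (\int[mu]_t (2 * N * M *
     (dist x t ^+ 2 * k t * \1_(nearS x rho) t)))); last first.
    by rewrite RintegralZl// ler_wpM2l// mulr_ge0// mulr_ge0.
  apply: Rintegral_le_setT => //.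
  - exact: (integrable_norm fi2).
  - exact: integrable_scale.
  - move=> t; rewrite indicE !mulr_ge0 ?dist_ge0//.
  move=> t _; rewrite /f phi_even k_even -!mulrDl !normrM.
  rewrite (ger0_norm (k_ge0 t)) (ger0_norm (phi_ge0 _)).
  have [h|h] := lerP rho (dist x t).
    rewrite phi_out// mulr0 mul0r indicE !mulr_ge0 ?dist_ge0//.
  rewrite indicE mem_set ?mulr1; last exact: ltW.
  rewrite mulrA; apply: ler_wpM2r => //.
  rewrite -[leRHS]mulr1; apply: ler_pM => //.
  have := C11_second_difference deta M_ge0 D_lip x (vec t - x).
  rewrite -enormN opprB -/(dist x t) subrKC /de vec_reflect => h2.
  have -> : eta x - eta (vec t) + (eta x - eta (x - (vec t - x))) =
    2 * eta x - eta (vec t) - eta (x - (vec t - x)) by ring.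
  by move: h2; rewrite !opprB.
have I2 : `|I| <= N * M * (a1 * rho ^+ 2 * G).
  by move: I_le; rewrite normrM ger0_norm//; lra.
have pw : p x * w x = p x ^+ 2 by rewrite wE mulrBr pm0 subr0.
have -> : 2 * (eta x * p x) * w x * I = 2 * (eta x * p x ^+ 2) * I.
  by rewrite -pw; ring.
have e0 : 0 <= 2 * (eta x * p x ^+ 2) by rewrite mulr_ge0// mulr_ge0// sqr_ge0.
apply: le_trans (ler_wpM2l e0 (le_trans (ler_norm _) I2)) _.
by rewrite eta_r rhoE le_eqVlt; apply/orP; left; apply/eqP; ring.
Qed.

(** Put q = px d and b = X px - Y py. From Y = X - d one gets Y (py - px) = q - b, so X px (py - px)
    d = (X/Y) (q^2 - q b) with X/Y <= 2, and Young's inequality with weight kap absorbs the product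
    q b. The term in my has a sign except for d, and -d <= kap X <= 2 kap Y puts it under the cross
    term of the energy. *)
Let near_algebra (X Y px py mx my d : R) : 0 < X -> Y = X - d ->
  `|d| <= kap * X -> px * mx = 0 -> 0 <= px * my ->
  2 * (X * px) * ((py - my) - (px - mx)) * d <=
   2 * kap * ((X * px - Y * py) ^+ 2 + 2 * X * Y * (px * my)) +
   (4 / kap + 4) * (px * d) ^+ 2.
Proof.
move=> X0 YE dX pm pm1.
have := dX; rewrite ler_norml => /andP[d1 d2].
have k0 := kap_gt0; have k8 := kap_le.
have Y2 : X <= 2 * Y by rewrite YE; nra.
have Y0 : 0 < Y by lra.
have T1 : - (2 * X * (px * my) * d) <= 2 * kap * (2 * X * Y * (px * my)).
  have h1 : - d <= kap * (2 * Y).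
    by apply: (@le_trans _ _ (kap * X)); [lra|rewrite ler_wpM2l// ltW].
  have h2 : 0 <= 2 * X * (px * my) by rewrite mulr_ge0// mulr_ge0// ltW.
  by have := ler_wpM2l h2 h1; lra.
set q := px * d; set b := X * px - Y * py.
have T2 : 2 * X * px * (py - px) * d <= kap * b ^+ 2 + (4 / kap + 4) * q ^+ 2.
  have -> : 2 * X * px * (py - px) * d = 2 * (X / Y) * (q ^+ 2 - q * b).
    by rewrite /q /b YE; field; rewrite -YE gt_eqF.
  have XY : X / Y <= 2 by rewrite ler_pdivrMr.
  have XY0 : 0 <= X / Y by rewrite divr_ge0// ltW.
  have qb : `|q ^+ 2 - q * b| <= q ^+ 2 + `|q| * `|b|.
    apply: le_trans (ler_normB _ _) _; rewrite [`|q * b|]normrM.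
    by rewrite (ger0_norm (sqr_ge0 q)) lexx.
  apply: (@le_trans _ _ (2 * 2 * (q ^+ 2 + `|q| * `|b|))).
    apply: (@le_trans _ _ (2 * (X / Y) * (q ^+ 2 + `|q| * `|b|))).
      apply: ler_wpM2l; first exact: mulr_ge0.
      exact: le_trans (ler_norm _) qb.
    apply: ler_wpM2r; last exact: ler_wpM2l.
    by rewrite addr_ge0 ?sqr_ge0// mulr_ge0.
  rewrite -[q ^+ 2]real_normK ?num_real// -[b ^+ 2]real_normK ?num_real//.
  rewrite -subr_ge0 -(pmulr_rge0 _ k0).
  have -> : kap * (kap * `|b| ^+ 2 + (4 / kap + 4) * `|q| ^+ 2 -
      2 * 2 * (`|q| ^+ 2 + `|q| * `|b|)) = (kap * `|b| - 2 * `|q|) ^+ 2.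
    by field; rewrite gt_eqF.
  exact: sqr_ge0.
have b0 := mulr_ge0 (ltW k0) (sqr_ge0 b).
have -> : 2 * (X * px) * (py - my - (px - mx)) * d = 2 * X * px * (py - px) * d
   - 2 * X * (px * my) * d + 2 * X * (px * mx) * d by ring.
rewrite pm mulr0 mul0r addr0; lra.
Qed.

Lemma near_difference_integral eps : 0 < eps ->
  mu.-integrable setT (EFin \o (fun t => energy eta p m x t * k t)) ->
  mu.-integrable (outside x eps)
    (EFin \o (fun t => (w (vec t) - w x) * de t * phi (vec t) * k t)) /\
  2 * (eta x * p x) * \int[mu]_(t in outside x eps)
     ((w (vec t) - w x) * de t * phi (vec t) * k t) <=
  2 * kap * \int[mu]_t (energy eta p m x t * k t) +
    6 * kap * a1 * ((eta x * p x) ^+ 2 * G).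
Proof.
move=> eps0 iE; have mD := @measurable_outside R n x eps.
set f := fun t => _ : R.
(* The coefficient of (px d)^2 in [near_algebra] times the squared Lipschitz bound of [near_gap]. *)
pose B0 := (4 / kap + 4) * (p x ^+ 2 * (3 * N ^+ 2 * M * r) ^+ 2).
have k0 := kap_gt0.
have B0_ge0 : 0 <= B0.
  by rewrite /B0; nneg.
have fi : mu.-integrable (outside x eps) (EFin \o f).
  apply: (@integrable_le_fun _ _ _ _ _ _
    (fun t => M * `|(w x - w (vec t)) * k t|)) => //.
  - apply: measurable_funS (_ : measurable_fun setT f) => //.
    apply: measurable_funM => //; apply: measurable_funM; last exact: mv.
    by apply: measurable_funM => //; apply: measurable_funB => //; exact: mv.
  - apply: integrable_scale => //; apply: integrable_norm; exact: w_out.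
  - move=> t _; rewrite /f !normrM distrC.
    rewrite (_ : M * _ = `|w x - w (vec t)| * M * 1 * `|k t|); last by ring.
    rewrite ler_wpM2r//; apply: ler_pM => //; last by rewrite ger0_norm.
    by apply: ler_pM.
split=> //.
have f2i := integrable_scale (2 * (eta x * p x)) mD fi.
rewrite -RintegralZl//.
apply: (@le_trans _ _ (\int[mu]_t (2 * kap * (energy eta p m x t * k t) +
    B0 * (dist x t ^+ 2 * k t * \1_(nearS x rho) t)))); last first.
  rewrite RintegralD//; [|exact: integrable_scale|exact: integrable_scale].
  rewrite !RintegralZl// lerD2l.
  apply: (le_trans (ler_wpM2l B0_ge0 near_le)).
  (* Here (3 N^2 M r rho)^2 = (kap eta(x))^2, and the two powers of kap outweigh the division by kap
     in [B0]. *)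
  have -> : B0 * (a1 * rho ^+ 2 * G) =
     (4 * kap + 4 * kap ^+ 2) * (a1 * ((eta x * p x) ^+ 2 * G)).
    rewrite /B0 eta_r rhoE kapE; field.
    by rewrite !gt_eqF// ltr0n.
  rewrite -[leRHS]mulrA; apply: ler_wpM2r.
    by nneg.
  by have := kap_le; nra.
apply: Rintegral_le_setT => //.
- by apply: integrable_add => //; exact: integrable_scale.
- move=> t; apply: addr_ge0.
    apply: mulr_ge0; first by nneg.
    by apply: mulr_ge0 => //; exact: energy_ge0.
  by rewrite indicE; nneg.
move=> t _.
have E0 : 0 <= energy eta p m x t by exact: energy_ge0.
have h1 : 0 <= 2 * kap * (energy eta p m x t * k t).
  by nneg.
have [h|h] := lerP rho (dist x t).
  rewrite /f phi_out// mulr0 mul0r mulr0 addr_ge0//.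
  by rewrite indicE; nneg.
rewrite indicE mem_set ?mulr1; last exact: ltW.
have [g1 g2] := near_gap (ltW h).
have := @near_algebra (eta x) (eta (vec t)) (p x) (p (vec t)) (m x) (m (vec t))
  (de t) eta_gt0 _ g2 pm0 (pm_ge0 _).
rewrite {1}/de opprB addrC subrK => /(_ erefl) al.
have d2 : (p x * de t) ^+ 2 <= p x ^+ 2 * (3 * N ^+ 2 * M * r) ^+ 2 * dist x t ^+ 2.
  have dd : de t ^+ 2 <= (3 * N ^+ 2 * M * r * dist x t) ^+ 2.
    rewrite -[leLHS]real_normK ?num_real// lerXn2r ?nnegrE//.
    exact: le_trans g1.
  have -> : p x ^+ 2 * (3 * N ^+ 2 * M * r) ^+ 2 * dist x t ^+ 2 =
    p x ^+ 2 * (3 * N ^+ 2 * M * r * dist x t) ^+ 2 by ring.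
  rewrite (_ : (p x * de t) ^+ 2 = p x ^+ 2 * de t ^+ 2); last by ring.
  exact: (ler_wpM2l (sqr_ge0 (p x)) dd).
have c4 : 0 <= 4 / kap + 4 by nneg.
have d3 := ler_wpM2l c4 d2.
set S := 2 * kap * energy eta p m x t + B0 * dist x t ^+ 2.
have al2 : 2 * (eta x * p x) * (w (vec t) - w x) * de t <= S.
  rewrite !wE; apply: (le_trans al); rewrite /S /B0 -/(energy eta p m x t).
  by rewrite lerD2l -[leRHS]mulrA.
have S0 : 0 <= S by rewrite /S; nneg.
have -> : 2 * kap * (energy eta p m x t * k t) + B0 * (dist x t ^+ 2 * k t) =
  S * k t by rewrite /S; ring.
have -> : 2 * (eta x * p x) * f t =
  2 * (eta x * p x) * (w (vec t) - w x) * de t * phi (vec t) * k t.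
  by rewrite /f; ring.
apply: ler_wpM2r => //.
apply: (le_trans (ler_wpM2r (phi_ge0 _) al2)).
by rewrite ler_piMr.
Qed.

End near_estimates.

(** * The part of the left side outside the ball of radius rho/2 *)

Section far_estimate.
Context {R : realType} {n : nat}.
Local Notation T := (n.-tuple (measurableTypeR R)).
Local Notation mu := (@lebesgueT R n).
Local Notation N := (n%:R : R).
Variables (eta u w : 'rV[R]_n -> R) (k : T -> R) (kf dk : 'rV[R]_n -> R).
Variables (x e : 'rV[R]_n) (M rho G b1 Lambda Kb Bu A tau : R).
Hypothesis n_gt0 : (0 < n)%N.
Hypothesis e1 : enorm e = 1.
Hypothesis deta : forall y, differentiable eta y.
Hypothesis D_le : forall y (i : 'I_n), `|'D_(delta_mx ord0 i) eta y| <= M.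
Hypothesis eta_ge0 : forall y, 0 <= eta y.
Hypothesis eta_le : forall y, eta y <= M.
Hypothesis du : forall y, is_derive y e u (w y).
Hypothesis cu : continuous u.
Hypothesis cw : continuous w.
Hypothesis u_le : forall y, `|u y| <= Bu.
Hypothesis rho_gt0 : 0 < rho.
Hypothesis mk : measurable_fun setT k.
Hypothesis k_ge0 : forall t, 0 <= k t.
Hypothesis kE : forall t, vec t != x -> k t = kf (vec t).
Hypothesis kf_ge0 : forall y, 0 <= kf y.
Hypothesis kf_le : forall y, rho / 2 <= enorm (y - x) -> kf y <= Kb.
Hypothesis dkf : forall y, y != x -> is_derive y e kf (dk y).
Hypothesis Lambda_ge0 : 0 <= Lambda.
Hypothesis dk_le : forall y, y != x ->
  `|dk y| * enorm (y - x) <= N * Lambda * kf y.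
Hypothesis far_int : mu.-integrable setT
  (EFin \o (fun t => k t * \1_(farS x (rho / 2)) t)).
Hypothesis far_le : \int[mu]_t (k t * \1_(farS x (rho / 2)) t) <= b1 * G.
Hypothesis w_far : mu.-integrable setT
  (EFin \o (fun t => `|w (vec t)| * (k t * \1_(farS x (rho / 2)) t))).
Hypothesis gap_int : mu.-integrable setT (EFin \o (fun t => gap u x t * k t)).
Hypothesis tau_gt0 : 0 < tau.

Let a : R := 4 / rho ^+ 2.
Let aj (j : nat) : R := a / j.+1%:R.
(** Compactly supported approximation of [1 - cutoff a]. It vanishes on the ball of radius rho/2,
    away from which the kernel is differentiable, and integration by parts leaves no boundary
    term. *)
Let chi j y : R := cutoff (aj j) (y - x) - cutoff a (y - x).
Let dchi j y : R := 'D_e (cutoff (aj j)) (y - x) - 'D_e (cutoff a) (y - x).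
Let F j y : R := (u y - u x) * ((eta x - eta y) * (kf y * chi j y)).
Let dpsi j y : R := - 'D_e eta y * (kf y * chi j y) +
  (eta x - eta y) * (dk y * chi j y + kf y * dchi j y).

(** Bound on [dpsi] relative to [kf]. The first term comes from the derivative of eta; in the other
    two the derivatives of the kernel and of the cutoff cost a factor 1/|y-x|, which the Lipschitz
    bound N M |y-x| on eta cancels. No power of rho is left. *)
Definition far_slope : R := N * M + N ^+ 2 * M * Lambda + 32 * N ^+ 2 * M.
Local Notation H2 := far_slope.

Let a_gt0 : 0 < a.
Proof. by rewrite divr_gt0// exprn_gt0. Qed.

Let j_gt0 j : 0 < j.+1%:R :> R. Proof. by rewrite ltr0n. Qed.

Let aj_gt0 j : 0 < aj j. Proof. exact: divr_gt0. Qed.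

Let aj_le j : aj j <= a.
Proof. by rewrite ler_pdivrMr// ler_peMr ?(ltW a_gt0)// ler1n. Qed.

Let M_ge0 : 0 <= M. Proof. exact: le_trans (eta_ge0 x) (eta_le x). Qed.

Let Bu_ge0 : 0 <= Bu. Proof. exact: le_trans (u_le 0). Qed.

Let H2_ge0 : 0 <= H2. Proof. by rewrite /far_slope; nneg. Qed.

Let Kb_ge0 y : rho / 2 <= enorm (y - x) -> 0 <= Kb.
Proof. by move=> h; exact: le_trans (kf_ge0 y) (kf_le h). Qed.

Let in_a y : enorm (y - x) <= rho / 2 -> a * enorm (y - x) ^+ 2 <= 1.
Proof.
move=> h; rewrite /a mulrAC ler_pdivrMr ?exprn_gt0// mul1r.
have -> : rho ^+ 2 = 4 * (rho / 2) ^+ 2 by field.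
by rewrite ler_pM2l// lerXn2r ?nnegrE ?enorm_ge0// divr_ge0// (ltW rho_gt0).
Qed.

Let in_aj j y : enorm (y - x) <= rho / 2 -> aj j * enorm (y - x) ^+ 2 <= 1.
Proof.
move=> h; apply: le_trans (in_a h); apply: ler_wpM2r; first exact: sqr_ge0.
exact: aj_le.
Qed.

Let chi_in j y : enorm (y - x) <= rho / 2 -> chi j y = 0 /\ dchi j y = 0.
Proof.
move=> h; rewrite /chi /dchi; split.
  by rewrite !cutoff1 ?subrr//; [exact: in_a|exact: in_aj].
by rewrite !derive_cutoff1 ?e1 ?subrr//; [exact: in_a|exact: in_aj].
Qed.

Let far_radius j : R := rho * j.+1%:R.

Let chi_out j y : far_radius j <= enorm (y - x) -> chi j y = 0 /\ dchi j y = 0.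
Proof.
move=> h.
have r0 : 0 <= far_radius j by rewrite mulr_ge0// ltW.
have h2 : far_radius j ^+ 2 <= enorm (y - x) ^+ 2.
  by rewrite lerXn2r ?nnegrE ?enorm_ge0.
have E : aj j * far_radius j ^+ 2 = 4 * j.+1%:R.
  by rewrite /aj /a /far_radius; field; rewrite gt_eqF//= gt_eqF.
have j1 : 1 <= j.+1%:R :> R by rewrite ler1n.
have p1 : 2 <= aj j * enorm (y - x) ^+ 2.
  by have := ler_wpM2l (ltW (aj_gt0 j)) h2; rewrite E; lra.
have p2 : 2 <= a * enorm (y - x) ^+ 2.
  by apply: le_trans p1 _; apply: ler_wpM2r (aj_le j); exact: sqr_ge0.
rewrite /chi /dchi !cutoff0// !derive_cutoff0 ?e1// !subrr; split=> //.
Qed.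

Let chi_le1 j y : `|chi j y| <= 1.
Proof.
have := cutoff_ge0 a (y - x); have := cutoff_le1 a (y - x).
have := cutoff_ge0 (aj j) (y - x); have := cutoff_le1 (aj j) (y - x).
by rewrite /chi ler_norml => *; apply/andP; split; lra.
Qed.

Let dchi_le j y : `|dchi j y| * enorm (y - x) <= 32 * N.
Proof.
have e_le : enorm e <= 1 by rewrite e1.
have h1 := derive_cutoff_enorm_le (y - x) (ltW (aj_gt0 j)) e_le.
have h2 := derive_cutoff_enorm_le (y - x) (ltW a_gt0) e_le.
have := ler_wpM2r (enorm_ge0 (y - x))
  (ler_normB ('D_e (cutoff (aj j)) (y - x)) ('D_e (cutoff a) (y - x))).
by rewrite /dchi mulrDl; lra.
Qed.

Let deta_le y : `|'D_e eta y| <= N * M.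
Proof.
rewrite -[M]mul1r; apply: dir_derive_le => // i.
by rewrite -e1 coord_le_enorm.
Qed.

Let de_lip y : `|eta x - eta y| <= N * M * enorm (y - x).
Proof. by have := C11_lipschitz deta D_le x (y - x); rewrite subrKC distrC. Qed.

Let de_le y : `|eta x - eta y| <= M.
Proof.
rewrite ler_norml; have := eta_ge0 x; have := eta_ge0 y.
by have := eta_le x; have := eta_le y; move=> *; apply/andP; split; lra.
Qed.

Let dpsi_le j y : y != x -> `|dpsi j y| <= H2 * kf y.
Proof.
move=> yx; have z0 : 0 < enorm (y - x) by rewrite enorm_gt0 subr_eq0.
have kf0 := kf_ge0 y.
have t1 : `|- 'D_e eta y * (kf y * chi j y)| <= N * M * kf y.
  rewrite normrM normrN normrM (ger0_norm kf0).
  apply: ler_pM => //; first by nneg.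
  by rewrite -[leRHS]mulr1 ler_wpM2l.
have t2 : `|(eta x - eta y) * (dk y * chi j y)| <= N ^+ 2 * M * Lambda * kf y.
  have -> : N ^+ 2 * M * Lambda * kf y = N * M * (N * Lambda * kf y) by ring.
  rewrite !normrM; apply: (@le_trans _ _ (N * M * enorm (y - x) * (`|dk y| * 1))).
    by apply: ler_pM => //; rewrite ler_wpM2l.
  rewrite mulr1 -mulrA [enorm _ * _]mulrC; apply: ler_wpM2l; first by nneg.
  exact: dk_le.
have t3 : `|(eta x - eta y) * (kf y * dchi j y)| <= 32 * N ^+ 2 * M * kf y.
  have -> : 32 * N ^+ 2 * M * kf y = N * M * kf y * (32 * N) by ring.
  rewrite !normrM (ger0_norm kf0).
  apply: (@le_trans _ _ (N * M * enorm (y - x) * (kf y * `|dchi j y|))).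
    by apply: ler_wpM2r; [nneg|].
  have -> : N * M * enorm (y - x) * (kf y * `|dchi j y|) =
    N * M * kf y * (`|dchi j y| * enorm (y - x)) by ring.
  by apply: ler_wpM2l; [nneg|].
rewrite /dpsi [X in `|_ + X|]mulrDr; apply: (le_trans (ler_normD _ _)).
have t4 := ler_normD ((eta x - eta y) * (dk y * chi j y))
  ((eta x - eta y) * (kf y * dchi j y)).
have -> : H2 * kf y = N * M * kf y + N ^+ 2 * M * Lambda * kf y +
  32 * N ^+ 2 * M * kf y by rewrite /far_slope; ring.
lra.
Qed.

Let dF j y : is_derive y e (F j)
  (w y * ((eta x - eta y) * (kf y * chi j y)) + (u y - u x) * dpsi j y).
Proof.
have sc (b c : R) : b *: c = b * c by [].
(* At x the kernel may be singular, but [F j] is identically zero around it. The factor N + 1 fits a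
   sup-norm ball into the Euclidean one. *)
have [->|yx] := eqVneq y x.
  rewrite (_ : _ + _ = 0); last by rewrite !subrr !mul0r mulr0 addr0.
  apply: (near_eq_is_derive (f := cst (0 : R)) _ (is_derive_cst (0 : R) x e)).
  have r2 : 0 < rho / 2 / (N + 1) by rewrite !divr_gt0// ltr_wpDl.
  near=> z.
  have zx : enorm (z - x) <= rho / 2.
    apply: le_trans (enorm_le_norm _) _.
    have : `|z - x| <= rho / 2 / (N + 1).
      rewrite distrC; near: z; apply: filterS (nbhsx_ballx x _ r2) => z.
      by rewrite -ball_normE /= => /ltW.
    rewrite ler_pdivlMr; last by rewrite ltr_wpDl.
    by have := normr_ge0 (z - x); rewrite mulrDr mulr1 mulrC; lra.
  by rewrite /F; have [-> _] := chi_in j zx; rewrite !mulr0.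
have h1 : is_derive y e (fun z => u z - u x) (w y).
  by have := is_deriveB (du y) (is_derive_cst (u x) y e); rewrite subr0.
have h2 : is_derive y e (fun z => eta x - eta z) (- 'D_e eta y).
  have h0 : is_derive y e eta ('D_e eta y) by exact/derivableP/diff_derivable.
  by have := is_deriveB (is_derive_cst (eta x) y e) h0; rewrite sub0r.
have e_le : enorm e <= 1 by rewrite e1.
have h3 : is_derive y e (chi j) (dchi j y).
  by apply: is_deriveB; apply: is_derive_translate;
    exact/derivableP/derivable_cutoff.
have h4 := is_deriveM (dkf yx) h3.
have h5 := is_deriveM h2 h4.
apply: (is_derive_eq (is_deriveM h1 h5)); rewrite /= !sc.
rewrite (_ : ((fun z => eta x - eta z) * (kf * chi j)) y =
  (eta x - eta y) * (kf y * chi j y))//.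
rewrite (_ : (kf * chi j) y = kf y * chi j y)// /dpsi.
by move: (chi j y) (dchi j y) => b c; ring.
Unshelve. all: by end_near. Qed.

Let mv (f : 'rV[R]_n -> R) : continuous f -> measurable_fun setT (f \o @vec R n).
Proof. by move=> cf; apply: measurable_fun_vec => // t _; exact: cf. Qed.

Let ceta : continuous eta.
Proof. by move=> y; exact/differentiable_continuous. Qed.

Let cchi j : continuous (chi j).
Proof.
move=> y.
have c1 : {for y, continuous (fun y : 'rV[R]_n => y - x)}.
  by apply: (@continuousB _ _ _ id (cst x)); [|exact: cst_continuous].
exact: (cvgB (continuous_comp c1 (@continuous_cutoff _ _ _ _))
  (continuous_comp c1 (@continuous_cutoff _ _ _ _))).
Qed.

Let u2 y : `|u y - u x| <= 2 * Bu.
Proof.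
by apply: le_trans (ler_normB _ _) _; have := u_le y; have := u_le x; lra.
Qed.

Let intF j : mu.-integrable setT (EFin \o (fun t => 'D_e (F j) (vec t))) /\
  \int[mu]_t 'D_e (F j) (vec t) = 0.
Proof.
have [Cw [Cw0 Cwle]] := continuous_bounded_ball x (far_radius j) cw.
have r0 : 0 <= far_radius j by rewrite mulr_ge0// ltW.
apply: (@integral_directional_derivative _ _ _ _ x (far_radius j)
  (Cw * (M * `|Kb|) + 2 * Bu * (H2 * `|Kb|) + 2 * Bu * (M * `|Kb|))) => //.
- by move=> y; case: (dF j y).
- rewrite (_ : F j \o @vec R n = fun t => (u (vec t) - u x) *
    ((eta x - eta (vec t)) * (k t * chi j (vec t)))).
    apply: measurable_funM; first by apply: measurable_funB => //; exact: mv.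
    apply: measurable_funM; first by apply: measurable_funB => //; exact: mv.
    by apply: measurable_funM => //; apply: mv; exact: cchi.
  apply/funext => t; rewrite /F /=.
  have [->|tx] := eqVneq (vec t) x; first by rewrite !subrr !mul0r.
  by rewrite kE.
- move=> y h; have [E1 _] := chi_out (le_trans h (norm_le_enorm _)).
  by rewrite /F E1 !mulr0.
- move=> y; have h1 : 0 <= Cw * (M * `|Kb|) by nneg.
  have h2 : 0 <= 2 * Bu * (H2 * `|Kb|) by nneg.
  apply: (@le_trans _ _ (2 * Bu * (M * `|Kb|))); last by lra.
  have [h|h] := lerP (rho / 2) (enorm (y - x)); last first.
    have [E1 _] := chi_in j (ltW h).
    by rewrite /F E1 !mulr0 normr0; nneg.
  rewrite /F -[`|Kb|]mulr1; do 3 (apply: normrM_le => //).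
  by rewrite (ger0_norm (kf_ge0 y)) (ger0_norm (Kb_ge0 h)) kf_le.
- move=> y; case: (dF j y) => _ ->.
  have h0 : 0 <= 2 * Bu * (M * `|Kb|) by nneg.
  have h1 : 0 <= Cw * (M * `|Kb|) by nneg.
  have h2 : 0 <= 2 * Bu * (H2 * `|Kb|) by nneg.
  have [h|h] := lerP (rho / 2) (enorm (y - x)); last first.
    have [E1 E2] := chi_in j (ltW h).
    rewrite /dpsi E1 E2 !(mulr0, addr0) normr0; lra.
  have yx : y != x by rewrite -subr_eq0 -enorm_gt0; apply: lt_le_trans h; exact: divr_gt0.
  have kK : kf y <= `|Kb| by rewrite (ger0_norm (Kb_ge0 h)) kf_le.
  have h3 : `|(u y - u x) * dpsi j y| <= 2 * Bu * (H2 * `|Kb|).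
    apply: normrM_le => //.
    by apply: (le_trans (dpsi_le j yx)); rewrite ler_wpM2l.
  have h4 : `|w y * ((eta x - eta y) * (kf y * chi j y))| <= Cw * (M * `|Kb|).
    have [h'|h'] := lerP (far_radius j) (enorm (y - x)).
      by have [E1 _] := chi_out h'; rewrite E1 !mulr0 normr0.
    apply: normrM_le.
      by apply: Cwle; exact: le_trans (norm_le_enorm _) (ltW h').
    rewrite -[`|Kb|]mulr1; do 2 (apply: normrM_le => //).
    by rewrite ger0_norm.
  by apply: le_trans (ler_normD _ _) _; lra.
Qed.

Let W j t : R := w (vec t) * (eta x - eta (vec t)) * chi j (vec t) * k t.

Let dist_norm t : dist x t = enorm (vec t - x).
Proof. by rewrite -enormN opprB. Qed.

Let W_le j t : `|W j t| <= M * (`|w (vec t)| * (k t * \1_(farS x (rho / 2)) t)).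
Proof.
have [h|h] := lerP (rho / 2) (dist x t); last first.
  rewrite dist_norm in h; have [E1 _] := chi_in j (ltW h).
  by rewrite /W E1 mulr0 mul0r normr0 indicE; nneg.
rewrite indicE mem_set// mulr1 /W normrM (ger0_norm (k_ge0 t)).
rewrite [leRHS](_ : _ = `|w (vec t)| * M * 1 * k t); last by ring.
by apply: ler_wpM2r => //; apply: normrM_le => //; exact: normrM_le.
Qed.

Let mW j : measurable_fun setT (W j).
Proof.
apply: measurable_funM => //; apply: measurable_funM; last exact: mv.
apply: measurable_funM; first exact: mv.
by apply: measurable_funB => //; exact: mv.
Qed.

Let iW j : mu.-integrable setT (EFin \o W j).
Proof.
apply: (integrable_le_fun measurableT (mW j) (integrable_scale M measurableT w_far)).
by move=> t _; exact: W_le.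
Qed.

(** [W j] is ['D_e (F j)] minus [(u - u x) dpsi]. The first integrates to zero; Young's inequality
    with weight tau splits the second between A^2 times the far mass and the gap. *)
Let W_int_le j : 2 * A * \int[mu]_t W j t <=
  tau * A ^+ 2 * (b1 * G) + H2 ^+ 2 / tau * \int[mu]_t (gap u x t * k t).
Proof.
have [iF IF] := intF j.
have tA : 0 <= tau * A ^+ 2 by nneg.
have Ht : 0 <= H2 ^+ 2 / tau by nneg.
apply: (@le_trans _ _ (\int[mu]_t (2 * A * 'D_e (F j) (vec t) +
  tau * A ^+ 2 * (k t * \1_(farS x (rho / 2)) t) +
  H2 ^+ 2 / tau * (gap u x t * k t)))); last first.
  have i1 := integrable_scale (2 * A) measurableT iF.
  have i2 := integrable_scale (tau * A ^+ 2) measurableT far_int.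
  have i3 := integrable_scale (H2 ^+ 2 / tau) measurableT gap_int.
  rewrite RintegralD//; last exact: integrable_add.
  rewrite RintegralD// !RintegralZl// IF mulr0 add0r lerD2r.
  exact: ler_wpM2l.
rewrite -RintegralZl//.
apply: le_Rintegral => //.
- exact: integrable_scale.
- apply: integrable_add => //; last exact: integrable_scale.
  by apply: integrable_add => //; exact: integrable_scale.
move=> t _; case: (dF j (vec t)) => _ ->.
have g0 : 0 <= gap u x t by exact: gap_ge0.
have r3 : 0 <= H2 ^+ 2 / tau * (gap u x t * k t) by apply: mulr_ge0 => //; exact: mulr_ge0.
have [h|h] := lerP (rho / 2) (dist x t); last first.
  rewrite dist_norm in h; have [E1 E2] := chi_in j (ltW h).
  rewrite /W /dpsi E1 E2 !(mulr0, mul0r, addr0, add0r).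
  by apply: addr_ge0 => //; rewrite indicE; nneg.
rewrite indicE mem_set// mulr1.
have tx : vec t != x.
  by rewrite -dist_gt0; apply: lt_le_trans h; exact: divr_gt0.
rewrite /W kE//.
have kf0 := kf_ge0 (vec t).
set y := vec t in tx kf0 *.
have key : - (2 * A * ((u y - u x) * dpsi j y)) <=
    (tau * A ^+ 2 + H2 ^+ 2 / tau * gap u x t) * kf y.
  apply: (@le_trans _ _ (2 * `|A| * `|u y - u x| * (H2 * kf y))).
    apply: (le_trans (ler_norm _)); rewrite normrN -!mulrA.
    apply: normrM_le; first by rewrite ger0_norm.
    apply: normrM_le => //; apply: normrM_le => //; exact: dpsi_le.
  rewrite mulrA; apply: ler_wpM2r => //.
  rewrite -subr_ge0 -(pmulr_rge0 _ tau_gt0).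
  rewrite -[A ^+ 2]real_normK ?num_real//.
  rewrite /gap -/y -[(u x - u y) ^+ 2]real_normK ?num_real// [`|u x - _|]distrC.
  have -> : tau * (tau * `|A| ^+ 2 + H2 ^+ 2 / tau * `|u y - u x| ^+ 2 -
    2 * `|A| * `|u y - u x| * H2) = (tau * `|A| - H2 * `|u y - u x|) ^+ 2.
    by field; rewrite gt_eqF.
  exact: sqr_ge0.
move: key; rewrite mulrDl; lra.
Qed.

Lemma far_integral :
  mu.-integrable setT (EFin \o (fun t => w (vec t) * (eta x - eta (vec t)) *
    (1 - cutoff (4 / rho ^+ 2) (vec t - x)) * k t)) /\
  2 * A * \int[mu]_t (w (vec t) * (eta x - eta (vec t)) *
    (1 - cutoff (4 / rho ^+ 2) (vec t - x)) * k t) <=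
  tau * A ^+ 2 * (b1 * G) + H2 ^+ 2 / tau * \int[mu]_t (gap u x t * k t).
Proof.
set f := fun t => _ : R.
(* For fixed t the sequence is eventually constant: [cutoff (aj j)] equals 1 at [vec t - x] once j
   exceeds a |vec t - x|^2. The majorant [W_le] and the bound [W_int_le] do not depend on j. *)
have Wf t : W j t @[j --> \oo] --> f t.
  have E : \forall j \near \oo, f t = W j t.
    near=> j; rewrite /f /W /chi [cutoff (aj j) _]cutoff1//.
    rewrite /aj mulrAC ler_pdivrMr// mul1r.
    apply: ltW; apply: lt_le_trans (truncnS_gt _) _; rewrite ler_nat ltnS.
    near: j; exact: nbhs_infty_ge.
  by apply: cvg_near_cst; apply: filterS E => j ->.
have mf : measurable_fun setT f.
  by apply: (@measurable_fun_cvg _ _ _ _ W) => // t _; exact: Wf.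
have [If _ cI] := @dominated_convergence _ _ _ mu setT measurableT
  (fun j => EFin \o W j) (EFin \o f)
  (EFin \o (fun t => M * (`|w (vec t)| * (k t * \1_(farS x (rho / 2)) t))))
  ltac:(by move=> j; exact/measurable_EFinP) ltac:(exact/measurable_EFinP)
  ltac:(by apply: aeW => t _; apply: cvg_EFin; [exact: nearW|exact: Wf])
  (integrable_scale M measurableT w_far)
  ltac:(by apply: aeW => t j _; rewrite lee_fin; exact: W_le).
split=> //.
have cR : \int[mu]_t W j t @[j --> \oo] --> \int[mu]_t f t.
  apply: fine_cvg; rewrite /Rintegral fineK; last exact: integrable_fin_num.
  exact: cI.
have cA : 2 * A * \int[mu]_t W j t @[j --> \oo] --> 2 * A * \int[mu]_t f t.
  exact: (cvgM (cvg_cst (2 * A)) cR).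
rewrite -(cvg_lim _ cA)//.
apply: limr_le; first by apply/cvg_ex; eexists; exact: cA.
by apply: nearW => j; exact: W_int_le.
Unshelve. all: by end_near. Qed.

End far_estimate.

Section indicator_integrable.
Context d (T : measurableType d) {R : realType}
  (mu : {measure set T -> \bar R}).

Lemma restrict_indic (A : set T) (f : T -> R) :
  EFin \o (fun t => f t * \1_A t) = (EFin \o f) \_ A.
Proof.
apply/funext => t; rewrite /patch/= indicE.
by case: ifP => _; rewrite ?mulr1 ?mulr0.
Qed.

Lemma integrable_mul_indic (A : set T) (f : T -> R) : measurable A ->
  mu.-integrable A (EFin \o f) ->
  mu.-integrable setT (EFin \o (fun t => f t * \1_A t)).
Proof. by move=> mA; rewrite restrict_indic => /(integrable_mkcond _ mA).1. Qed.

Lemma integrable_of_mul_indic (A : set T) (f : T -> R) : measurable A ->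
  mu.-integrable setT (EFin \o (fun t => f t * \1_A t)) ->
  mu.-integrable A (EFin \o f).
Proof. by move=> mA; rewrite restrict_indic => /(integrable_mkcond _ mA).2. Qed.

End indicator_integrable.

(** * Choice of the constants and of the threshold *)

Section threshold.
Context {R : realType}.
Variables (n : nat) (s1 s2 Q M : R).
Local Notation N := (n%:R : R).

Definition near_coef : R := @near_const R n s2 * Q.
(** The factor 4 bounds g(rho/2) by g(rho), since the far region starts at rho/2. *)
Definition far_coef : R := 4 * @far_const R n s1 * Q.
(** The 8 keeps it below 1/8. The near errors amount to 1 + 6 units of [absorption * near_coef];
    with the factor [2 * N ^+ n] of the interpolation, 56 = 4 * 2 * 7 leaves them one quarter. *)
Definition absorption : R := 1 / (8 + 56 * near_coef * N ^+ n).
Definition radius_ratio : R := absorption / (3 * N ^+ 2).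
(** Young weight of the far estimate: 8 = 4 * 2 leaves the far error another quarter, and the added
    1 keeps the denominator positive. *)
Definition far_weight : R := 1 / (8 * far_coef * N ^+ n + 1).

(** Sum of the coefficients with which the gap enters [interpolation], where H = M / [radius_ratio],
    and [far_integral]. The added 1 makes it positive. *)
Definition threshold : R :=
  @interp_slope R n M (M / radius_ratio) ^+ 2 * (2 * N) ^+ n +
  @far_slope R n M Q ^+ 2 / far_weight + 1.

Hypothesis n_gt0 : (0 < n)%N.
Hypothesis s1_gt0 : 0 < s1.
Hypothesis s2_lt1 : s2 < 1.
Hypothesis Q_ge0 : 0 <= Q.

Lemma near_coef_ge0 : 0 <= near_coef.
Proof. by apply: mulr_ge0 => //; exact: near_const_ge0. Qed.

Lemma far_coef_ge0 : 0 <= far_coef.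
Proof. by apply: mulr_ge0 => //; apply: mulr_ge0 => //; exact: far_const_ge0. Qed.

Let Nn_gt0 : 0 < N ^+ n. Proof. by rewrite exprn_gt0// ltr0n. Qed.

Lemma absorption_gt0 : 0 < absorption.
Proof.
apply: divr_gt0 => //; apply: ltr_pwDl => //.
by have := near_coef_ge0 => ?; nneg.
Qed.

Lemma absorption_le : absorption <= 1 / 8.
Proof.
rewrite ler_pdivrMr; last first.
  by apply: ltr_pwDl => //; have := near_coef_ge0 => ?; nneg.
have : 0 <= 56 * near_coef * N ^+ n by have := near_coef_ge0 => ?; nneg.
lra.
Qed.

Lemma radius_ratio_gt0 : 0 < radius_ratio.
Proof. by rewrite divr_gt0 ?absorption_gt0// mulr_gt0// exprn_gt0// ltr0n. Qed.

Lemma far_weight_gt0 : 0 < far_weight.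
Proof.
apply: divr_gt0 => //; apply: ltr_wpDl => //.
by have := far_coef_ge0 => ?; nneg.
Qed.

Lemma threshold_gt0 : 0 < threshold.
Proof.
rewrite ltr_wpDl// addr_ge0//.
  by apply: mulr_ge0; [exact: sqr_ge0|apply: exprn_ge0; nneg].
by apply: divr_ge0; [exact: sqr_ge0|exact: ltW far_weight_gt0].
Qed.

Lemma coefficients_absorbed : 2 * N ^+ n *
  (2 * N * near_coef * radius_ratio ^+ 2 + 6 * absorption * near_coef +
   far_weight * far_coef) <= 1 / 2.
Proof.
have a0 := near_coef_ge0; have b0 := far_coef_ge0.
have k0 := absorption_gt0; have k8 := absorption_le.
(* [radius_ratio] is proportional to [absorption]: one of the two factors is kept, the other one and
   the powers of N are bounded by 1. *)
have h1 : 2 * N * near_coef * radius_ratio ^+ 2 <= absorption * near_coef.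
  have N1 : 1 <= N by rewrite ler1n.
  have N0 : 0 < N by rewrite ltr0n.
  have E : 2 * N * near_coef * radius_ratio ^+ 2 =
      absorption * near_coef * (absorption * (2 / 9) / N ^+ 3).
    by rewrite /radius_ratio; field; rewrite gt_eqF.
  rewrite E ler_piMr//; first by nneg.
  rewrite ler_pdivrMr ?exprn_gt0// mul1r.
  apply: (@le_trans _ _ 1); first by lra.
  exact: exprn_ege1.
have h2 : 56 * near_coef * N ^+ n * absorption <= 1.
  rewrite /absorption mulrA mulr1 ler_pdivrMr; last first.
    by apply: ltr_pwDl => //; nneg.
  lra.
have h3 : 8 * far_coef * N ^+ n * far_weight <= 1.
  rewrite /far_weight mulrA mulr1 ler_pdivrMr; last first.
    by apply: ltr_wpDl => //; nneg.
  lra.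
have h4 := ler_wpM2l (ltW Nn_gt0) h1.
lra.
Qed.

End threshold.

(** * The absorption argument at a point where eta is positive *)

Section core.
Context {R : realType} {n : nat}.
Local Notation T := (n.-tuple (measurableTypeR R)).
Local Notation mu := (@lebesgueT R n).
Local Notation N := (n%:R : R).
Variables (s1 s2 lambda Lambda Q M : R) (g : R -> R) (K : 'rV[R]_n -> \bar R).
Variables (eta u w p m : 'rV[R]_n -> R) (x e : 'rV[R]_n) (Bu : R).
Hypothesis n_gt0 : (0 < n)%N.
Hypothesis s1_gt0 : 0 < s1.
Hypothesis s2_lt1 : s2 < 1.
Hypothesis lambda_gt0 : 0 < lambda.
Hypothesis lambda_le : lambda <= Lambda.
Hypothesis Lambda_le : Lambda <= Q.
Hypothesis Lambda_leM : Lambda <= Q * lambda.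
Hypothesis g_ge0 : forall r : R, 0 < r -> 0 <= g r.
Hypothesis g_decr : forall r r' : R, 0 < r -> r < r' -> g r' < g r.
Hypothesis g_derivable : forall r : R, 0 < r -> derivable g r 1.
Hypothesis g_growth : forall r : R, 0 < r ->
     2 * s1 * r^-1 * g r <= `|derive1 g r| <= 2 * s2 * r^-1 * g r.
Hypothesis K_ge0 : forall y, (0 <= K y)%E.
Hypothesis K_even : forall y, K (- y) = K y.
Hypothesis K_bounds : forall y, y != 0 ->
  ((lambda * enorm y ^- n * g (enorm y))%:E <= K y)%E /\
  (K y <= (Lambda * enorm y ^- n * g (enorm y))%:E)%E.
Hypothesis K_differentiable :
  forall y, y != 0 -> differentiable (fun z => fine (K z)) y.
Hypothesis K_gradient : forall y, y != 0 ->
     ((enorm (grad (fun z => fine (K z)) y))%:E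
        <= (Lambda * (enorm y)^-1)%:E * K y)%E.
Hypothesis M_gt0 : 0 < M.
Hypothesis deta : forall y, differentiable eta y.
Hypothesis D_le : forall y (i : 'I_n), `|'D_(delta_mx ord0 i) eta y| <= M.
Hypothesis D_lip : forall y y' (i : 'I_n), `|'D_(delta_mx ord0 i) eta y -
        'D_(delta_mx ord0 i) eta y'| <= M * enorm (y - y').
Hypothesis eta_ge0 : forall y, 0 <= eta y.
Hypothesis eta_le : forall y, eta y <= M.
Hypothesis e1 : enorm e = 1.
Hypothesis du : forall y, is_derive y e u (w y).
Hypothesis cu : continuous u.
Hypothesis cw : continuous w.
Hypothesis u_le : forall y, `|u y| <= Bu.
Hypothesis wE : forall y, w y = p y - m y.
Hypothesis pm0 : p x * m x = 0.
Hypothesis pm_ge0 : forall y, 0 <= p x * m y.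
Hypothesis w_out : forall eps, 0 < eps -> mu.-integrable (outside x eps)
  (EFin \o (fun t => (w x - w (vec t)) * kern K x t)).

Local Notation k := (kern K x).

Let k_ge0 t : 0 <= k t. Proof. exact: kern_ge0. Qed.

Let mk : measurable_fun setT k. Proof. exact: measurable_kern. Qed.

Lemma farS_integrable eps : 0 < eps ->
  mu.-integrable (farS x eps) (EFin \o k).
Proof.
move=> eps0; apply: integrable_of_mul_indic; first exact: measurable_farS.
by case: (far_mass s1_gt0 lambda_gt0 lambda_le g_ge0 g_decr g_derivable
  g_growth K_ge0 K_bounds K_differentiable x eps0).
Qed.

Lemma kern_outside_integrable eps : 0 < eps ->
  mu.-integrable (outside x eps) (EFin \o k).
Proof.
move=> eps0; apply: (integrableS (@measurable_farS R n x eps)) (farS_integrable eps0).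
  exact: measurable_outside.
by move=> t; exact: ltW.
Qed.

Let mD eps : measurable (outside x eps : set T).
Proof. exact: measurable_outside. Qed.

(** w may be unbounded; its integrability against the kernel is recovered from that of w(x) - w and
    of the kernel itself. *)
Lemma derivative_outside_integrable eps : 0 < eps ->
  mu.-integrable (outside x eps) (EFin \o (fun t => `|w (vec t)| * k t)).
Proof.
move=> eps0.
have mw : measurable_fun setT (w \o @vec R n).
  by apply: measurable_fun_vec => // t _; exact: cw.
apply: (@integrable_le_fun _ _ _ _ _ _
  (fun t => `|(w x - w (vec t)) * k t| + `|w x| * k t)) => //.
- apply: measurable_funS (_ : measurable_fun setT _) => //.
  by apply: measurable_funM => //; exact: measurableT_comp.
- apply: integrable_add => //; first by apply: integrable_norm; exact: w_out.
  by apply: integrable_scale => //; exact: kern_outside_integrable.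
move=> t _; rewrite !normrM normr_id (ger0_norm (k_ge0 t)) -mulrDl.
apply: ler_wpM2r => //.
rewrite -[X in `|X| <= _](subrK (w x)).
by apply: (le_trans (ler_normD _ _)); rewrite distrC.
Qed.

Let kf (y : 'rV[R]_n) : R := fine (K (x - y)).
Let dk (y : 'rV[R]_n) : R := 'D_(- e) (fun z => fine (K z)) (x - y).

Let kE t : vec t != x -> k t = kf (vec t).
Proof. by move=> tx; rewrite /kern (negbTE tx). Qed.

Let dkf y : y != x -> is_derive y e kf (dk y).
Proof.
move=> yx; apply: is_derive_lineV.
have -> : (fun s : R => kf (y + s *: e)) =
    (fun s => fine (K ((x - y) + s *: (- e)))).
  by apply/funext => s; rewrite /kf scalerN opprD addrA.
apply: (is_derive_line (f := fun z => fine (K z)) (s := 0)).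
rewrite scale0r addr0; apply/derivableP/diff_derivable/K_differentiable.
by rewrite subr_eq0 eq_sym.
Qed.

Let Q_ge0 : 0 <= Q.
Proof. by apply: le_trans Lambda_le; apply: le_trans lambda_le; exact: ltW. Qed.

Let dk_le y : y != x -> `|dk y| * enorm (y - x) <= N * Q * kf y.
Proof.
move=> yx; have xy0 : x - y != 0 by rewrite subr_eq0 eq_sym.
have d0 : 0 < enorm (x - y) by rewrite enorm_gt0.
have G := K_gradient xy0.
have Kf : K (x - y) = (kf y)%:E by rewrite /kf fineK//; exact: (K_fin K_ge0 K_bounds).
rewrite Kf -EFinM lee_fin in G.
have h : `|dk y| <= N * (1 * (Lambda * (enorm (x - y))^-1 * kf y)).
  apply: dir_derive_le; first exact: K_differentiable.
    by move=> i; rewrite -e1 -enormN; exact: coord_le_enorm.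
  move=> i; apply: le_trans G.
  by have := coord_le_enorm (grad (fun z => fine (K z)) (x - y)) i; rewrite mxE.
have -> : enorm (y - x) = enorm (x - y) by rewrite -enormN opprB.
apply: le_trans (ler_wpM2r (ltW d0) h) _.
have -> : N * (1 * (Lambda * (enorm (x - y))^-1 * kf y)) * enorm (x - y) =
    N * Lambda * kf y by field; rewrite gt_eqF.
apply: ler_wpM2r; first by rewrite /kf fine_ge0.
exact: ler_wpM2l.
Qed.

(** With phi the cutoff at scale rho, the integrand is f2 + w(x) f1 + f3: the increment of w near x,
    its value at x, and the far part. Their errors are multiples of S, with total coefficient Z
    small enough for [interpolation] to return at most half of the energy. *)
Lemma core_estimate : 0 < eta x ->
  exists rho0 : R, 0 < rho0 /\ forall eps, 0 < eps -> eps <= rho0 ->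
  mu.-integrable setT (EFin \o (fun t => energy eta p m x t * k t)) ->
  mu.-integrable setT (EFin \o (fun t => gap u x t * k t)) ->
  2 * (eta x * p x) * \int[mu]_(t in outside x eps)
    (w (vec t) * (eta x - eta (vec t)) * k t) <=
  \int[mu]_t (energy eta p m x t * k t) +
  threshold n s1 s2 Q M * \int[mu]_t (gap u x t * k t).
Proof.
move=> eta0.
pose c := radius_ratio n s2 Q.
pose kap := absorption n s2 Q.
pose tau := far_weight n s1 Q.
have c0 : 0 < c by exact: radius_ratio_gt0.
have tau0 : 0 < tau by exact: far_weight_gt0.
pose r := Num.sqrt (eta x / M).
have r0 : 0 < r by rewrite sqrtr_gt0 divr_gt0.
have r2 : r ^+ 2 = eta x / M by rewrite sqr_sqrtr// divr_ge0// ltW.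
have eta_r : eta x = M * r ^+ 2 by rewrite r2; field; rewrite gt_eqF.
have r1 : r <= 1.
  rewrite -(@ler_pXn2r _ 2)// ?nnegrE//; last exact: ltW.
  by rewrite expr1n r2 ler_pdivrMr// mul1r.
pose rho := c * r; have rho0 : 0 < rho by exact: mulr_gt0.
pose G := lambda * g rho.
have grho : 0 < g rho := profile_gt0 g_ge0 g_decr rho0.
have G0 : 0 < G by exact: mulr_gt0.
exists (rho / 2); split; first exact: divr_gt0.
move=> eps eps0 eps_le iE iU.
have [near_int near_le] := near_mass s2_lt1 lambda_gt0 lambda_le g_ge0 g_decr
  g_derivable g_growth K_ge0 K_bounds K_differentiable x rho0.
have rho2 : 0 < rho / 2 by exact: divr_gt0.
have [far_int far_le] := far_mass s1_gt0 lambda_gt0 lambda_le g_ge0 g_decr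
  g_derivable g_growth K_ge0 K_bounds K_differentiable x rho2.
(* The masses are bounded through Lambda, while the interpolation uses the lower bound through
   lambda; Q converts one into the other. *)
have Lg : Lambda * g rho <= Q * G.
  by rewrite /G mulrA; apply: ler_wpM2r => //; exact: ltW.
have near_le' : \int[mu]_t (dist x t ^+ 2 * k t * \1_(nearS x rho) t) <=
    near_coef n s2 Q * rho ^+ 2 * G.
  apply: (le_trans near_le).
  have -> : Lambda * rho ^+ 2 * g rho = rho ^+ 2 * (Lambda * g rho) by ring.
  rewrite (_ : near_coef n s2 Q * rho ^+ 2 * G =
    @near_const R n s2 * (rho ^+ 2 * (Q * G))); last by rewrite /near_coef; ring.
  apply: ler_wpM2l; first exact: near_const_ge0.
  by apply: ler_wpM2l => //; exact: sqr_ge0.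
have g_half : g (rho / 2) <= 4 * g rho.
  have := profile_double g_ge0 g_decr g_derivable g_growth rho2.
  rewrite (_ : 2 * (rho / 2) = rho); last by field.
  move=> h; apply: (le_trans h); rewrite mulrC; apply: ler_wpM2r; first exact: ltW.
  exact: ltW (doubling_lt4 s2_lt1).
have Lambda0 : 0 <= Lambda by apply: le_trans lambda_le; exact: ltW.
have far_le' : \int[mu]_t (k t * \1_(farS x (rho / 2)) t) <=
    far_coef n s1 Q * G.
  apply: (le_trans far_le).
  rewrite (_ : far_coef n s1 Q * G = @far_const R n s1 * (4 * (Q * G))); last first.
    by rewrite /far_coef; ring.
  apply: ler_wpM2l; first exact: far_const_ge0.
  apply: (@le_trans _ _ (4 * (Lambda * g rho))); last by rewrite ler_pM2l.
  by rewrite mulrCA; exact: ler_wpM2l.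
have kge t : vec t != x -> dist x t <= rho -> G <= rho ^+ n * k t.
  move=> tx tr; have d0 : 0 < dist x t by rewrite dist_gt0.
  have h := kern_ge K_ge0 K_bounds tx.
  have rn : 0 < rho ^+ n by exact: exprn_gt0.
  rewrite mulrC -ler_pdivrMr//; apply: le_trans h.
  have dg : g rho <= g (dist x t) by exact: (profile_le g_decr).
  have dn : rho ^- n <= dist x t ^- n.
    by rewrite lef_pV2 ?posrE ?exprn_gt0// lerXn2r// nnegrE ltW.
  rewrite /G mulrAC; apply: ler_pM => //; first by nneg.
    exact: ltW.
  by apply: ler_wpM2l => //; exact: ltW.
(* Since eta <= M, r is at most 1, so eta(x) = M r^2 <= M r = (M/c) rho. *)
have eta_H : eta x <= M / c * rho.
  rewrite (_ : M / c * rho = M * r); last by rewrite /rho; field; rewrite gt_eqF.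
  by rewrite eta_r ler_pM2l// expr2 ler_piMr// ltW.
pose phi y : R := cutoff (4 / rho ^+ 2) (y - x).
have a0 : 0 < rho ^+ 2 by exact: exprn_gt0.
have dN t : enorm (vec t - x) = dist x t by rewrite -enormN opprB.
have phi_out t : rho <= dist x t -> phi (vec t) = 0.
  move=> h; rewrite /phi cutoff0// mulrAC ler_pdivlMr// dN.
  have : rho ^+ 2 <= dist x t ^+ 2.
    by rewrite lerXn2r// nnegrE ?dist_ge0// ltW.
  by have := ltW a0; lra.
have phi_in t : dist x t <= rho / 2 -> phi (vec t) = 1.
  move=> h; rewrite /phi cutoff1// mulrAC ler_pdivrMr// dN mul1r.
  have : dist x t ^+ 2 <= (rho / 2) ^+ 2.
    by rewrite lerXn2r// nnegrE ?dist_ge0// ltW.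
  rewrite expr_div_n ler_pdivlMr; last by rewrite exprn_gt0.
  by rewrite (_ : 2 ^+ 2 = 4 :> R) 1?mulrC// -natrX.
have phi_even t : phi (vec (reflect_at x t)) = phi (vec t).
  by rewrite /phi vec_reflect addrAC subrr add0r cutoffN.
have cphi : continuous phi.
  move=> y.
  have c1 : {for y, continuous (fun y : 'rV[R]_n => y - x)}.
    by apply: (@continuousB _ _ _ id (cst x)); [|exact: cst_continuous].
  exact: (continuous_comp c1 (@continuous_cutoff _ _ _ _)).
have a1_ge0 : 0 <= near_coef n s2 Q by exact: near_coef_ge0.

have phi0 y : 0 <= phi y by exact: cutoff_ge0.
have phi1 y : phi y <= 1 by exact: cutoff_le1.
have k_even t : k (reflect_at x t) = k t by exact: kern_reflect.
have kapE : kap = 3 * N ^+ 2 * c.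
  have N0 : 0 < N by rewrite ltr0n.
  by rewrite /kap /c /radius_ratio; field; rewrite gt_eqF.
have kap_le : kap <= 1 / 8 by exact: absorption_le.
have kf_le y : rho / 2 <= enorm (y - x) ->
    kf y <= Lambda * (rho / 2) ^- n * g (rho / 2).
  move=> h; have d0 : 0 < enorm (y - x) by exact: lt_le_trans h.
  have xy0 : x - y != 0 by rewrite -enorm_gt0 -enormN opprB.
  have := (K_bounds xy0).2.
  rewrite -[K (x - y)]fineK; last exact: (K_fin K_ge0 K_bounds).
  rewrite lee_fin -/(kf y) -[enorm (x - y)]enormN opprB => /le_trans; apply.
  apply: ler_pM; [by nneg|exact: g_ge0| |exact: (profile_le g_decr)].
  apply: ler_wpM2l => //.
  by rewrite lef_pV2 ?posrE ?exprn_gt0// lerXn2r// nnegrE ltW.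
(* [outside] is defined by a strict inequality and [farS] by a large one: the smaller radius rho/4
   gives the inclusion. *)
have far_mul f : mu.-integrable (outside x (rho / 4)) (EFin \o f) ->
    mu.-integrable setT (EFin \o (fun t => f t * \1_(farS x (rho / 2)) t)).
  move=> fi; apply: integrable_mul_indic; first exact: measurable_farS.
  apply: (integrableS (mD (rho / 4))) fi; first exact: measurable_farS.
  move=> t; rewrite /farS/outside/= -/(dist x t); apply: lt_le_trans.
  by rewrite ltr_pM2l// ltf_pV2 ?posrE// ltr_nat.
have w_far : mu.-integrable setT (EFin \o (fun t =>
    `|w (vec t)| * (k t * \1_(farS x (rho / 2)) t))).
  rewrite (_ : (fun t => _ * (_ * _)) =
    (fun t => `|w (vec t)| * k t * \1_(farS x (rho / 2)) t)).
    by apply: far_mul; apply: derivative_outside_integrable; exact: divr_gt0.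
  by apply/funext => t; rewrite mulrA.
have [iN1 hN1] := near_even_integral deta D_lip eta_ge0 eta_le wE pm0 mk
  k_ge0 k_even kern_outside_integrable near_int near_le' eta_r (erefl rho) cphi
  phi0 phi1 phi_out phi_even eps0.
have [iN2 hN2] := near_difference_integral n_gt0 deta D_lip eta_ge0 eta_le cw
  wE pm0 pm_ge0 (ltW G0) a1_ge0 eta0 mk k_ge0 w_out near_int near_le' eta_r r0
  c0 (erefl rho) kapE kap_le cphi phi0 phi1 phi_out eps0 iE.
have [iF hF] := far_integral (eta x * p x) e1 deta D_le eta_ge0 eta_le du cu cw
  u_le rho0 mk k_ge0 kE (fun y => fine_ge0 (K_ge0 (x - y))) kf_le dkf Q_ge0
  dk_le far_int far_le' w_far iU tau0.
have hI := interpolation n_gt0 e1 deta D_le eta_ge0 eta_le du cu cw u_le wE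
  pm0 pm_ge0 rho0 G0 k_ge0 kge eta_H iE iU.

set E := \int[mu]_t (energy eta p m x t * k t) in hN2 hI *.
set U := \int[mu]_t (gap u x t * k t) in hF hI *.
set S := (eta x * p x) ^+ 2 * G in hN1 hN2 hI.
set f1 := (fun t => (eta x - eta (vec t)) * phi (vec t) * k t) in iN1 hN1.
set f2 := (fun t => (w (vec t) - w x) * (eta x - eta (vec t)) * phi (vec t) *
  k t) in iN2 hN2.
set f3 := (fun t => w (vec t) * (eta x - eta (vec t)) *
  (1 - cutoff (4 / rho ^+ 2) (vec t - x)) * k t) in iF hF.
have iF' := integrableS measurableT (mD eps) (@subsetT _ _) iF.
(* For eps <= rho/2 the removed ball lies where phi is 1, so the truncation does not affect the far
   part. *)
have F3 : \int[mu]_(t in outside x eps) f3 t = \int[mu]_t f3 t.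
  rewrite Rintegral_mkcond; congr Rintegral; apply/funext => t; rewrite /patch.
  case: ifPn => // /negP h; rewrite /f3 -/(phi (vec t)) phi_in.
    by rewrite subrr mulr0 mul0r.
  apply: le_trans eps_le; rewrite leNgt; apply/negP => h'.
  by apply: h; rewrite inE.
have -> : \int[mu]_(t in outside x eps)
    (w (vec t) * (eta x - eta (vec t)) * k t) =
    \int[mu]_(t in outside x eps) (f2 t + w x * f1 t + f3 t).
  congr Rintegral; apply/funext => t; rewrite /f1 /f2 /f3 /phi/=. by ring.
have i1 := integrable_scale (w x) (mD eps) iN1.
rewrite RintegralD//; last exact: integrable_add.
rewrite RintegralD// RintegralZl// F3.
have hA := coefficients_absorbed n_gt0 s1_gt0 s2_lt1 Q_ge0.
rewrite -/c -/kap -/tau in hA.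
have E0 : 0 <= E.
  by apply: Rintegral_ge0 => t _; apply: mulr_ge0 => //; exact: energy_ge0.
have U0 : 0 <= U.
  by apply: Rintegral_ge0 => t _; apply: mulr_ge0 => //; exact: gap_ge0.
have S0 : 0 <= S by rewrite /S; nneg.
rewrite (_ : tau * _ ^+ 2 * _ = tau * far_coef n s1 Q * S) in hF; last first.
  by rewrite /S; ring.
rewrite /threshold -/c -/tau.

set H := interp_slope _ _ ^+ 2 * _ in hI *.
set h := far_slope _ _ ^+ 2 / tau in hF *.
set Z := _ + tau * _ in hA.
have Z0 : 0 <= Z.
  have k0 : 0 < kap by exact: absorption_gt0.
  have b0 := far_coef_ge0 n s1_gt0 Q_ge0.
  by rewrite /Z; nneg.
have H0 : 0 <= H.
  by apply: mulr_ge0; [exact: sqr_ge0|apply: exprn_ge0; nneg].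
(* Absorbing Z S costs half of E and half of H U. The near estimate adds 2 kap E, at most a quarter
   of E, and the far one h U; the total stays below E + (H + h + 1) U. *)
have ZS : Z * S <= 1 / 2 * (E + H * U).
  apply: le_trans (ler_wpM2l Z0 hI) _.
  rewrite mulrA [Z * _]mulrC; apply: ler_wpM2r => //.
  by apply: addr_ge0 => //; exact: mulr_ge0.
have kE' := ler_wpM2r E0 kap_le.
have HU := mulr_ge0 H0 U0.
move: ZS; rewrite /Z; lra.
Qed.

End core.

(** * Subtraction of a nonnegative function of possibly infinite integral *)

Section ge0_subtraction.
Context d (T : measurableType d) {R : realType}
  (mu : {measure set T -> \bar R}).

(* The subtracted function may have infinite integral, and the value is then
   [-oo]. *)
Lemma integral_sub_ge0 (D : set T) (a b : T -> R) : measurable D ->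
  mu.-integrable D (EFin \o a) -> measurable_fun D b ->
  (forall t, D t -> 0 <= b t) ->
  (\int[mu]_(t in D) (a t - b t)%:E =
   \int[mu]_(t in D) (a t)%:E - \int[mu]_(t in D) (b t)%:E)%E.
Proof.
move=> mD ia mb b0.
have ma : measurable_fun D a by case/integrableP : ia => /measurable_EFinP.
have ib0 : (0 <= \int[mu]_(t in D) (b t)%:E)%E.
  by apply: integral_ge0 => t Dt; rewrite lee_fin b0.
have [ib|] := boolP ((\int[mu]_(t in D) (b t)%:E)%E \is a fin_num).
  have iB : mu.-integrable D (EFin \o b).
    apply/integrableP; split; first exact/measurable_EFinP.
    rewrite (eq_integral (fun t => (b t)%:E)) ?ltey_eq ?ib//.
    by move=> t; rewrite inE => Dt /=; rewrite ger0_norm// b0.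
  rewrite -integralB_EFin//; apply: eq_integral => t _; by rewrite EFinB.
rewrite ge0_fin_numE// -leNgt leye_eq => /eqP bI; rewrite bI.
have [_ a_lt] := integrableP _ _ _ ia.
set f := fun t => (a t - b t)%:E.
have mab : measurable_fun D f by apply/measurable_EFinP; exact: measurable_funB.
have posI : (\int[mu]_(t in D) f^\+ t <= \int[mu]_(t in D) `|(a t)%:E|)%E.
  apply: ge0_le_integral => //.
  - exact: measurable_funepos.
  - by apply: measurableT_comp => //; exact/measurable_EFinP.
  move=> t Dt; rewrite funeposE /f abse_EFin ge_max !lee_fin normr_ge0 andbT.
  by have := ler_norm (a t); have := b0 _ Dt; lra.
have negI : (\int[mu]_(t in D) f^\- t = +oo)%E.
  apply/eqP; rewrite -leye_eq leNgt; apply/negP => h.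
  have : (\int[mu]_(t in D) (b t)%:E < +oo)%E.
    apply: (@le_lt_trans _ _ (\int[mu]_(t in D) (f^\- t + `|(a t)%:E|))%E).
      apply: ge0_le_integral => //.
      - exact/measurable_EFinP.
      - apply: emeasurable_funD; first exact: measurable_funeneg.
        by apply: measurableT_comp => //; exact/measurable_EFinP.
      move=> t Dt; rewrite funenegE /f -EFinN -EFin_max abse_EFin -EFinD lee_fin.
      have h1 : b t - a t <= Num.max (- (a t - b t)) 0.
        by rewrite le_max opprB lexx.
      by have := ler_norm (a t); lra.
    rewrite ge0_integralD//; last 2 first.
    - exact: measurable_funeneg.
    - by apply: measurableT_comp => //; exact/measurable_EFinP.
    by rewrite lte_add_pinfty.
  by rewrite bI.
rewrite integralE negI.
have h1 : (\int[mu]_(t in D) f^\+ t < +oo)%E by exact: le_lt_trans posI a_lt.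
have h0 : (0 <= \int[mu]_(t in D) f^\+ t)%E by exact: integral_ge0.
have /fineK <- : (\int[mu]_(t in D) f^\+ t)%E \is a fin_num by rewrite ge0_fin_numE.
have /fineK <- : (\int[mu]_(t in D) (a t)%:E)%E \is a fin_num.
  exact: (integrable_fin_num mD ia).
by [].
Qed.

End ge0_subtraction.

(** * Convergence of truncated integrals and of principal values *)

Section principal_value.
Context {R : realType} {n : nat}.
Local Notation T := (n.-tuple (measurableTypeR R)).
Local Notation mu := (@lebesgueT R n).
Variables (x : 'rV[R]_n).

Let mD eps : measurable (outside x eps : set T).
Proof. exact: measurable_outside. Qed.

(** The truncated integrals increase as eps decreases, so they converge to their supremum, possibly
    infinite. Monotone convergence along eps = 1/(i+1) identifies it, the only points never reached
    being those with [vec t = x], where f vanishes. *)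
Lemma cvg_integral_outside_ge0 (f : T -> \bar R) : measurable_fun setT f ->
  (forall t, (0 <= f t)%E) -> (forall t, vec t = x -> f t = 0%E) ->
  (\int[mu]_(t in outside x eps) f t)%E @[eps --> 0^'+] -->
  (\int[mu]_t f t)%E.
Proof.
move=> mf f0 fx.
have mfS D : measurable_fun D f by exact: measurable_funS mf.
have := @nonincreasing_at_right_cvge R
  (fun eps => \int[mu]_(t in outside x eps) f t)%E 0 +oo%O isT.
set S := ereal_sup _.
have -> : S = (\int[mu]_t f t)%E.
  apply/eqP; rewrite eq_le; apply/andP; split.
    apply: ge_ereal_sup => _ [eps _ <-].
    by apply: ge0_subset_integral.
  pose F i : set T := outside x (i.+1%:R^-1).
  have nF : {homo F : i j / (i <= j)%N >-> (i <= j)%O}.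
    move=> i j ij; apply/subsetPset => t; rewrite /F/outside/=.
    by apply: le_lt_trans; rewrite lef_pV2 ?posrE// ler_nat.
  have cF := @ge0_nondecreasing_set_cvg_integral _ _ _ F f mu nF
    (fun i => mD _) (fun i => mfS _) (fun i t _ => f0 t).
  have -> : (\int[mu]_t f t = \int[mu]_(t in \bigcup_i F i) f t)%E.
    rewrite [RHS]integral_mkcond; apply: eq_integral => t _; rewrite /patch.
    case: ifPn => // /negP h; apply: fx; apply/eqP/negPn.
    rewrite -dist_gt0; apply/negP => h'; apply: h; rewrite inE.
    have [j _ hj] := near_infty_natSinv_lt (PosNum h').
    by exists j => //; exact: hj (leqnn j).
  rewrite -(cvg_lim _ cF)//; apply: lime_le.
    by apply/cvg_ex; eexists; exact: cF.
  apply: nearW => i; apply: ereal_sup_ubound; exists i.+1%:R^-1 => //=.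
  by rewrite in_itv/= andbT invr_gt0.
apply => a b _ _ ab; apply: ge0_subset_integral => // t.
exact: le_lt_trans.
Qed.

Lemma cvg_integral_outside (f : T -> R) : mu.-integrable setT (EFin \o f) ->
  (forall t, vec t = x -> f t = 0) ->
  \int[mu]_(t in outside x eps) f t @[eps --> 0^'+] --> \int[mu]_t f t.
Proof.
move=> fi fx.
have [mf flt] := integrableP _ _ _ fi.
apply: fine_cvg; rewrite /Rintegral fineK; last exact: integrable_fin_num.
rewrite integralE.
under eq_fun do rewrite integralE.
have pf : (\int[mu]_t (EFin \o f)^\+ t)%E \is a fin_num.
  exact: (integrable_fin_num measurableT (integrable_funepos measurableT fi)).
apply: cvgeB; first by rewrite fin_num_adde_defr.
  apply: cvg_integral_outside_ge0 => //; first exact: measurable_funepos.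
  by move=> t tx; rewrite funeposE/= fx// maxxx.
apply: cvg_integral_outside_ge0 => //; first exact: measurable_funeneg.
by move=> t tx; rewrite funenegE/= fx// oppr0 maxxx.
Qed.

End principal_value.

Section principal_value_convergence.
Context {R : realType} {n : nat}.
Local Notation T := (n.-tuple (measurableTypeR R)).
Local Notation mu := (@lebesgueT R n).
Variables (k : T -> R) (x : 'rV[R]_n) (F : 'rV[R]_n -> R) (C : R).
Hypothesis mk : measurable_fun setT k.
Hypothesis k_ge0 : forall t, 0 <= k t.
Hypothesis k_even : forall t, k (reflect_at x t) = k t.
Hypothesis near_int : mu.-integrable setT
  (EFin \o (fun t => dist x t ^+ 2 * k t * \1_(nearS x 1) t)).
Hypothesis cF : continuous F.
Hypothesis F_sd : forall z, enorm z <= 1 ->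
  `|2 * F x - F (x + z) - F (x - z)| <= C * enorm z ^+ 2.
Hypothesis F_out : forall eps, 0 < eps -> mu.-integrable (outside x eps)
  (EFin \o (fun t => (F x - F (vec t)) * k t)).

(** The symmetrized integrand [G] has the same truncated integrals, by evenness of k, and it is
    absolutely integrable: within distance 1 by the second difference of F, beyond it by [F_out]. *)
Lemma principal_value_converges : exists l : R,
  \int[mu]_(t in outside x eps) ((F x - F (vec t)) * k t) @[eps --> 0^'+] --> l.
Proof.
have mD eps := @measurable_outside R n x eps.
pose f t : R := (F x - F (vec t)) * k t.
pose G t : R := 2^-1 * (f t + f (reflect_at x t)).
have Gout (eps : R) : 0 < eps -> mu.-integrable (outside x eps) (EFin \o G) /\
    \int[mu]_(t in outside x eps) G t = \int[mu]_(t in outside x eps) f t.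
  move=> eps0; have [i1 I1] := Rintegral_reflect (F_out eps0).
  have i2 := integrable_add (mD eps) (F_out eps0) i1.
  split; first exact: (integrable_scale 2^-1 (mD eps) i2).
  rewrite RintegralZl// RintegralD//; last exact: F_out.
  by rewrite I1 -/f; set I := Rintegral _ _ _; field.
have GE t : G t = 2^-1 * (2 * F x - F (vec t) - F (x - (vec t - x))) * k t.
  by rewrite /G /f k_even vec_reflect; ring.
have mF : measurable_fun setT (F \o @vec R n).
  by apply: measurable_fun_vec => // t _; exact: cF.
have mFr : measurable_fun setT (fun t : T => F (x - (vec t - x))).
  rewrite (_ : (fun t : T => _) = (fun y => F (x + x - y)) \o @vec R n).
    apply: measurable_fun_vec => // t _.
    exact: (continuous_comp (@continuous_opp_shift _ _ (x + x) (vec t)) (@cF _)).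
  by apply/funext => t /=; rewrite opprB addrA.
have iG : mu.-integrable setT (EFin \o G).
  apply: (@integrable_le_fun _ _ _ _ _ _ (fun t => 2^-1 * C *
     (dist x t ^+ 2 * k t * \1_(nearS x 1) t) + `|G t| * \1_(outside x 1) t)) => //.
  - rewrite (_ : G = fun t => 2^-1 * (2 * F x - F (vec t) -
       F (x - (vec t - x))) * k t); last by apply/funext => t; exact: GE.
    apply: measurable_funM => //; apply: measurable_funM => //.
    by apply: measurable_funB => //; apply: measurable_funB.
  - apply: integrable_add => //; first exact: integrable_scale.
    apply: integrable_mul_indic; first exact: mD.
    by apply: integrable_norm; exact: (Gout 1 ltr01).1.
  move=> t _; have [h|h] := leP (dist x t) 1.
    rewrite !indicE mem_set// memNset; last by move=> /(le_lt_trans h); rewrite ltxx.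
    rewrite mulr1 mulr0 addr0 GE normrM (ger0_norm (k_ge0 t)) mulrA.
    apply: ler_wpM2r => //; rewrite normrM ger0_norm// -mulrA ler_pM2l//.
    have := F_sd (z := vec t - x); rewrite subrKC -enormN opprB; exact.
  rewrite !indicE [t \in outside x 1]mem_set// memNset; last first.
    by rewrite /nearS/= => /(lt_le_trans h); rewrite ltxx.
  by rewrite !mulr0 add0r mulr1.
exists (\int[mu]_t G t).
have G0 t : vec t = x -> G t = 0.
  by move=> tx; rewrite GE tx subrr subr0; ring.
apply: cvg_trans (cvg_integral_outside iG G0).
apply: near_eq_cvg; near=> eps.
by rewrite (Gout eps _).2.
Unshelve. all: by end_near. Qed.

End principal_value_convergence.

(** * Regularity of the directional derivative of a C^3 function *)

Section directional_regularity.
Context {R : realType} {n : nat}.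
Variables (u : 'rV[R]_n -> R) (e x : 'rV[R]_n).
Hypothesis cu : Ck 3 u.
Local Notation D i := ('D_(delta_mx ord0 i) u).

Let du y : differentiable u y. Proof. by case: cu. Qed.
Let Du i : Ck 2 (D i). Proof. by move: cu => [_]; apply. Qed.

Let DeE y : 'D_e u y = \sum_(i < n) e ord0 i * D i y.
Proof. exact: derive_coordE. Qed.

Lemma Ck3_is_derive y : is_derive y e u ('D_e u y).
Proof. exact/derivableP/diff_derivable. Qed.

Lemma Ck3_directional_continuous : continuous ('D_e u).
Proof.
rewrite (_ : 'D_e u = fun y => \sum_(i < n) e ord0 i * D i y); last first.
  by apply/funext => y; exact: DeE.
apply: (continuous_big (op := +%R) (x0 := 0 : R)) => [|i _ y].
  exact: add_continuous.
have c1 : {for y, continuous (D i)} := @Ck_continuous _ _ 2 _ (Du i) y.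
have c2 : D i z @[z --> y] --> D i y := c1.
have c3 : e ord0 i * D i z @[z --> y] --> e ord0 i * D i y.
  exact: (cvgM (cvg_cst _) c2).
exact: c3.
Qed.

Lemma Ck3_directional_lipschitz : exists C : R, 0 <= C /\ forall z, enorm z <= 1 ->
  `|'D_e u (x + z) - 'D_e u x| <= C * enorm z.
Proof.
have D1 i : Ck 1 (D i).
  by case: (Du i) => d1 d2; split=> // j; exact: (@Ck_continuous _ _ 1 _ (d2 j)).
have [C hC] := fin_all_exists (fun i => Ck1_lipschitz x 1 (D1 i)).
exists (\sum_i `|e ord0 i| * C i); split.
  by apply: sumr_ge0 => i _; rewrite mulr_ge0// (hC i).1.
move=> z z1; rewrite !DeE -sumrB mulr_suml.
apply: (le_trans (ler_norm_sum _ _ _)); apply: ler_sum => i _.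
rewrite -mulrBr normrM -mulrA; apply: ler_wpM2l => //.
have [C0 h] := hC i.
have := h x (x + z); rewrite subrr normr0 ler01 addrAC subrr add0r.
move=> /(_ isT (le_trans (norm_le_enorm _) z1)) h1.
by apply: (le_trans h1); apply: ler_wpM2l => //; exact: norm_le_enorm.
Qed.

Lemma Ck3_directional_second_difference : exists C : R, 0 <= C /\
  forall z, enorm z <= 1 ->
  `|2 * 'D_e u x - 'D_e u (x + z) - 'D_e u (x - z)| <= C * enorm z ^+ 2.
Proof.
have [C hC] := fin_all_exists (fun i => Ck2_second_difference x (Du i)).
exists (\sum_i `|e ord0 i| * C i); split.
  by apply: sumr_ge0 => i _; rewrite mulr_ge0// (hC i).1.
move=> z z1; rewrite !DeE mulr_sumr -!sumrB mulr_suml.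
apply: (le_trans (ler_norm_sum _ _ _)); apply: ler_sum => i _.
rewrite (_ : _ - _ = e ord0 i * (2 * D i x - D i (x + z) - D i (x - z))); last by ring.
rewrite normrM -mulrA; apply: ler_wpM2l => //.
have [C0 h] := hC i.
apply: le_trans (h z (le_trans (norm_le_enorm _) z1)) _.
by apply: ler_wpM2l => //; rewrite lerXn2r ?nnegrE ?enorm_ge0 ?norm_le_enorm.
Qed.

End directional_regularity.

(** * The inequality at a point for a general decomposition w = p - m *)

Section bernstein.
Context {R : realType} {n : nat}.
Local Notation T := (n.-tuple (measurableTypeR R)).
Local Notation mu := (@lebesgueT R n).
Local Notation N := (n%:R : R).
Variables (s1 s2 lambda Lambda Q M : R) (g : R -> R) (K : 'rV[R]_n -> \bar R).
Variables (eta u w p m : 'rV[R]_n -> R) (x e : 'rV[R]_n) (Bu sigma : R).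
Hypothesis n_gt0 : (0 < n)%N.
Hypothesis s1_gt0 : 0 < s1.
Hypothesis s2_lt1 : s2 < 1.
Hypothesis lambda_gt0 : 0 < lambda.
Hypothesis lambda_le : lambda <= Lambda.
Hypothesis Lambda_le : Lambda <= Q.
Hypothesis Lambda_leM : Lambda <= Q * lambda.
Hypothesis g_ge0 : forall r : R, 0 < r -> 0 <= g r.
Hypothesis g_decr : forall r r' : R, 0 < r -> r < r' -> g r' < g r.
Hypothesis g_derivable : forall r : R, 0 < r -> derivable g r 1.
Hypothesis g_growth : forall r : R, 0 < r ->
     2 * s1 * r^-1 * g r <= `|derive1 g r| <= 2 * s2 * r^-1 * g r.
Hypothesis K_ge0 : forall y, (0 <= K y)%E.
Hypothesis K_even : forall y, K (- y) = K y.
Hypothesis K_bounds : forall y, y != 0 ->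
  ((lambda * enorm y ^- n * g (enorm y))%:E <= K y)%E /\
  (K y <= (Lambda * enorm y ^- n * g (enorm y))%:E)%E.
Hypothesis K_differentiable :
  forall y, y != 0 -> differentiable (fun z => fine (K z)) y.
Hypothesis K_gradient : forall y, y != 0 ->
     ((enorm (grad (fun z => fine (K z)) y))%:E
        <= (Lambda * (enorm y)^-1)%:E * K y)%E.
Hypothesis M_gt0 : 0 < M.
Hypothesis deta : forall y, differentiable eta y.
Hypothesis D_le : forall y (i : 'I_n), `|'D_(delta_mx ord0 i) eta y| <= M.
Hypothesis D_lip : forall y y' (i : 'I_n), `|'D_(delta_mx ord0 i) eta y -
        'D_(delta_mx ord0 i) eta y'| <= M * enorm (y - y').
Hypothesis eta_ge0 : forall y, 0 <= eta y.
Hypothesis eta_le : forall y, eta y <= M.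
Hypothesis e1 : enorm e = 1.
Hypothesis du : forall y, is_derive y e u (w y).
Hypothesis cu : continuous u.
Hypothesis cw : continuous w.
Hypothesis u_le : forall y, `|u y| <= Bu.
Hypothesis wE : forall y, w y = p y - m y.
Hypothesis pm0 : p x * m x = 0.
Hypothesis pm_ge0 : forall y, 0 <= p x * m y.
Hypothesis w_out : forall eps, 0 < eps -> mu.-integrable (outside x eps)
  (EFin \o (fun t => (w x - w (vec t)) * kern K x t)).

Hypothesis w_lip : exists C : R, 0 <= C /\ forall z, enorm z <= 1 ->
  `|w (x + z) - w x| <= C * enorm z.
Hypothesis w_sd : exists C : R, 0 <= C /\ forall z, enorm z <= 1 ->
  `|2 * w x - w (x + z) - w (x - z)| <= C * enorm z ^+ 2.
Hypothesis u_sd : exists C : R, 0 <= C /\ forall z, enorm z <= 1 ->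
  `|2 * u x - u (x + z) - u (x - z)| <= C * enorm z ^+ 2.
Hypothesis mp : measurable_fun setT (p \o @vec R n).
Hypothesis mm : measurable_fun setT (m \o @vec R n).
Hypothesis sigma_ge : threshold n s1 s2 Q M <= sigma.

Local Notation k := (kern K x).

Let k_ge0 t : 0 <= k t. Proof. exact: kern_ge0. Qed.

Let mk : measurable_fun setT k. Proof. exact: measurable_kern. Qed.

Let mD eps : measurable (outside x eps : set T).
Proof. exact: measurable_outside. Qed.

Let k_even t : k (reflect_at x t) = k t. Proof. exact: kern_reflect. Qed.

Let k_out eps : 0 < eps -> mu.-integrable (outside x eps) (EFin \o k).
Proof.
exact: (kern_outside_integrable x s1_gt0 lambda_gt0 lambda_le g_ge0 g_decr
  g_derivable g_growth K_ge0 K_bounds K_differentiable).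
Qed.

Let near_int : mu.-integrable setT
  (EFin \o (fun t => dist x t ^+ 2 * k t * \1_(nearS x 1) t)).
Proof.
exact: (near_mass s2_lt1 lambda_gt0 lambda_le g_ge0 g_decr
  g_derivable g_growth K_ge0 K_bounds K_differentiable x ltr01).1.
Qed.

Let kx t : vec t = x -> k t = 0.
Proof. by move=> tx; rewrite /kern tx eqxx. Qed.

Let mv (f : 'rV[R]_n -> R) : continuous f -> measurable_fun setT (f \o @vec R n).
Proof. by move=> cf; apply: measurable_fun_vec => // t _; exact: cf. Qed.

Let ceta : continuous eta.
Proof. by move=> y; exact/differentiable_continuous. Qed.

Let de (t : T) : R := eta x - eta (vec t).

Let de_le t : `|de t| <= M.
Proof.
rewrite ler_norml; have := eta_ge0 x; have := eta_ge0 (vec t).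
by have := eta_le x; have := eta_le (vec t); move=> *; apply/andP; split;
  rewrite /de; lra.
Qed.

Lemma integral_LintegrandE (F : 'rV[R]_n -> R) eps : 0 < eps ->
  (\int[mu]_(t in outside x eps) Lintegrand K F x t =
   \int[mu]_(t in outside x eps) ((F x - F (vec t)) * k t)%:E)%E.
Proof.
move=> eps0; apply: eq_integral => t; rewrite inE /outside/= => ht.
rewrite /Lintegrand (kernE K_ge0 K_bounds)//.
by rewrite -dist_gt0; exact: lt_trans ht.
Qed.

Lemma Lop_cvg (F : 'rV[R]_n -> R) (l : \bar R) :
  (\int[mu]_(t in outside x eps) ((F x - F (vec t)) * k t)%:E)%E
    @[eps --> 0^'+] --> l -> Lop K F x = l.
Proof.
move=> h; apply: cvg_lim => //; apply: cvg_trans h; apply: near_eq_cvg.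
by near=> eps; rewrite integral_LintegrandE.
Unshelve. all: by end_near. Qed.

Lemma Lop_cvg_fin (F : 'rV[R]_n -> R) (l : R) :
  (forall eps, 0 < eps -> mu.-integrable (outside x eps)
     (EFin \o (fun t => (F x - F (vec t)) * k t))) ->
  \int[mu]_(t in outside x eps) ((F x - F (vec t)) * k t) @[eps --> 0^'+] --> l ->
  Lop K F x = l%:E.
Proof.
move=> iF h; apply: Lop_cvg.
have : (\int[mu]_(t in outside x eps) ((F x - F (vec t)) * k t))%:E
  @[eps --> 0^'+] --> l%:E by apply: cvg_EFin => //; exact: nearW.
apply: cvg_trans; apply: near_eq_cvg.
by near=> eps; rewrite Rintegral_EFin//; exact: iF.
Unshelve. all: by end_near. Qed.

Let u_out eps : 0 < eps -> mu.-integrable (outside x eps)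
  (EFin \o (fun t => (u x - u (vec t)) * k t)).
Proof.
move=> eps0; apply: (@integrable_le_fun _ _ _ _ _ _ (fun t => 2 * Bu * k t)) => //.
- apply: measurable_funS (_ : measurable_fun setT _) => //.
  by apply: measurable_funM => //; apply: measurable_funB => //; exact: mv.
- by apply: integrable_scale => //; exact: k_out.
move=> t _; rewrite normrM (ger0_norm (k_ge0 t)); apply: ler_wpM2r => //.
apply: (le_trans (ler_normB _ _)).
by have := u_le x; have := u_le (vec t); lra.
Qed.

(** It vanishes at x, and its increment [flux x - flux y] is w(y) (eta(x) - eta(y)): the left side
    to be estimated is a principal value of the same kind as those of u and w. *)
Let flux (y : 'rV[R]_n) : R := w y * (eta y - eta x).

Let flux_out eps : 0 < eps -> mu.-integrable (outside x eps)
  (EFin \o (fun t => (flux x - flux (vec t)) * k t)).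
Proof.
move=> eps0.
apply: (@integrable_le_fun _ _ _ _ _ _ (fun t => M * (`|w (vec t)| * k t))) => //.
- apply: measurable_funS (_ : measurable_fun setT _) => //.
  apply: measurable_funM => //; apply: measurable_funB => //.
  apply: measurable_funM; first exact: mv.
  by apply: measurable_funB => //; exact: mv.
- apply: integrable_scale => //.
  exact: (derivative_outside_integrable s1_gt0 lambda_gt0 lambda_le g_ge0 g_decr
    g_derivable g_growth K_ge0 K_bounds K_differentiable cw w_out).
move=> t _; rewrite /flux subrr mulr0 sub0r normrM (ger0_norm (k_ge0 t)) mulrA.
apply: ler_wpM2r => //; rewrite normrN normrM mulrC.
by apply: ler_wpM2r => //; rewrite distrC; exact: de_le.
Qed.

(** The flux is no more regular than eta, so it need not be C^2. At the centre x its second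
    difference still is quadratic: it consists of products of increments of w and eta, both
    Lipschitz, and of w(x) times the second difference of eta. *)
Let flux_sd : exists C : R, forall z, enorm z <= 1 ->
  `|2 * flux x - flux (x + z) - flux (x - z)| <= C * enorm z ^+ 2.
Proof.
have [C [C0 hC]] := w_lip.
exists (2 * (C * (N * M)) + `|w x| * (2 * N * M)) => z z1.
have z1' : enorm (- z) <= 1 by rewrite enormN.
set d1 := eta (x + z) - eta x; set d2 := eta (x - z) - eta x.
have -> : 2 * flux x - flux (x + z) - flux (x - z) =
  - ((w (x + z) - w x) * d1) - (w (x - z) - w x) * d2 - w x * (d1 + d2).
  by rewrite /flux -/d1 -/d2; ring.
have h1 : `|d1| <= N * M * enorm z := C11_lipschitz deta D_le x z.
have h2 : `|d2| <= N * M * enorm z.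
  by rewrite -[enorm z]enormN; exact: (C11_lipschitz deta D_le x (- z)).
have h3 : `|d1 + d2| <= 2 * N * M * enorm z ^+ 2.
  rewrite -normrN (_ : - (d1 + d2) = 2 * eta x - eta (x + z) - eta (x - z)).
    exact: (C11_second_difference deta (ltW M_gt0) D_lip).
  by rewrite /d1 /d2; ring.
have t1 := normrM_le (hC z z1) h1.
have t2 := normrM_le (hC _ z1') h2; rewrite enormN in t2.
have t3 := ler_wpM2l (normr_ge0 (w x)) h3; rewrite -normrM in t3.
apply: (le_trans (ler_normB _ _)).
have := ler_normB (- ((w (x + z) - w x) * d1)) ((w (x - z) - w x) * d2).
rewrite normrN; lra.
Qed.

Let energy_measurable :
  measurable_fun setT (fun t => energy eta p m x t * k t).
Proof.
have me : measurable_fun setT (eta \o @vec R n) by exact: mv.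
apply: measurable_funM => //; apply: measurable_funD.
  apply: measurable_funX; apply: measurable_funB => //.
  exact: measurable_funM.
apply: measurable_funM; first exact: measurable_funM.
exact: measurable_funM.
Qed.

Let gap_measurable : measurable_fun setT (fun t => gap u x t * k t).
Proof.
apply: measurable_funM => //; apply: measurable_funX.
by apply: measurable_funB => //; exact: mv.
Qed.

Let sigma_gt0 : 0 < sigma.
Proof.
apply: lt_le_trans sigma_ge; apply: threshold_gt0 => //.
by apply: le_trans Lambda_le; apply: le_trans lambda_le; exact: ltW.
Qed.

(* The nonnegative defect by which [L] fails to be a derivation. *)
Let defect t : R := (energy eta p m x t + sigma * gap u x t) * k t.

Let energyk_ge0 t : 0 <= energy eta p m x t * k t.
Proof. by apply: mulr_ge0 => //; exact: energy_ge0. Qed.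

Let gapk_ge0 t : 0 <= gap u x t * k t.
Proof. by apply: mulr_ge0 => //; exact: gap_ge0. Qed.

Let defectE t : defect t = energy eta p m x t * k t + sigma * (gap u x t * k t).
Proof. by rewrite /defect mulrDl mulrA. Qed.

Let defect_ge0 t : 0 <= defect t.
Proof.
by rewrite defectE addr_ge0// mulr_ge0// ltW.
Qed.

Let defect_measurable : measurable_fun setT defect.
Proof.
rewrite (_ : defect = fun t => energy eta p m x t * k t +
  sigma * (gap u x t * k t)); last by apply/funext => t; exact: defectE.
by apply: measurable_funD => //; exact: measurable_funM.
Qed.

Let pw : p x * w x = p x ^+ 2.
Proof. by rewrite wE mulrBr pm0 subr0. Qed.

(** L of the left function is a combination of the finite principal values of w, u and the flux,
    minus the integral of [defect]. The claim is then that [cc * lf] is at most that integral, which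
    [core_estimate] gives for small eps before passing to the limit. *)
Theorem bernstein_inequality :
  (Lop K (fun y => eta y ^+ 2 * p y ^+ 2 + sigma * u y ^+ 2)%R x <=
   (2 * eta x ^+ 2)%:E * Lop K w x * (p x)%:E +
   (2 * sigma)%:E * Lop K u x * (u x)%:E)%E.
Proof.
have [Cu [_ hCu]] := u_sd; have [Cw [_ hCw]] := w_sd; have [Cf hCf] := flux_sd.
have cf : continuous flux.
  move=> y; have c1 : eta z @[z --> y] --> eta y by exact: ceta.
  have c2 : w z @[z --> y] --> w y by exact: cw.
  have c3 : eta z - eta x @[z --> y] --> eta y - eta x.
    exact: (cvgB c1 (cvg_cst _)).
  exact: (cvgM c2 c3).
have [lu hu] := principal_value_converges mk k_ge0 k_even near_int cu hCu u_out.
have [lw hw] := principal_value_converges mk k_ge0 k_even near_int cw hCw w_out.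
have [lf hf] := principal_value_converges mk k_ge0 k_even near_int cf hCf flux_out.
rewrite (Lop_cvg_fin u_out hu) (Lop_cvg_fin w_out hw).
set ca := 2 * eta x ^+ 2 * p x; set cb := 2 * sigma * u x.
set cc := 2 * (eta x * p x).
set h := fun y => _ + _.
have -> : Lop K h x = ((ca * lw + cb * lu + cc * lf)%:E -
    \int[mu]_t (defect t)%:E)%E.
  apply: Lop_cvg.
  pose a t : R := ca * ((w x - w (vec t)) * k t) + cb * ((u x - u (vec t)) * k t)
    + cc * ((flux x - flux (vec t)) * k t).
  (* From a^2 - b^2 = 2 a (a - b) - (a - b)^2 for both squares. Writing p(y) = w(y) + m(y) in the
     linear term gives the increments of w and of the flux, and the m(y) part is the cross term of
     the energy. *)
  have hE t : (h x - h (vec t)) * k t = a t - defect t.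
    rewrite /a /defect /energy /gap /flux /ca /cb /cc /h.
    have pmy : w (vec t) = p (vec t) - m (vec t) by exact: wE.
    have -> : 2 * eta x ^+ 2 * p x * ((w x - w (vec t)) * k t) =
      2 * eta x ^+ 2 * (p x ^+ 2 - p x * w (vec t)) * k t.
      by rewrite -pw; ring.
    by rewrite pmy; ring.
  have ia (eps : R) : 0 < eps -> mu.-integrable (outside x eps) (EFin \o a) /\
    \int[mu]_(t in outside x eps) a t =
     ca * \int[mu]_(t in outside x eps) ((w x - w (vec t)) * k t) +
     cb * \int[mu]_(t in outside x eps) ((u x - u (vec t)) * k t) +
     cc * \int[mu]_(t in outside x eps) ((flux x - flux (vec t)) * k t).
    move=> eps0.
    have i1 := integrable_scale ca (mD eps) (w_out eps0).
    have i2 := integrable_scale cb (mD eps) (u_out eps0).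
    have i3 := integrable_scale cc (mD eps) (flux_out eps0).
    have i12 := integrable_add (mD eps) i1 i2.
    split; first exact: (integrable_add (mD eps) i12 i3).
    have [[j1 j2] j3] := (w_out eps0, u_out eps0, flux_out eps0).
    by rewrite /a RintegralD// RintegralD// !RintegralZl.
  have ca_cvg : (\int[mu]_(t in outside x eps) a t)%:E @[eps --> 0^'+] -->
      (ca * lw + cb * lu + cc * lf)%:E.
    have c0 : ca * \int[mu]_(t in outside x eps) ((w x - w (vec t)) * k t) +
      cb * \int[mu]_(t in outside x eps) ((u x - u (vec t)) * k t) +
      cc * \int[mu]_(t in outside x eps) ((flux x - flux (vec t)) * k t)
      @[eps --> 0^'+] --> ca * lw + cb * lu + cc * lf.
      exact: (cvgD (cvgD (cvgM (cvg_cst ca) hw) (cvgM (cvg_cst cb) hu))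
        (cvgM (cvg_cst cc) hf)).
    apply: cvg_EFin; first exact: nearW.
    apply: cvg_trans c0; apply: near_eq_cvg; near=> eps.
    by rewrite /= (ia eps _).2.
  have cd : (\int[mu]_(t in outside x eps) (defect t)%:E)%E @[eps --> 0^'+] -->
      (\int[mu]_t (defect t)%:E)%E.
    apply: cvg_integral_outside_ge0.
    - exact/measurable_EFinP.
    - by move=> t; rewrite lee_fin.
    - by move=> t tx; rewrite /defect kx// mulr0.
  have dd : ((ca * lw + cb * lu + cc * lf)%:E +?
    - \int[mu]_t (defect t)%:E)%E by rewrite fin_num_adde_defr.
  have cab : ((\int[mu]_(t in outside x eps) a t)%:E -
    \int[mu]_(t in outside x eps) (defect t)%:E)%E @[eps --> 0^'+] -->
    ((ca * lw + cb * lu + cc * lf)%:E - \int[mu]_t (defect t)%:E)%E.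
    exact: (cvgeB dd ca_cvg cd).
  apply: cvg_trans cab; apply: near_eq_cvg; near=> eps.
  have e0 : 0 < eps by near: eps; exact: nbhs_right_gt.
  rewrite -Rintegral_EFin//; last exact: (ia eps e0).1.
  rewrite -integral_sub_ge0//; last 2 first.
  - exact: (ia eps e0).1.
  - exact: measurable_funS defect_measurable.
  by apply: eq_integral => t _; rewrite hE.
have D0 : (0 <= \int[mu]_t (defect t)%:E)%E.
  by apply: integral_ge0 => t _; rewrite lee_fin.
(* An infinite defect makes the left side -oo. *)
have [Dfin|] := boolP ((\int[mu]_t (defect t)%:E)%E \is a fin_num); last first.
  by rewrite ge0_fin_numE// -leNgt leye_eq => /eqP ->; rewrite /= leNye.
have iD : mu.-integrable setT (EFin \o defect).
  apply/integrableP; split; first exact/measurable_EFinP.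
  rewrite (eq_integral (fun t => (defect t)%:E)) ?ltey_eq ?Dfin//.
  by move=> t _ /=; rewrite ger0_norm.
have iE : mu.-integrable setT (EFin \o (fun t => energy eta p m x t * k t)).
  apply: (integrable_le_fun _ energy_measurable iD) => // t _.
  by rewrite ger0_norm// defectE lerDl mulr_ge0// ltW.
have iU : mu.-integrable setT (EFin \o (fun t => gap u x t * k t)).
  apply: (integrable_le_fun _ gap_measurable
    (integrable_scale sigma^-1 measurableT iD)) => // t _.
  by rewrite ger0_norm// defectE ler_pdivlMl// lerDr.
rewrite Rintegral_EFin// -!EFinM -EFinB -EFinD lee_fin.
have -> : \int[mu]_t defect t = \int[mu]_t (energy eta p m x t * k t) +
    sigma * \int[mu]_t (gap u x t * k t).
  rewrite (_ : defect = fun t => energy eta p m x t * k t +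
    sigma * (gap u x t * k t)); last by apply/funext => t; exact: defectE.
  have iU' := integrable_scale sigma measurableT iU.
  by rewrite RintegralD// RintegralZl.
set E := \int[mu]_t _; set U := \int[mu]_t _.
have E0 : 0 <= E by apply: Rintegral_ge0 => t _.
have U0 : 0 <= U by apply: Rintegral_ge0 => t _.
have sU := ler_wpM2r U0 sigma_ge.
have sU0 : 0 <= sigma * U by rewrite mulr_ge0// ltW.
suff cf_le : cc * lf <= E + sigma * U by rewrite /ca /cb; lra.
(* At a zero of eta the scale rho degenerates, but the coefficient of the flux vanishes as well. *)
have [eta0|eta0] := eqVneq (eta x) 0.
  by rewrite /cc eta0 mul0r mulr0 mul0r addr_ge0.
have eta_gt0 : 0 < eta x by rewrite lt_neqAle eq_sym eta0 eta_ge0.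
have [rho0 [rho0_gt0 hcore]] := core_estimate n_gt0 s1_gt0 s2_lt1 lambda_gt0
  lambda_le Lambda_le Lambda_leM g_ge0 g_decr g_derivable g_growth K_ge0 K_even
  K_bounds K_differentiable K_gradient M_gt0 deta D_le D_lip eta_ge0 eta_le e1
  du cu cw u_le wE pm0 pm_ge0 w_out eta_gt0.
have hcf : cc * \int[mu]_(t in outside x eps) ((flux x - flux (vec t)) * k t)
  @[eps --> 0^'+] --> cc * lf by exact: (cvgM (cvg_cst cc) hf).
rewrite -(cvg_lim _ hcf)//; apply: limr_le.
  by apply/cvg_ex; eexists; exact: hcf.
near=> eps.
have e0 : 0 < eps by near: eps; exact: nbhs_right_gt.
have er : eps <= rho0 by near: eps; exact: nbhs_right_le.
have := hcore eps e0 er iE iU; rewrite -/cc -/E -/U.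
have -> : (fun t => (flux x - flux (vec t)) * k t) =
  (fun t => w (vec t) * (eta x - eta (vec t)) * k t).
  by apply/funext => t; rewrite /flux; ring.
lra.
Unshelve. all: by end_near. Qed.

End bernstein.

(** * From smooth enough functions to the two inequalities *)

Lemma bounded_fun_norm (R : realType) (n : nat) (u : 'rV[R]_n -> R) :
  bounded_fun u -> exists B : R, forall y, `|u y| <= B.
Proof.
move=> [B [_ hB]]; exists (B + 1) => y.
by apply: (hB (B + 1)) => //; rewrite ltrDl.
Qed.

(** [Lambda / Num.min lambda 1] is the maximum of Lambda and Lambda/lambda, the least Q for which
    both [Lambda <= Q], used for the gradient of K, and [Lambda <= Q * lambda], used for its size,
    hold. The norm of eta is increased by 1 because the scale rho divides by M, and eta may be
    zero. *)
Lemma smooth_enough_bernstein (R : realType) (n : nat)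
    (s1 s2 lambda Lambda : R) (g : R -> R) (K : 'rV[R]_n -> \bar R)
    (eta : 'rV[R]_n -> R) :
  (0 < n)%N -> 0 < s1 -> s2 < 1 -> 0 < lambda -> lambda <= Lambda ->
  (forall r, 0 < r -> 0 <= g r) ->
  (forall r r', 0 < r -> r < r' -> g r' < g r) ->
  (forall r, 0 < r -> derivable g r 1) ->
  (forall r, 0 < r ->
     2 * s1 * r^-1 * g r <= `|derive1 g r| <= 2 * s2 * r^-1 * g r) ->
  (forall y, (0 <= K y)%E) ->
  (forall y, K (- y) = K y) ->
  (forall y, y != 0 ->
     ((lambda * enorm y ^- n * g (enorm y))%:E <= K y)%E /\
     (K y <= (Lambda * enorm y ^- n * g (enorm y))%:E)%E) ->
  (forall y, y != 0 -> differentiable (fun z => fine (K z)) y) ->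
  (forall y, y != 0 ->
     ((enorm (grad (fun z => fine (K z)) y))%:E
        <= (Lambda * (enorm y)^-1)%:E * K y)%E) ->
  C11 eta ->
  (forall x, 0 <= eta x) ->
  forall (sigma : R) (e : 'rV[R]_n) (u p m : 'rV[R]_n -> R) (x : 'rV[R]_n),
  threshold n s1 s2 (Lambda / Num.min lambda 1) (fine (C11norm eta) + 1)
    <= sigma ->
  enorm e = 1 -> smooth_enough K e u ->
  (forall y, 'D_e u y = p y - m y) ->
  p x * m x = 0 -> (forall y, 0 <= p x * m y) ->
  measurable_fun setT (p \o @vec R n) -> measurable_fun setT (m \o @vec R n) ->
  (Lop K (fun y => eta y ^+ 2 * p y ^+ 2 + sigma * u y ^+ 2)%R x <=
   (2 * eta x ^+ 2)%:E * Lop K ('D_e u) x * (p x)%:E +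
   (2 * sigma)%:E * Lop K u x * (u x)%:E)%E.
Proof.
move=> n_gt0 s1_gt0 s2_lt1 l_gt0 l_le g_ge0 g_decr g_der g_growth K_ge0 K_even
  K_bounds K_diff K_grad eta11 eta_ge0 sigma e u p m x sigma_ge e1
  [cu /bounded_fun_norm[Bu u_le] w_int] wE pm0 pm_ge0 mp mm.
have [M0 eta_le D_le D_lip] := C11_bounds n_gt0 eta11.
set M := fine (C11norm eta) in M0 eta_le D_le D_lip sigma_ge.
have min_gt0 : 0 < Num.min lambda 1 by rewrite lt_min l_gt0 ltr01.
have L_ge0 : 0 <= Lambda by apply: le_trans l_le; exact: ltW.
have MM : M <= M + 1 by rewrite lerDl.
have w_out eps : 0 < eps -> (lebesgueT n).-integrable (outside x eps)
    (EFin \o (fun t => ('D_e u x - 'D_e u (vec t)) * kern K x t)).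
  move=> eps0; apply: eq_integrable (w_int x eps eps0).
    exact: measurable_outside.
  move=> t; rewrite inE /outside/= => ht.
  rewrite /Lintegrand (kernE K_ge0 K_bounds)//.
  by rewrite -dist_gt0; exact: lt_trans ht.
have cu2 : Ck 2 u.
  by case: (cu) => d1 d2; split=> // i; case: (d2 i) => d3 d4; split=> // j;
    exact: (@Ck_continuous _ _ 1 _ (d4 j)).
have u_sd : exists C : R, 0 <= C /\ forall z, enorm z <= 1 ->
    `|2 * u x - u (x + z) - u (x - z)| <= C * enorm z ^+ 2.
  have [C [C0 hC]] := Ck2_second_difference x cu2; exists C; split=> // z z1.
  apply: le_trans (hC z (le_trans (norm_le_enorm _) z1)) _.
  by apply: ler_wpM2l => //; rewrite lerXn2r ?nnegrE ?enorm_ge0 ?norm_le_enorm.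
apply: (@bernstein_inequality R n s1 s2 lambda Lambda (Lambda / Num.min lambda 1)
  (M + 1) g K eta u ('D_e u) p m x e Bu) => //.
- rewrite ler_pdivlMr// -[leRHS]mulr1; apply: ler_wpM2l => //.
  by rewrite ge_min lexx orbT.
- rewrite mulrAC ler_pdivlMr//; apply: ler_wpM2l => //.
  by rewrite ge_min lexx.
- exact: ltr_wpDl.
- by case: eta11.
- by move=> y i; exact: le_trans (D_le y i) MM.
- move=> y y' i; apply: (le_trans (D_lip y y' i)); apply: ler_wpM2r => //.
  exact: enorm_ge0.
- by move=> y; apply: le_trans MM; apply: le_trans (eta_le y); exact: ler_norm.
- by move=> y; exact: Ck3_is_derive.
- exact: (@Ck_continuous _ _ 3).
- exact: Ck3_directional_continuous.
- exact: Ck3_directional_lipschitz.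
- exact: Ck3_directional_second_difference.
Qed.

Unset Implicit Arguments.

Theorem theorem7p9 (R : realType) :
  exists sigma0 : nat -> R -> R -> R -> R -> R,
  forall (n : nat) (s1 s2 lambda Lambda : R) (g : R -> R)
    (K : 'rV[R]_n -> \bar R) (eta : 'rV[R]_n -> R),
  (0 < n)%N ->
  0 < s1 -> s1 <= s2 -> s2 < 1 ->
  0 < lambda -> lambda <= Lambda ->
  (* g : (0,oo) -> [0,oo) *)
  (forall r, 0 < r -> 0 <= g r) ->
  (forall r r', 0 < r -> r < r' -> g r' < g r) ->
  (forall r, 0 < r -> derivable g r 1) ->
  (forall r, 0 < r ->
     2 * s1 * r^-1 * g r <= `|derive1 g r| <= 2 * s2 * r^-1 * g r) ->
  (* K : R^n -> [0,oo] *)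
  (forall y, (0 <= K y)%E) ->
  (forall y, K (- y) = K y) ->
  (forall y, y != 0 ->
     ((lambda * enorm y ^- n * g (enorm y))%:E <= K y)%E /\
     (K y <= (Lambda * enorm y ^- n * g (enorm y))%:E)%E) ->
  (forall y, y != 0 -> differentiable (fun z => fine (K z)) y) ->
  (forall y, y != 0 ->
     ((enorm (grad (fun z => fine (K z)) y))%:E
        <= (Lambda * (enorm y)^-1)%:E * K y)%E) ->
  C11 eta ->
  (forall x, 0 <= eta x) ->
  let sig0 :=
    sigma0 n s1 s2 (Lambda / Num.min lambda 1) (fine (C11norm eta)) in
  0 < sig0 /\
  forall (sigma : R) (e : 'rV[R]_n) (u v : 'rV[R]_n -> R),
  sig0 <= sigma -> enorm e = 1 ->
  smooth_enough K e u -> smooth_enough K e v ->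
  (forall x,
    (Lop K (fun y => eta y ^+ 2 * ('D_e u y) ^+ 2 + sigma * u y ^+ 2)%R x
     <= (2 * eta x ^+ 2)%:E * Lop K ('D_e u) x * ('D_e u x)%:E
        + (2 * sigma)%:E * Lop K u x * (u x)%:E)%E) /\
  (forall x,
    (Lop K (fun y => eta y ^+ 2 * (Num.max ('D_e v y) 0) ^+ 2
                     + sigma * v y ^+ 2)%R x
     <= (2 * eta x ^+ 2)%:E * Lop K ('D_e v) x * (Num.max ('D_e v x) 0)%:E
        + (2 * sigma)%:E * Lop K v x * (v x)%:E)%E).
Proof.
exists (fun n s1 s2 Q M => threshold n s1 s2 Q (M + 1)).
move=> n s1 s2 lambda Lambda g K eta n_gt0 s1_gt0 s12 s2_lt1 l_gt0 l_le g_ge0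
  g_decr g_der g_growth K_ge0 K_even K_bounds K_diff K_grad eta11 eta_ge0 sig0.
split.
  apply: threshold_gt0 => //; apply: divr_ge0.
    by apply: le_trans l_le; exact: ltW.
  by rewrite le_min ler01 ltW.
move=> sigma e u v sigma_ge e1 su sv.
have mv (f : 'rV[R]_n -> R) : continuous f -> measurable_fun setT (f \o @vec R n).
  by move=> cf; apply: measurable_fun_vec => // t _; exact: cf.
have H := smooth_enough_bernstein n_gt0 s1_gt0 s2_lt1 l_gt0 l_le g_ge0 g_decr
  g_der g_growth K_ge0 K_even K_bounds K_diff K_grad eta11 eta_ge0 _ e1.
split=> x.
  have mw : measurable_fun setT ('D_e u \o @vec R n).
    by apply: mv; apply: Ck3_directional_continuous; case: su.
  apply: (H _ _ _ (fun=> 0)) => //.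
  - by move=> y; rewrite subr0.
  - by rewrite mulr0.
  - by move=> y; rewrite mulr0.
  - exact: measurable_cst.
have mw : measurable_fun setT ('D_e v \o @vec R n).
  by apply: mv; apply: Ck3_directional_continuous; case: sv.
apply: (H _ _ (fun y => Num.max ('D_e v y) 0) (fun y => Num.max (- 'D_e v y) 0)) => //.
- by move=> y; rewrite /Num.max; do 2 case: ifPn => ?; lra.
- have [h|h] := leP 0 ('D_e v x).
    by rewrite [Num.max (- _) 0]max_r ?mulr0// oppr_le0.
  by rewrite mul0r.
- by move=> y; apply: mulr_ge0; rewrite le_max lexx orbT.
- exact: measurable_maxr.
- apply: measurable_maxr => //; exact: measurableT_comp.
Qed.
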